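(* Let $\varphi$ be a smooth elliptic anisotropy on $\mathbb{R}^2$, let $0<T<\infty$, and let $(u^1,u^2,u^3)$ be a geometric solution on $[0,T)$ which is smooth on $[0,T)\times[0,1]$ (up to the initial time). Suppose that the lengths of the curves are uniformly bounded from below, $$L(u^i(t))\ge\delta>0,\qquad i=1,2,3,\ \text{for any } t\in[0,T),$$ and that there exists a sequence of times $t_j\to T$ such that $$\Big(\sum_{i=1}^3\int_I(\kappa^i_\varphi)^2\varphi^\circ(\nu^i)\,ds\Big)\Big|_{t=t_j}\to\infty\qquad\text{as } j\to\infty.$$ Then there exists a positive constant $C$, depending only on $\delta$ and $\varphi^\circ$, such that $$\sum_{i=1}^3\int_I(\kappa^i_\varphi)^2\varphi^\circ(\nu^i)\,ds\ \ge\ \frac{C}{\sqrt{T-t}}\qquad\text{for any }t\in[0,T).$$ In particular, taking $t=0$, $$\sqrt{T}\ \ge\ \frac{C}{\sum_{i=1}^3\|\kappa^i_\varphi(0,\cdot)\|^2_{L^2(I)}}.$$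
   Context: Anisotropy. An anisotropy is a norm $\varphi:\mathbb{R}^2\to[0,\infty)$; it is smooth if $\varphi\in C^\infty(\mathbb{R}^2\setminus\{0\})$, and elliptic if there is $C>0$ with $D^2(\varphi^2)\ge C\,\mathrm{Id}$ in the distributional sense. The polar norm is $\varphi^\circ(x)=\sup\{\xi\cdot x:\varphi(\xi)\le 1\}$ (also smooth and elliptic). Curves. $I=[0,1]$, $(a,b)^\perp=(-b,a)$. For a regular planar curve $u$: $\tau=u_x/|u_x|=(\sin\theta,-\cos\theta)$, $\nu=\tau^\perp=(\cos\theta,\sin\theta)$, $\partial_s=\partial_x/|u_x|$, $ds=|u_x|\,dx$, $\kappa=\frac{u_{xx}}{|u_x|^2}\cdot\nu$, $\psi(\theta)=\varphi^\circ(\nu)\,(D^2\varphi^\circ(\nu)\tau\cdot\tau)$, $\kappa_\varphi=\psi(\theta)\kappa/\varphi^\circ(\nu)$, $L(u)=\int_Ids$. A superscript $i$ denotes the quantity of the $i$-th curve. $\|\cdot\|_{L^2(I)}$ is taken with respect to arclength $ds$. Geometric solution. Here this means regular maps $u^i:[0,T)\times[0,1]\to\mathbb{R}^2$, $i=1,2,3$, smooth on $[0,T)\times[0,1]$, such that $(u^i_t\cdot\nu^i)\nu^i=\psi(\theta^i)\kappa^i\nu^i$, with $u^i(t,1)=P^i$ for fixed points $P^i\in\mathbb{R}^2$, $u^1(t,0)=u^2(t,0)=u^3(t,0)$ and $\sum_{i=1}^3D\varphi^\circ(\nu^i(t,0))=0$. Equivalently $u_t^i=\psi(\theta^i)\kappa^i\nu^i+\lambda^i\tau^i$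 with $\lambda^i=u^i_t\cdot\tau^i$. The dependence of $C$ on $\varphi^\circ$ is through: constants $m,M$ with $M\ge\psi\ge m>0$; a constant $a_0>0$ depending on $\varphi^\circ$ such that $|\nu^i\cdot\tau^j|\ge a_0$ for $i\ne j$ at the triple junction (such a constant exists as a consequence of $\sum_iD\varphi^\circ(\nu^i)=0$); and upper and lower bounds of $\varphi^\circ$ and an upper bound of $|D\varphi^\circ|$ on the unit circle. *)

(* Defs.v *)
From Stdlib Require Import Reals.
From Coquelicot Require Import Coquelicot.
Open Scope R_scope.

Definition vec : Type := (R * R)%type.

Definition dot (v w : vec) : R := fst v * fst w + snd v * snd w.
Definition vadd (v w : vec) : vec := (fst v + fst w, snd v + snd w).
Definition vscal (c : R) (v : vec) : vec := (c * fst v, c * snd v).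
Definition vlen (v : vec) : R := sqrt (dot v v).
Definition vzero : vec := (0, 0).
Definition perp (v : vec) : vec := (- snd v, fst v).

(* Inverse of [perp]: it sends the normal (cos th, sin th) to the tangent
   (sin th, - cos th). *)
Definition unperp (n : vec) : vec := (snd n, - fst n).

Definition unit_vec (v : vec) : Prop := vlen v = 1.

Definition d1 (f : vec -> R) (p : vec) : R :=
  Derive (fun a => f (a, snd p)) (fst p).
Definition d2 (f : vec -> R) (p : vec) : R :=
  Derive (fun b => f (fst p, b)) (snd p).
Definition grad (f : vec -> R) (p : vec) : vec := (d1 f p, d2 f p).

(* D^2 f(p) v . v *)
Definition hess_quad (f : vec -> R) (p v : vec) : R :=
  d1 (d1 f) p * fst v * fst v + d2 (d1 f) p * fst v * snd v
  + d1 (d2 f) p * snd v * fst v + d2 (d2 f) p * snd v * snd v.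

(* [ex_diff_n _ n] at a point asks that all iterated partial derivatives of
   order at most n exist and are jointly continuous there; at every point of an
   open set this is C^n, so this predicate is only used on open sets. *)
Definition smooth_on (D : vec -> Prop) (f : vec -> R) : Prop :=
  forall (n : nat) (p : vec), D p ->
    ex_diff_n (fun a b => f (a, b)) n (fst p) (snd p).

Definition anisotropy (phi : vec -> R) : Prop :=
  (forall v, 0 <= phi v) /\
  (forall v, phi v = 0 -> v = vzero) /\
  (forall c v, phi (vscal c v) = Rabs c * phi v) /\
  (forall v w, phi (vadd v w) <= phi v + phi w).

Definition smooth_anisotropy (phi : vec -> R) : Prop :=
  smooth_on (fun p => p <> vzero) phi.

Definition supported_in_square (r : R) (f : vec -> R) : Prop :=
  forall p, r < Rmax (Rabs (fst p)) (Rabs (snd p)) -> f p = 0.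

(* The integral over the plane of a continuous function vanishing outside
   [-r,r]^2. *)
Definition square_integral (r : R) (f : vec -> R) : R :=
  RInt (fun a => RInt (fun b => f (a, b)) (- r) r) (- r) r.

(* D^2(phi^2) >= c Id as matrix-valued distributions: the two sides are tested
   against nonnegative functions of class C_c^infty, with the two derivatives
   moved onto the test function. *)
Definition elliptic (phi : vec -> R) : Prop :=
  exists c : R, 0 < c /\
    forall (r : R) (eta : vec -> R) (xi : vec),
      smooth_on (fun _ => True) eta ->
      (forall p, 0 <= eta p) ->
      supported_in_square r eta ->
      square_integral r (fun p => (phi p)^2 * hess_quad eta p xi)
        >= c * dot xi xi * square_integral r eta.

Definition polar (phi : vec -> R) (x : vec) : R :=
  real (Lub_Rbar (fun s => exists xi, phi xi <= 1 /\ s = dot xi x)).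

(* The function psi(th), with th encoded by the unit normal
   n = (cos th, sin th). *)
Definition psi (phi : vec -> R) (n : vec) : R :=
  polar phi n * hess_quad (polar phi) n (unperp n).

Definition vDerive (g : R -> vec) (x : R) : vec :=
  (Derive (fun y => fst (g y)) x, Derive (fun y => snd (g y)) x).

Section Curve.
Variables (phi : vec -> R) (g : R -> vec).

Definition speed (x : R) : R := vlen (vDerive g x).
Definition tau (x : R) : vec := vscal (/ speed x) (vDerive g x).
Definition nu (x : R) : vec := perp (tau x).
Definition kappa (x : R) : R :=
  dot (vscal (/ (speed x)^2) (vDerive (vDerive g) x)) (nu x).
Definition kappa_phi (x : R) : R :=
  psi phi (nu x) * kappa x / polar phi (nu x).

Definition arc_integral (f : R -> R) : R := RInt (fun x => f x * speed x) 0 1.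
Definition curve_length : R := arc_integral (fun _ => 1).
Definition L2_norm (f : R -> R) : R := sqrt (arc_integral (fun x => (f x)^2)).

Definition curve_energy : R :=
  arc_integral (fun x => (kappa_phi x)^2 * polar phi (nu x)).
End Curve.

Inductive branch : Set := B1 | B2 | B3.

Definition sum3 (f : branch -> R) : R := f B1 + f B2 + f B3.
Definition vsum3 (f : branch -> vec) : vec :=
  vadd (vadd (f B1) (f B2)) (f B3).

Definition energy (phi : vec -> R) (u : branch -> R -> R -> vec) (t : R) : R :=
  sum3 (fun i => curve_energy phi (u i t)).

(* [u i t x] is the i-th curve. Smoothness on [0,T) x [0,1], up to its boundary,
   means that u is smooth on an open neighbourhood of this set, so that the
   two-sided derivatives at its boundary points are the right ones; values of u
   off [0,T) x [0,1] play no other role. *)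
Definition geometric_solution (phi : vec -> R) (T : R) (P : branch -> vec)
    (u : branch -> R -> R -> vec) : Prop :=
  (forall i, exists O : vec -> Prop,
     open O /\
     (forall t x, 0 <= t < T -> 0 <= x <= 1 -> O (t, x)) /\
     smooth_on O (fun p => fst (u i (fst p) (snd p))) /\
     smooth_on O (fun p => snd (u i (fst p) (snd p)))) /\
  (forall i t x, 0 <= t < T -> 0 <= x <= 1 -> vDerive (u i t) x <> vzero) /\
  (forall i t x, 0 <= t < T -> 0 <= x <= 1 ->
     let n := nu (u i t) x in
     vscal (dot (vDerive (fun s => u i s x) t) n) n
       = vscal (psi phi n * kappa (u i t) x) n) /\
  (forall i t, 0 <= t < T -> u i t 1 = P i) /\
  (forall t, 0 <= t < T -> u B1 t 0 = u B2 t 0 /\ u B2 t 0 = u B3 t 0) /\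
  (forall t, 0 <= t < T ->
     vsum3 (fun i => grad (polar phi) (nu (u i t) 0)) = vzero).

(* The quantities through which constants are allowed to depend on the polar
   norm. *)
Record polar_constants : Set := {
  psi_min : R;
  psi_max : R;
  junction_angle : R;
  polar_min : R;
  polar_max : R;
  polar_grad_max : R
}.

Definition admissible_constants (phi : vec -> R) (K : polar_constants) : Prop :=
  0 < psi_min K /\
  (forall n, unit_vec n -> psi_min K <= psi phi n <= psi_max K) /\
  0 < junction_angle K /\
  (forall n : branch -> vec,
     (forall i, unit_vec (n i)) ->
     vsum3 (fun i => grad (polar phi) (n i)) = vzero ->
     forall i j, i <> j ->
       junction_angle K <= Rabs (dot (n i) (unperp (n j)))) /\
  0 < polar_min K /\
  (forall n, unit_vec n -> polar_min K <= polar phi n <= polar_max K) /\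
  (forall n, unit_vec n -> vlen (grad (polar phi) n) <= polar_grad_max K).

(* Main.v *)
(** Write f for the polar norm as a function of the unit normal, w = f + f''
    (so that psi = f w and kappa_phi = w kappa), V = f kappa_phi for the normal
    speed, lambda for the tangential one, and E for the energy, the integral of
    kappa_phi^2 f ds.  On one curve
      dE/dt = [2 w V V_s + lambda kappa_phi^2 f] from end to end
              + int (- 2 w V_s^2 + V^4 / (f^2 w) + V^2 f' V_s / f^2) ds.
    At the fixed end V = lambda = 0.  At the junction, differentiating the
    condition sum Df(nu^i) = 0 in time and pairing it with the common
    velocity removes V_s: the three boundary terms add up to
    sum lambda^i (V^i)^2 / f^i, and lambda^i is bounded by the normal speeds
    because the normals are pairwise transversal.  As V vanishes at the fixed end,
    sup V^4 <= 4 (int V^2 ds) (int V_s^2 ds), so the dissipation absorbs all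
    other terms and dE/dt <= C E^3.  This integrates to E(t)^2 >= 1 / (2 C (T - t))
    when E is unbounded near T.  No power of the lengths enters, so C does not
    involve delta.

    For the existence of the constants, ellipticity is tested on products of bump
    functions, which makes it a pointwise bound for D^2(phi^2) off the origin;
    then the gradient of phi along the unit circle turns at a positive rate and
    parametrizes the polar norm, with w > 0. *)

Require Import Defs.
From Stdlib Require Import Reals Lra Lia Psatz ClassicalEpsilon FunctionalExtensionality.
From Coquelicot Require Import Coquelicot.
(* Stdlib's [Reals] has a [d1] that would hide the one of [Defs]. *)
Import Defs.
Open Scope R_scope.

(** * Smooth functions of two variables *)

(** The exponents fit by scaling: for lengths of order l, the terms sup |V|^3, (sup V^2) int V^2 ds,
    int V_s^2 ds and E^3 are all of order l^-3, so Young's inequality absorbs with constants free of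
    l. At the junction, the differentiated angle condition controls theta_t, the rotation speed of
    the normal, and not V_s. Since V_s = theta_t - lambda kappa, passing from one to the other
    reverses the sign of the lambda term, and what is left is cubic in the speeds. No global angle
    is chosen along the moving curves. A function of the angle is a function on the unit circle
    composed with the normal, and an angle is used only locally, for the chain rule. The derivatives
    theta_t and theta_x are explicit expressions in the curve, and their compatibility is Schwarz's
    theorem for its components. The boundary conditions are known for times in [0,T) only, so they
    are differentiated at t > 0. Time 0 is reached by continuity of the energy, which comes from
    smoothness on an open neighbourhood. *)

Definition Dt (g : R -> R -> R) (t x : R) : R := Derive (fun s => g s x) t.
Definition Dx (g : R -> R -> R) (t x : R) : R := Derive (fun y => g t y) x.

Definition smooth2 (O : vec -> Prop) (g : R -> R -> R) : Prop :=
  forall (n : nat) (t x : R), O (t, x) -> ex_diff_n g n t x.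

Lemma smooth2_Dt O g : smooth2 O g -> smooth2 O (Dt g).
Proof. intros H n t x Hp. exact (proj1 (proj2 (proj2 (proj2 (H (S n) t x Hp))))). Qed.

Lemma smooth2_Dx O g : smooth2 O g -> smooth2 O (Dx g).
Proof. intros H n t x Hp. exact (proj2 (proj2 (proj2 (proj2 (H (S n) t x Hp))))). Qed.

Lemma smooth2_continuity O g t x :
  smooth2 O g -> O (t, x) -> continuity_2d_pt g t x.
Proof. intros H Hp. exact (proj1 (H 0%nat t x Hp)). Qed.

Lemma smooth2_is_derive_t O g t x :
  smooth2 O g -> O (t, x) -> is_derive (fun s => g s x) t (Dt g t x).
Proof.
  intros H Hp. apply Derive_correct. exact (proj1 (proj2 (H 1%nat t x Hp))).
Qed.

Lemma smooth2_is_derive_x O g t x :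
  smooth2 O g -> O (t, x) -> is_derive (fun y => g t y) x (Dx g t x).
Proof.
  intros H Hp. apply Derive_correct. exact (proj1 (proj2 (proj2 (H 1%nat t x Hp)))).
Qed.

Lemma open_locally_2d (O : vec -> Prop) t x :
  open O -> O (t, x) -> locally_2d (fun u v => O (u, v)) t x.
Proof. intros H Hp. apply locally_2d_locally. apply filter_imp with (2 := H _ Hp). now intros [u v]. Qed.

Lemma smooth2_Schwarz O g t x :
  open O -> smooth2 O g -> O (t, x) -> Dt (Dx g) t x = Dx (Dt g) t x.
Proof.
  intros HO H Hp. apply (Schwarz g t x).
  - apply locally_2d_impl with (2 := open_locally_2d O t x HO Hp).
    apply locally_2d_forall. intros u v Huv.
    pose proof (smooth2_Dt _ _ H) as Ht. pose proof (smooth2_Dx _ _ H) as Hx.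
    repeat split; eexists.
    + exact (smooth2_is_derive_t _ _ _ _ H Huv).
    + exact (smooth2_is_derive_x _ _ _ _ H Huv).
    + exact (smooth2_is_derive_t _ _ _ _ Hx Huv).
    + exact (smooth2_is_derive_x _ _ _ _ Ht Huv).
  - exact (smooth2_continuity _ _ _ _ (smooth2_Dt _ _ (smooth2_Dx _ _ H)) Hp).
  - exact (smooth2_continuity _ _ _ _ (smooth2_Dx _ _ (smooth2_Dt _ _ H)) Hp).
Qed.

Lemma smooth2_differentiable O g t x :
  open O -> smooth2 O g -> O (t, x) ->
  differentiable_pt_lim g t x (Dt g t x) (Dx g t x).
Proof.
  intros HO H Hp.
  apply filterdiff_differentiable_pt_lim.
  apply (is_derive_filterdiff g t x (Dt g)).
  - apply filter_imp with (2 := HO _ Hp).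
    intros [u v] Huv. exact (smooth2_is_derive_t _ _ _ _ H Huv).
  - exact (smooth2_is_derive_x _ _ _ _ H Hp).
  - apply (proj1 (continuity_2d_pt_filterlim _ _ _)).
    exact (smooth2_continuity _ _ _ _ (smooth2_Dt _ _ H) Hp).
Qed.

Lemma smooth2_is_derive_comp O g (a b : R -> R) s a' b' :
  open O -> smooth2 O g -> O (a s, b s) ->
  is_derive a s a' -> is_derive b s b' ->
  is_derive (fun r => g (a r) (b r)) s (Dt g (a s) (b s) * a' + Dx g (a s) (b s) * b').
Proof.
  intros HO H Hp Ha Hb. apply is_derive_Reals.
  apply derivable_pt_lim_comp_2d.
  - now apply (smooth2_differentiable O).
  - now apply is_derive_Reals.
  - now apply is_derive_Reals.
Qed.

(** [auto_derive] leaves the derivatives of abstract functions as [Derive] terms; they are replaced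
    here by the values known from the context, so that [ring] or [field] can conclude. *)
Ltac rew_derive :=
  repeat match goal with
  | H : is_derive ?f ?x ?l |- context [Derive ?g ?x] =>
      replace (Derive g x) with l by (symmetry; exact (is_derive_unique f x l H))
  end.

Ltac ex_derive_ctx :=
  repeat split; try trivial;
  try match goal with H : is_derive ?f ?x ?l |- ex_derive _ ?x => now exists l end.

(** * Bump functions *)

Fixpoint Cn (n : nat) (f : R -> R) : Prop :=
  match n with
  | O => True
  | S m => exists f', (forall x, is_derive f x (f' x)) /\ Cn m f'
  end.

Lemma Cn_le n f : Cn (S n) f -> Cn n f.
Proof.
  revert f; induction n as [|n IH]; intros f H; [exact I|].
  destruct H as [f' [H1 H2]]. exists f'. split; [exact H1|]. now apply IH.
Qed.

Lemma Cn_plus n f g : Cn n f -> Cn n g -> Cn n (fun x => f x + g x).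
Proof.
  revert f g; induction n as [|n IH]; intros f g Hf Hg; [exact I|].
  destruct Hf as [f' [Hf Hf']], Hg as [g' [Hg Hg']].
  exists (fun x => f' x + g' x). split; [|now apply IH].
  intros x. apply (is_derive_plus f g); auto.
Qed.

Lemma Cn_scal n c f : Cn n f -> Cn n (fun x => c * f x).
Proof.
  revert f; induction n as [|n IH]; intros f Hf; [exact I|].
  destruct Hf as [f' [Hf Hf']].
  exists (fun x => c * f' x). split; [|now apply IH].
  intros x. apply (is_derive_scal f); auto.
Qed.

Lemma Cn_mult n f g : Cn n f -> Cn n g -> Cn n (fun x => f x * g x).
Proof.
  revert f g; induction n as [|n IH]; intros f g Hf Hg; [exact I|].
  pose proof (Cn_le _ _ Hf) as Kf. pose proof (Cn_le _ _ Hg) as Kg.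
  destruct Hf as [f' [Hf Hf']], Hg as [g' [Hg Hg']].
  exists (fun x => f' x * g x + f x * g' x). split; [|apply Cn_plus; now apply IH].
  intros x. apply (is_derive_mult f g); auto. intros; apply Rmult_comm.
Qed.

Lemma Cn_affine n c d f : Cn n f -> Cn n (fun x => f (c * x + d)).
Proof.
  revert f; induction n as [|n IH]; intros f Hf; [exact I|].
  destruct Hf as [f' [Hf Hf']].
  exists (fun x => c * f' (c * x + d)). split; [|now apply Cn_scal, IH].
  intros x. specialize (Hf (c * x + d)).
  auto_derive. now exists (f' (c * x + d)).
  rew_derive. ring.
Qed.

(** With [k = n + 1], [exp y] is the k-th power of [exp (y / k)], and [exp z >= 1 + z >= z]. *)
Lemma pow_le_exp n y : 0 <= y -> y ^ S n <= INR (S n) ^ S n * exp y.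
Proof.
  intros Hy. set (k := INR (S n)).
  assert (Hk : 0 < k) by apply lt_0_INR, Nat.lt_0_succ.
  assert (Hexp : forall m z, exp (INR m * z) = exp z ^ m).
  { induction m as [|m IH]; intros z.
    - now rewrite Rmult_0_l, exp_0.
    - rewrite S_INR, Rmult_plus_distr_r, Rmult_1_l, exp_plus, IH. simpl; ring. }
  replace (exp y) with (exp (y / k) ^ S n)
    by (rewrite <- Hexp; f_equal; fold k; field; lra).
  rewrite <- Rpow_mult_distr. apply pow_incr. split; [exact Hy|].
  pose proof (exp_ineq1_le (y / k)).
  replace y with (k * (y / k)) at 1 by (field; lra).
  apply Rmult_le_compat_l; lra.
Qed.

(** The classical flat function [exp (- / x)] is the case [k = 0]. The powers of [/ x] are included
    so that the family is closed under differentiation up to linear combinations, which makes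
    smoothness an induction. *)
Definition flat (k : nat) (x : R) : R :=
  if Rlt_dec 0 x then (/ x) ^ k * exp (- / x) else 0.

Lemma flat_pos k x : 0 < x -> 0 < flat k x.
Proof.
  intros H. unfold flat. destruct (Rlt_dec 0 x); [|lra].
  apply Rmult_lt_0_compat; [now apply pow_lt, Rinv_0_lt_compat | apply exp_pos].
Qed.

Lemma flat_neg k x : x <= 0 -> flat k x = 0.
Proof. intros H. unfold flat. destruct (Rlt_dec 0 x); lra. Qed.

Lemma flat_nonneg k x : 0 <= flat k x.
Proof.
  destruct (Rlt_dec 0 x) as [H|H]; [left; now apply flat_pos|].
  rewrite flat_neg; lra.
Qed.

(** A quadratic bound is what differentiability at 0 with zero derivative requires. It is
    [pow_le_exp] at [y = / x], with the exponent raised by two. *)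
Lemma flat_le_sqr k x : flat k x <= INR (S (S k)) ^ S (S k) * x ^ 2.
Proof.
  assert (Hc : 0 <= INR (S (S k)) ^ S (S k)) by apply pow_le, pos_INR.
  pose proof (pow2_ge_0 x) as Hx.
  destruct (Rlt_dec 0 x) as [H|H].
  2:{ rewrite flat_neg by lra. now apply Rmult_le_pos. }
  unfold flat. destruct (Rlt_dec 0 x); [|lra].
  assert (Hi : 0 < / x) by now apply Rinv_0_lt_compat.
  pose proof (pow_le_exp (S k) (/ x) (Rlt_le _ _ Hi)) as Hp.
  set (c := INR (S (S k)) ^ S (S k)) in *.
  rewrite exp_Ropp. set (e := exp (/ x)) in *.
  assert (He : 0 < e) by apply exp_pos.
  apply Rmult_le_reg_r with (e * / x ^ 2).
  { apply Rmult_lt_0_compat; [exact He|]. apply Rinv_0_lt_compat, pow_lt; lra. }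
  replace ((/ x) ^ k * / e * (e * / x ^ 2)) with ((/ x) ^ S (S k))
    by (simpl; field; split; lra).
  replace (c * x ^ 2 * (e * / x ^ 2)) with (c * e) by (field; lra).
  exact Hp.
Qed.

Lemma flat_is_derive k x :
  is_derive (flat k) x (flat (S (S k)) x - INR k * flat (S k) x).
Proof.
  destruct (total_order_T x 0) as [[H|H]|H].
  - rewrite 2!flat_neg by lra.
    apply is_derive_ext_loc with (fun _ => 0).
    + exists (mkposreal (- x) ltac:(lra)). intros y Hy.
      unfold ball in Hy; simpl in Hy; unfold AbsRing_ball, abs, minus, plus, opp in Hy; simpl in Hy.
      apply Rabs_lt_between in Hy. rewrite flat_neg; lra.
    + auto_derive; [exact I|ring].
  - subst x. rewrite 2!flat_neg by lra.
    apply is_derive_Reals. intros eps Heps.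
    set (c := INR (S (S k)) ^ S (S k)).
    assert (Hc : 0 < c) by (apply pow_lt, lt_0_INR; lia).
    exists (mkposreal (eps / c) (Rdiv_lt_0_compat _ _ Heps Hc)).
    intros h Hh Hd; simpl in Hd.
    rewrite Rplus_0_l, (flat_neg k 0) by lra.
    replace ((flat k h - 0) / h - (0 - INR k * 0)) with (flat k h / h) by (field; exact Hh).
    unfold Rdiv. rewrite Rabs_mult, (Rabs_pos_eq _ (flat_nonneg k h)), Rabs_inv.
    pose proof (flat_le_sqr k h) as Hf. fold c in Hf. rewrite <- pow2_abs in Hf.
    pose proof (Rabs_pos_lt h Hh) as Ha.
    apply Rle_lt_trans with (c * Rabs h).
    + apply Rmult_le_reg_r with (Rabs h); [exact Ha|].
      rewrite Rmult_assoc, Rinv_l by lra. lra.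
    + apply Rmult_lt_reg_r with (/ c); [now apply Rinv_0_lt_compat|].
      replace (c * Rabs h * / c) with (Rabs h) by (field; lra). exact Hd.
  - unfold flat at 2 3. destruct (Rlt_dec 0 x); [|lra].
    apply is_derive_ext_loc with (fun y => (/ y) ^ k * exp (- / y)).
    + exists (mkposreal x H). intros y Hy.
      unfold ball in Hy; simpl in Hy; unfold AbsRing_ball, abs, minus, plus, opp in Hy; simpl in Hy.
      apply Rabs_lt_between in Hy. unfold flat. destruct (Rlt_dec 0 y); [reflexivity|lra].
    + auto_derive; [repeat split; lra|].
      destruct k as [|k]; [simpl; field; lra|].
      change (Init.Nat.pred (S k)) with k. rewrite <- !tech_pow_Rmult.
      change (match k with O => 1 | S _ => INR k + 1 end) with (INR (S k)).
      field; lra.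
Qed.

Lemma flat_Cn n k : Cn n (flat k).
Proof.
  revert k; induction n as [|n IH]; intros k; [exact I|].
  exists (fun x => flat (S (S k)) x + - INR k * flat (S k) x). split.
  - intros x. evar_last; [apply flat_is_derive|]. ring.
  - apply Cn_plus; [|apply Cn_scal]; apply IH.
Qed.

(** The function and its first derivative vanish at the end points of the support as well, which
    removes the boundary terms of two successive integrations by parts. For the second derivative,
    vanishing on the open complement is enough. *)
Record bump (a0 rho : R) := {
  bf : R -> R; bf1 : R -> R; bf2 : R -> R;
  bump_Cn : forall n, Cn n bf;
  bump_d1 : forall x, is_derive bf x (bf1 x);
  bump_d2 : forall x, is_derive bf1 x (bf2 x);
  bump_c2 : forall x, continuous bf2 x;
  bump_pos : forall x, Rabs (x - a0) < rho -> 0 < bf x;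
  bump_out : forall x, rho <= Rabs (x - a0) -> bf x = 0 /\ bf1 x = 0;
  bump_out2 : forall x, rho < Rabs (x - a0) -> bf2 x = 0
}.

Lemma is_derive_zero_near (f : R -> R) x l :
  is_derive f x l -> locally x (fun y => f y = 0) -> l = 0.
Proof.
  intros Hd Hl.
  assert (H0 : is_derive f x 0).
  { apply is_derive_ext_loc with (fun _ => 0).
    - apply filter_imp with (2 := Hl). intros y Hy; now rewrite Hy.
    - auto_derive; [exact I|reflexivity]. }
  now rewrite <- (is_derive_unique _ _ _ Hd), (is_derive_unique _ _ _ H0).
Qed.

Lemma Rabs_open_gt a0 r x :
  r < Rabs (x - a0) -> locally x (fun y => r < Rabs (y - a0)).
Proof.
  intros H. exists (mkposreal (Rabs (x - a0) - r) ltac:(lra)). intros y Hy.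
  change (Rabs (y - x) < Rabs (x - a0) - r) in Hy.
  pose proof (Rabs_triang (y - a0) (x - y)) as Ht.
  replace (y - a0 + (x - y)) with (x - a0) in Ht by ring.
  rewrite (Rabs_minus_sym x y) in Ht. lra.
Qed.

Lemma is_derive_continuous (f : R -> R) x l : is_derive f x l -> continuous f x.
Proof. intros H. apply (ex_derive_continuous f). now exists l. Qed.

Lemma is_derive_local_min (f : R -> R) x l :
  is_derive f x l -> (forall y, f x <= f y) -> l = 0.
Proof.
  intros H Hmin.
  assert (Hm : forall eps, 0 < eps -> Rabs l <= eps).
  { intros eps He. apply is_derive_Reals in H. destruct (H eps He) as [d Hd].
    pose proof (cond_pos d) as Hdp.
    pose proof (Hd (d / 2) ltac:(lra) ltac:(rewrite Rabs_pos_eq; lra)) as H1.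
    pose proof (Hd (- (d / 2)) ltac:(lra) ltac:(rewrite Rabs_Ropp, Rabs_pos_eq; lra)) as H2.
    apply Rabs_lt_between in H1, H2.
    assert (0 <= (f (x + d / 2) - f x) / (d / 2)).
    { apply Rdiv_le_0_compat; [pose proof (Hmin (x + d / 2)); lra | lra]. }
    assert ((f (x + - (d / 2)) - f x) / - (d / 2) <= 0).
    { unfold Rdiv at 1. rewrite Rinv_opp.
      pose proof (Hmin (x + - (d / 2))).
      pose proof (Rinv_0_lt_compat (d / 2) ltac:(lra)). nra. }
    apply Rabs_le. lra. }
  destruct (Req_dec l 0) as [|Hn]; [assumption|].
  pose proof (Rabs_pos_lt l Hn). specialize (Hm (Rabs l / 2) ltac:(lra)). lra.
Qed.

Lemma bump_exists a0 rho : 0 < rho -> exists b : bump a0 rho, True.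
Proof.
  intros Hr.
  set (f := fun x => flat 0 (1 * x + (rho - a0)) * flat 0 (-1 * x + (rho + a0))).
  assert (HC : forall n, Cn n f).
  { intros n. apply Cn_mult; apply Cn_affine, flat_Cn. }
  destruct (HC 3%nat) as [f1 [D1 [f2 [D2 [f3 [D3 _]]]]]].
  assert (Hnn : forall x, 0 <= f x).
  { intros x. apply Rmult_le_pos; apply flat_nonneg. }
  assert (Hout : forall x, rho <= Rabs (x - a0) -> f x = 0 /\ f1 x = 0).
  { intros x Hx.
    assert (Hf : f x = 0).
    { unfold f. unfold Rabs in Hx. destruct (Rcase_abs (x - a0)).
      - rewrite (flat_neg 0 (1 * x + _)) by lra. ring.
      - rewrite (flat_neg 0 (-1 * x + _)) by lra. ring. }
    split; [exact Hf|].
    (* A zero of a nonnegative function is a minimum, so the derivative vanishes there, end points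
       of the support included. *)
    apply (is_derive_local_min f x); [apply D1|]. intros y. rewrite Hf. apply Hnn. }
  unshelve eexists; [|exact I].
  refine {| bf := f; bf1 := f1; bf2 := f2 |}; auto.
  - intros x. exact (is_derive_continuous _ _ _ (D3 x)).
  - intros x Hx. apply Rabs_lt_between in Hx.
    apply Rmult_lt_0_compat; apply flat_pos; lra.
  - intros x Hx. apply (is_derive_zero_near f1 x); [apply D2|].
    apply filter_imp with (2 := Rabs_open_gt _ _ _ Hx).
    intros y Hy. apply Hout. lra.
Qed.

Lemma Cn_continuity_pt f x : (forall n, Cn n f) -> continuity_pt f x.
Proof.
  intros H. destruct (H 1%nat) as [f' [D _]].
  apply continuity_pt_filterlim. exact (is_derive_continuous _ _ _ (D x)).
Qed.

Lemma ex_diff_n_product n f g a b :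
  (forall m, Cn m f) -> (forall m, Cn m g) -> ex_diff_n (fun x y => f x * g y) n a b.
Proof.
  revert f g a b; induction n as [|n IH]; intros f g a b Hf Hg.
  all: assert (Hc : continuity_2d_pt (fun x y => f x * g y) a b) by
    (apply continuity_2d_pt_mult;
     [ apply (continuity_1d_2d_pt_comp f (fun u _ => u));
       [now apply Cn_continuity_pt | apply continuity_2d_pt_id1]
     | apply (continuity_1d_2d_pt_comp g (fun _ v => v));
       [now apply Cn_continuity_pt | apply continuity_2d_pt_id2] ]).
  { split; [exact Hc|exact I]. }
  (* The derivatives provided by [Cn] at different orders are unique, hence all equal to [Derive h],
     which therefore has every order itself. *)
  assert (Hd : forall h, (forall m, Cn m h) ->
      (forall x, is_derive h x (Derive h x)) /\ forall m, Cn m (Derive h)).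
  { intros h Hh.
    assert (D : forall x, is_derive h x (Derive h x)).
    { intros x. destruct (Hh 1%nat) as [h' [D _]]. apply Derive_correct. now exists (h' x). }
    split; [exact D|]. intros m. destruct (Hh (S m)) as [h' [D' C']].
    enough (h' = Derive h) as <- by exact C'.
    apply FunctionalExtensionality.functional_extensionality.
    intros x. symmetry. now apply is_derive_unique. }
  destruct (Hd f Hf) as [Df Cf], (Hd g Hg) as [Dg Cg].
  split; [exact Hc|]. split; [|split; [|split]].
  - exists (Derive f a * g b). pose proof (Df a). auto_derive.
    ex_derive_ctx. rew_derive. ring.
  - exists (f a * Derive g b). pose proof (Dg b). auto_derive.
    ex_derive_ctx. rew_derive. ring.
  - apply ex_diff_n_ext_loc with (fun x y => Derive f x * g y).
    2: now apply IH.
    apply locally_2d_forall. intros u v. symmetry. apply is_derive_unique.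
    pose proof (Df u). auto_derive. ex_derive_ctx. rew_derive. ring.
  - apply ex_diff_n_ext_loc with (fun x y => f x * Derive g y).
    2: now apply IH.
    apply locally_2d_forall. intros u v. symmetry. apply is_derive_unique.
    pose proof (Dg v). auto_derive. ex_derive_ctx. rew_derive. ring.
Qed.

(** * Integrals depending on a parameter *)

(** Compactness of the segment: each of its points has a square inside [O], and a positive lower
    bound for the radii of finitely many squares covering the segment gives the time interval. *)
Lemma tube (O : vec -> Prop) t c d :
  open O -> (forall x, c <= x <= d -> O (t, x)) ->
  locally t (fun s => forall x, c <= x <= d -> O (s, x)).
Proof.
  intros HO H.
  assert (Hch : forall x, { e : posreal | c <= x <= d ->
    forall s y, Rabs (s - t) < e -> Rabs (y - x) < e -> O (s, y) }).
  { intros x. apply constructive_indefinite_description.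
    destruct (excluded_middle_informative (c <= x <= d)) as [Hx|Hx].
    - destruct (open_locally_2d O t x HO (H x Hx)) as [e He]. exists e. intros _. exact He.
    (* The gauge has to be defined on the whole line; off the segment its value is arbitrary. *)
    - exists (mkposreal 1 Rlt_0_1). intros K; contradiction. }
  set (delta := fun x => proj1_sig (Hch x)).
  destruct (compactness_value_1d c d delta) as [e He].
  exists e. intros s Hs x Hx. change (Rabs (s - t) < e) in Hs.
  apply NNPP. intros Hn. apply (He x Hx). intros [y [Hy [Hxy Hey]]].
  apply Hn. apply (proj2_sig (Hch y) Hy); fold (delta y); lra.
Qed.

Lemma continuity_2d_pt_1d_x f (t x : R) :
  continuity_2d_pt f t x -> continuous (f t) x.
Proof.
  intros H. apply continuity_pt_filterlim. intros eps Heps.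
  destruct (H (mkposreal eps Heps)) as [d Hd].
  exists d. split; [apply cond_pos|]. intros y [_ Hy].
  apply Hd; [|exact Hy]. rewrite Rminus_eq_0, Rabs_R0. apply cond_pos.
Qed.

(** Regularity of the integrand is known only on an open set containing the segment at time [t];
    [tube] turns this into a time interval valid for all points of the segment, as differentiation
    under the integral requires. *)
Lemma is_derive_RInt_open (O : vec -> Prop) (g g' : R -> R -> R) t c d :
  open O -> c <= d -> (forall x, c <= x <= d -> O (t, x)) ->
  (forall s x, O (s, x) -> is_derive (fun r => g r x) s (g' s x)) ->
  (forall s x, O (s, x) -> continuity_2d_pt g s x) ->
  (forall s x, O (s, x) -> continuity_2d_pt g' s x) ->
  is_derive (fun s => RInt (g s) c d) t (RInt (g' t) c d).
Proof.
  intros HO Hcd H HD Hg Hg'.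
  pose proof (tube O t c d HO H) as Ht.
  evar_last.
  - apply (is_derive_RInt_param g c d t).
    + apply filter_imp with (2 := Ht). intros s Hs x Hx.
      rewrite Rmin_left, Rmax_right in Hx by lra.
      exists (g' s x). apply HD, Hs, Hx.
    + intros x Hx. rewrite Rmin_left, Rmax_right in Hx by lra.
      apply continuity_2d_pt_ext_loc with g'.
      * apply locally_2d_impl with (2 := open_locally_2d O t x HO (H x Hx)).
        apply locally_2d_forall. intros u v Huv. symmetry.
        apply is_derive_unique. now apply HD.
      * apply Hg', H, Hx.
    + apply filter_imp with (2 := Ht). intros s Hs.
      apply (ex_RInt_continuous (g s)). intros x Hx.
      rewrite Rmin_left, Rmax_right in Hx by lra.
      apply continuity_2d_pt_1d_x, Hg, Hs, Hx.
  - apply RInt_ext. intros x Hx. rewrite Rmin_left, Rmax_right in Hx by lra.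
    apply is_derive_unique, HD, H. lra.
Qed.

Lemma RInt_param_continuous (g : R -> R -> R) t c d :
  c <= d ->
  (exists O : vec -> Prop, open O /\ (forall x, c <= x <= d -> O (t, x)) /\
     forall s x, O (s, x) -> continuity_2d_pt g s x) ->
  continuous (fun s => RInt (g s) c d) t.
Proof.
  intros Hcd [O [HO [H Hg]]].
  pose proof (tube O t c d HO H) as [e1 He1].
  assert (Hex : forall s, Rabs (s - t) < e1 -> ex_RInt (g s) c d).
  { intros s Hs. apply (ex_RInt_continuous (g s)). intros x Hx.
    rewrite Rmin_left, Rmax_right in Hx by lra.
    apply continuity_2d_pt_1d_x, Hg, (He1 s Hs), Hx. }
  apply continuity_pt_filterlim. intros eps Heps.
  (* The added 1 keeps the divisor positive when [c = d]. *)
  set (m := eps / (2 * (d - c + 1))).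
  assert (Hm : 0 < m) by (apply Rdiv_lt_0_compat; lra).
  destruct (uniform_continuity_2d_1d' g c d t (fun x Hx => Hg t x (H x Hx)) (mkposreal m Hm))
    as [e2 He2].
  exists (Rmin e1 e2). split; [apply Rmin_pos; apply cond_pos|].
  intros s [_ Hs]. simpl in Hs. unfold Rdist in *.
  pose proof (Rmin_l e1 e2). pose proof (Rmin_r e1 e2).
  pose proof (cond_pos e1). pose proof (cond_pos e2).
  assert (E1 : ex_RInt (g s) c d) by (apply Hex; lra).
  assert (E2 : ex_RInt (g t) c d).
  { apply Hex. rewrite Rminus_eq_0, Rabs_R0; lra. }
  simpl. unfold Rdist.
  apply Rle_lt_trans with (m * (d - c)).
  - change (RInt (g s) c d - RInt (g t) c d) with (minus (RInt (g s) c d) (RInt (g t) c d)).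
    rewrite <- (RInt_minus (V := R_CompleteNormedModule)) by assumption.
    rewrite Rmult_comm. apply (abs_RInt_le_const _ c d m Hcd).
    + now apply (ex_RInt_minus (V := R_NormedModule)).
    + intros x Hx. left. apply Rabs_lt_between in Hs.
      apply (He2 x t x s); try lra. rewrite Rminus_eq_0, Rabs_R0; lra.
  - unfold m. apply Rmult_lt_reg_r with (2 * (d - c + 1)); [lra|].
    replace (eps / (2 * (d - c + 1)) * (d - c) * (2 * (d - c + 1))) with (eps * (d - c))
      by (field; lra).
    nra.
Qed.

Lemma RInt_Rplus (f g : R -> R) a b :
  ex_RInt f a b -> ex_RInt g a b ->
  RInt (fun x => f x + g x) a b = RInt f a b + RInt g a b.
Proof. intros Hf Hg. exact (RInt_plus (V := R_CompleteNormedModule) f g a b Hf Hg). Qed.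

Lemma RInt_Rminus (f g : R -> R) a b :
  ex_RInt f a b -> ex_RInt g a b ->
  RInt (fun x => f x - g x) a b = RInt f a b - RInt g a b.
Proof. intros Hf Hg. exact (RInt_minus (V := R_CompleteNormedModule) f g a b Hf Hg). Qed.

Lemma RInt_Rmult (f : R -> R) l a b :
  ex_RInt f a b -> RInt (fun x => l * f x) a b = l * RInt f a b.
Proof. intros Hf. exact (RInt_scal (V := R_CompleteNormedModule) f a b l Hf). Qed.

Lemma RInt_by_parts (f f' g g' : R -> R) a b :
  a <= b ->
  (forall x, a <= x <= b -> is_derive f x (f' x)) ->
  (forall x, a <= x <= b -> is_derive g x (g' x)) ->
  (forall x, a <= x <= b -> continuous f' x) ->
  (forall x, a <= x <= b -> continuous g' x) ->
  g a = 0 -> g b = 0 ->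
  RInt (fun x => f x * g' x) a b = - RInt (fun x => f' x * g x) a b.
Proof.
  intros Hab Df Dg Cf Cg Ha Hb.
  assert (E1 : ex_RInt (fun x => f x * g' x) a b).
  { apply (ex_RInt_continuous (V := R_CompleteNormedModule)). intros x Hx.
    rewrite Rmin_left, Rmax_right in Hx by lra.
    apply (continuous_mult f g'); [exact (is_derive_continuous _ _ _ (Df x Hx))|auto]. }
  assert (E2 : ex_RInt (fun x => f' x * g x) a b).
  { apply (ex_RInt_continuous (V := R_CompleteNormedModule)). intros x Hx.
    rewrite Rmin_left, Rmax_right in Hx by lra.
    apply (continuous_mult f' g); [auto|exact (is_derive_continuous _ _ _ (Dg x Hx))]. }
  assert (E : is_RInt (fun x => f' x * g x + f x * g' x) a b (f b * g b - f a * g a)).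
  { apply (is_RInt_derive (fun x => f x * g x)).
    - intros x Hx. rewrite Rmin_left, Rmax_right in Hx by lra.
      apply (is_derive_mult f g); auto. intros; apply Rmult_comm.
    - intros x Hx. rewrite Rmin_left, Rmax_right in Hx by lra.
      apply (continuous_plus (fun x => f' x * g x)).
      + apply (continuous_mult f' g); [auto|exact (is_derive_continuous _ _ _ (Dg x Hx))].
      + apply (continuous_mult f g'); [exact (is_derive_continuous _ _ _ (Df x Hx))|auto]. }
  apply (is_RInt_unique (V := R_CompleteNormedModule)) in E.
  rewrite RInt_Rplus in E by assumption.
  rewrite Ha, Hb in E. lra.
Qed.

Lemma RInt_supported (f : R -> R) r l u :
  - r <= l <= u -> u <= r -> ex_RInt f l u ->
  (forall x, x < l \/ u < x -> f x = 0) ->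
  ex_RInt f (- r) r /\ RInt f (- r) r = RInt f l u.
Proof.
  intros H1 H2 Hex Hz.
  assert (Hl : is_RInt f (- r) l 0).
  { apply is_RInt_ext with (fun _ => 0).
    - intros x Hx. rewrite Rmin_left, Rmax_right in Hx by lra. rewrite Hz; lra.
    - evar_last; [apply is_RInt_const|]. unfold scal; simpl; unfold mult; simpl; ring. }
  assert (Hr : is_RInt f u r 0).
  { apply is_RInt_ext with (fun _ => 0).
    - intros x Hx. rewrite Rmin_left, Rmax_right in Hx by lra. rewrite Hz; lra.
    - evar_last; [apply is_RInt_const|]. unfold scal; simpl; unfold mult; simpl; ring. }
  pose proof (is_RInt_Chasles f _ _ _ _ _ (is_RInt_Chasles f _ _ _ _ _ Hl (RInt_correct _ _ _ Hex)) Hr) as H.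
  split; [eexists; exact H|].
  rewrite (is_RInt_unique _ _ _ _ H). unfold plus; simpl. change (0 + RInt f l u + 0 = RInt f l u). ring.
Qed.

(** * Testing an inequality of second derivatives on a small square *)

Ltac eqR := match goal with |- @eq _ ?a ?b => change (@eq R a b) end.
Ltac ringR := eqR; ring.

Ltac contR :=
  repeat match goal with
  | |- continuous (fun x => @?f x + @?g x) _ => apply (continuous_plus f g)
  | |- continuous (fun x => @?f x - @?g x) _ => apply (continuous_minus f g)
  | |- continuous (fun x => - @?f x) _ => apply (continuous_opp f)
  | |- continuous (fun x => @?f x * @?g x) _ => apply (continuous_mult f g)
  | |- continuous (fun _ => ?c) _ => apply continuous_const
  end.

Lemma ex_RInt_cont (f : R -> R) a b :
  a <= b -> (forall x, a <= x <= b -> continuous f x) -> ex_RInt f a b.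
Proof.
  intros Hab H. apply (ex_RInt_continuous (V := R_CompleteNormedModule)).
  intros x Hx. rewrite Rmin_left, Rmax_right in Hx by lra. now apply H.
Qed.

Lemma RInt_Rext (f g : R -> R) a b :
  a <= b -> (forall x, a < x < b -> f x = g x) -> RInt f a b = RInt g a b.
Proof.
  intros Hab H. apply RInt_ext. intros x Hx.
  rewrite Rmin_left, Rmax_right in Hx by lra. now apply H.
Qed.

Lemma continuity_2d_pt_x (f : R -> R) (t x : R) :
  continuous f x -> continuity_2d_pt (fun _ v => f v) t x.
Proof.
  intros H. apply (continuity_1d_2d_pt_comp f (fun _ v => v)).
  - now apply continuity_pt_filterlim.
  - apply continuity_2d_pt_id2.
Qed.

(* On a square where G is C^2, both derivatives of the test function
   [bf A a * bf B b] in the direction (x, y) are moved onto G. *)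
Section Box.
Variables (a0 b0 rho : R) (A : bump a0 rho) (B : bump b0 rho) (O : vec -> Prop).
Variables (G Ga Gb Gaa Gba Gbb : R -> R -> R) (x y : R).
Hypothesis rho_pos : 0 < rho.
Let l := a0 - rho. Let u := a0 + rho. Let l' := b0 - rho. Let u' := b0 + rho.
Hypothesis O_open : open O.
Hypothesis O_box : forall a b, l <= a <= u -> l' <= b <= u' -> O (a, b).
Hypothesis D_a : forall a b, O (a, b) -> is_derive (fun s => G s b) a (Ga a b).
Hypothesis D_b : forall a b, O (a, b) -> is_derive (fun s => G a s) b (Gb a b).
Hypothesis D_aa : forall a b, O (a, b) -> is_derive (fun s => Ga s b) a (Gaa a b).
Hypothesis D_ba : forall a b, O (a, b) -> is_derive (fun s => Gb s b) a (Gba a b).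
Hypothesis D_bb : forall a b, O (a, b) -> is_derive (fun s => Gb a s) b (Gbb a b).
Hypothesis C0 : forall a b, O (a, b) -> continuity_2d_pt G a b.
Hypothesis Ca : forall a b, O (a, b) -> continuity_2d_pt Ga a b.
Hypothesis Cb : forall a b, O (a, b) -> continuity_2d_pt Gb a b.
Hypothesis Caa : forall a b, O (a, b) -> continuity_2d_pt Gaa a b.
Hypothesis Cba : forall a b, O (a, b) -> continuity_2d_pt Gba a b.
Hypothesis Cbb : forall a b, O (a, b) -> continuity_2d_pt Gbb a b.

Let Af := bf _ _ A. Let A1 := bf1 _ _ A. Let A2 := bf2 _ _ A.
Let Bf := bf _ _ B. Let B1 := bf1 _ _ B. Let B2 := bf2 _ _ B.

Let cAf s : continuous Af s. Proof. exact (is_derive_continuous _ _ _ (bump_d1 _ _ A s)). Qed.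
Let cA1 s : continuous A1 s. Proof. exact (is_derive_continuous _ _ _ (bump_d2 _ _ A s)). Qed.
Let cA2 s : continuous A2 s. Proof. exact (bump_c2 _ _ A s). Qed.
Let cBf s : continuous Bf s. Proof. exact (is_derive_continuous _ _ _ (bump_d1 _ _ B s)). Qed.
Let cB1 s : continuous B1 s. Proof. exact (is_derive_continuous _ _ _ (bump_d2 _ _ B s)). Qed.
Let cB2 s : continuous B2 s. Proof. exact (bump_c2 _ _ B s). Qed.
Let Hl : l <= u. Proof. unfold l, u; lra. Qed.
Let Hl' : l' <= u'. Proof. unfold l', u'; lra. Qed.

(** Averaging against the second bump leaves a function of the first variable alone, to which the
    one-dimensional integration by parts applies again. *)
Let J (h : R -> R -> R) (a : R) := RInt (fun b => h a b * Bf b) l' u'.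

Let cont_h (h : R -> R -> R) (C : forall a b, O (a, b) -> continuity_2d_pt h a b) a b :
  O (a, b) -> continuity_2d_pt (fun a b => h a b * Bf b) a b.
Proof. intros Hp. apply continuity_2d_pt_mult; [auto|]. now apply continuity_2d_pt_x. Qed.

Let J_derive (h h' : R -> R -> R)
  (D : forall a b, O (a, b) -> is_derive (fun s => h s b) a (h' a b))
  (C : forall a b, O (a, b) -> continuity_2d_pt h a b)
  (C' : forall a b, O (a, b) -> continuity_2d_pt h' a b) a :
  l <= a <= u -> is_derive (J h) a (J h' a).
Proof.
  intros Ha. apply (is_derive_RInt_open O (fun a b => h a b * Bf b) (fun a b => h' a b * Bf b)); auto.
  intros s z Hp. pose proof (D _ _ Hp). auto_derive; [ex_derive_ctx|rew_derive; ring].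
Qed.

Let J_continuous (h : R -> R -> R)
  (C : forall a b, O (a, b) -> continuity_2d_pt h a b) a :
  l <= a <= u -> continuous (J h) a.
Proof.
  intros Ha. apply (RInt_param_continuous (fun a b => h a b * Bf b) a l' u'); auto.
  exists O. auto.
Qed.

Let slice (h : R -> R -> R) (C : forall a b, O (a, b) -> continuity_2d_pt h a b) a b :
  l <= a <= u -> l' <= b <= u' -> continuous (h a) b.
Proof. intros Ha Hb. apply continuity_2d_pt_1d_x. auto. Qed.

Let B_ends : Bf l' = 0 /\ B1 l' = 0 /\ Bf u' = 0 /\ B1 u' = 0.
Proof.
  assert (H1 : rho <= Rabs (l' - b0)) by (unfold l'; rewrite Rabs_left1; lra).
  assert (H2 : rho <= Rabs (u' - b0)) by (unfold u'; rewrite Rabs_right; lra).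
  pose proof (bump_out _ _ B _ H1). pose proof (bump_out _ _ B _ H2). tauto.
Qed.

Let A_ends : Af l = 0 /\ A1 l = 0 /\ Af u = 0 /\ A1 u = 0.
Proof.
  assert (H1 : rho <= Rabs (l - a0)) by (unfold l; rewrite Rabs_left1; lra).
  assert (H2 : rho <= Rabs (u - a0)) by (unfold u; rewrite Rabs_right; lra).
  pose proof (bump_out _ _ A _ H1). pose proof (bump_out _ _ A _ H2). tauto.
Qed.

Let inner1 a : l <= a <= u -> RInt (fun b => G a b * B1 b) l' u' = - J Gb a.
Proof.
  intros Ha. destruct B_ends as [? [? [? ?]]].
  apply (RInt_by_parts (G a) (Gb a) Bf B1); auto.
  intros; apply (bump_d1 _ _ B).
Qed.

Let inner2 a : l <= a <= u -> RInt (fun b => G a b * B2 b) l' u' = J Gbb a.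
Proof.
  intros Ha. destruct B_ends as [? [? [? ?]]].
  rewrite (RInt_by_parts (G a) (Gb a) B1 B2); auto.
  2: intros; apply (bump_d2 _ _ B).
  rewrite (RInt_by_parts (Gb a) (Gbb a) Bf B1); auto.
  2: intros; apply (bump_d1 _ _ B).
  apply Ropp_involutive.
Qed.

(** [G] times the second derivative of the product bump in the direction [(x, y)]. *)
Definition box_integrand (a b : R) : R :=
  G a b * (A2 a * Bf b * x ^ 2 + 2 * A1 a * B1 b * x * y + Af a * B2 b * y ^ 2).

Let inner a : l <= a <= u ->
  RInt (box_integrand a) l' u' =
  x ^ 2 * (J G a * A2 a) + (- (2 * x * y)) * (J Gb a * A1 a) + y ^ 2 * (J Gbb a * Af a).
Proof.
  intros Ha.
  rewrite (RInt_Rext _ (fun b => (x ^ 2 * A2 a) * (G a b * Bf b) +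
      (2 * x * y * A1 a) * (G a b * B1 b) + (y ^ 2 * Af a) * (G a b * B2 b))).
  2: exact Hl'. 2: intros b _; unfold box_integrand; ringR.
  assert (E : forall f : R -> R, (forall b, continuous f b) -> ex_RInt (fun b => G a b * f b) l' u').
  { intros f Hf. apply ex_RInt_cont; [exact Hl'|]. intros b Hb.
    contR; [apply (slice G C0); auto|apply Hf]. }
  assert (E' : forall k (f : R -> R), (forall b, continuous f b) ->
      ex_RInt (fun b => k * (G a b * f b)) l' u').
  { intros k f Hf. apply (ex_RInt_scal (V := R_NormedModule) (fun b => G a b * f b)). auto. }
  rewrite RInt_Rplus by (auto; apply (ex_RInt_plus (V := R_NormedModule)); auto).
  rewrite RInt_Rplus by auto.
  rewrite !RInt_Rmult by auto.
  rewrite inner1, inner2 by exact Ha. unfold J. ringR.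
Qed.

Let H a b := Gaa a b * x ^ 2 + 2 * Gba a b * x * y + Gbb a b * y ^ 2.

Let cH a b : O (a, b) -> continuity_2d_pt H a b.
Proof.
  intros Hp. unfold H.
  repeat first [ apply continuity_2d_pt_plus | apply continuity_2d_pt_mult
               | apply continuity_2d_pt_const ]; auto.
Qed.

Let J_H a : l <= a <= u -> J H a = x ^ 2 * J Gaa a + (2 * x * y) * J Gba a + y ^ 2 * J Gbb a.
Proof.
  intros Ha. unfold J at 1.
  rewrite (RInt_Rext _ (fun b => (x ^ 2) * (Gaa a b * Bf b) +
      (2 * x * y) * (Gba a b * Bf b) + (y ^ 2) * (Gbb a b * Bf b))).
  2: exact Hl'. 2: intros b _; unfold H; ringR.
  assert (E : forall h : R -> R -> R, (forall a b, O (a, b) -> continuity_2d_pt h a b) ->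
      ex_RInt (fun b => h a b * Bf b) l' u').
  { intros h C. apply ex_RInt_cont; [exact Hl'|]. intros b Hb.
    contR; [apply (slice h C); auto|apply cBf]. }
  assert (E' : forall k (h : R -> R -> R), (forall a b, O (a, b) -> continuity_2d_pt h a b) ->
      ex_RInt (fun b => k * (h a b * Bf b)) l' u').
  { intros k h C. apply (ex_RInt_scal (V := R_NormedModule) (fun b => h a b * Bf b)). auto. }
  rewrite RInt_Rplus by (auto; apply (ex_RInt_plus (V := R_NormedModule)); auto).
  rewrite RInt_Rplus by auto.
  rewrite !RInt_Rmult by auto. reflexivity.
Qed.

Lemma box_integral_by_parts :
  RInt (fun a => RInt (box_integrand a) l' u') l u = RInt (fun a => J H a * Af a) l u.
Proof.
  assert (E : forall (h : R -> R -> R) (f : R -> R), (forall a b, O (a, b) -> continuity_2d_pt h a b) ->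
      (forall a, continuous f a) -> ex_RInt (fun a => J h a * f a) l u).
  { intros h f C Cf. apply ex_RInt_cont; [exact Hl|]. intros a Ha.
    contR; [now apply J_continuous|auto]. }
  assert (E' : forall k (h : R -> R -> R) (f : R -> R), (forall a b, O (a, b) -> continuity_2d_pt h a b) ->
      (forall a, continuous f a) -> ex_RInt (fun a => k * (J h a * f a)) l u).
  { intros k h f C Cf. apply (ex_RInt_scal (V := R_NormedModule) (fun a => J h a * f a)). auto. }
  rewrite (RInt_Rext _ (fun a => x ^ 2 * (J G a * A2 a) + (- (2 * x * y)) * (J Gb a * A1 a)
     + y ^ 2 * (J Gbb a * Af a))).
  2: exact Hl. 2:{ intros a Ha. apply inner. lra. }
  rewrite (RInt_Rext (fun a => J H a * Af a) (fun a => x ^ 2 * (J Gaa a * Af a) +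
     (2 * x * y) * (J Gba a * Af a) + y ^ 2 * (J Gbb a * Af a))).
  2: exact Hl. 2:{ intros a Ha. rewrite J_H by lra. ringR. }
  rewrite !RInt_Rplus by (first [solve [auto] | apply (ex_RInt_plus (V := R_NormedModule)); auto]).
  rewrite (RInt_Rmult (fun a => J G a * A2 a)), (RInt_Rmult (fun a => J Gb a * A1 a)),
    (RInt_Rmult (fun a => J Gbb a * Af a)), (RInt_Rmult (fun a => J Gaa a * Af a)),
    (RInt_Rmult (fun a => J Gba a * Af a)) by auto.
  destruct A_ends as [? [? [? ?]]].
  assert (D1 : forall a, is_derive Af a (A1 a)) by (intros; apply (bump_d1 _ _ A)).
  assert (D2 : forall a, is_derive A1 a (A2 a)) by (intros; apply (bump_d2 _ _ A)).
  rewrite (RInt_by_parts (J G) (J Ga) A1 A2); auto.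
  rewrite (RInt_by_parts (J Ga) (J Gaa) Af A1); auto.
  rewrite (RInt_by_parts (J Gb) (J Gba) Af A1); auto.
  ringR.
Qed.

(** After the derivatives have been moved onto [G], the test function enters undifferentiated. Both
    bumps are positive inside the square, so a strict pointwise inequality stays strict through the
    two integrations. *)
Lemma box_integral_lt k :
  (forall a b, l <= a <= u -> l' <= b <= u' -> H a b < k) ->
  RInt (fun a => RInt (box_integrand a) l' u') l u <
  k * RInt (fun a => RInt (fun b => Af a * Bf b) l' u') l u.
Proof.
  intros Hk. rewrite box_integral_by_parts.
  set (I := RInt Bf l' u').
  assert (HB : ex_RInt Bf l' u') by (apply ex_RInt_cont; auto).
  rewrite (RInt_Rext (fun a => RInt (fun b => Af a * Bf b) l' u') (fun a => Af a * I)).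
  2: exact Hl. 2: intros a _; now apply RInt_Rmult.
  rewrite <- RInt_Rmult.
  2: apply ex_RInt_cont; [exact Hl|intros; contR; auto].

  apply RInt_lt.
  - unfold l, u; lra.
  - intros a Ha. contR; auto.
  - intros a Ha. contR; auto.
  - intros a Ha.
    assert (HA : 0 < Af a).
    { apply (bump_pos _ _ A). unfold l, u in Ha. apply Rabs_def1; lra. }
    enough (J H a < k * I) by nra.
    unfold I. rewrite <- RInt_Rmult by exact HB. apply RInt_lt.
    + unfold l', u'; lra.
    + intros; contR; auto.
    + intros b Hb. contR; [apply (slice H cH); lra|auto].
    + intros b Hb.
      assert (0 < Bf b).
      { apply (bump_pos _ _ B). unfold l', u' in Hb. apply Rabs_def1; lra. }
      apply Rmult_lt_compat_r; [assumption|]. apply Hk; lra.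
Qed.
End Box.

(** * Ellipticity as a pointwise inequality *)

Definition off_origin (p : vec) : Prop := p <> vzero.

Lemma off_origin_open : open off_origin.
Proof.
  intros [a b] Hp.
  assert (Hab : a <> 0 \/ b <> 0).
  { destruct (Req_dec a 0) as [->|]; [|tauto]. destruct (Req_dec b 0) as [->|]; [|tauto].
    now elim Hp. }
  destruct Hab as [H|H].
  - pose proof (Rabs_pos_lt _ H). exists (mkposreal _ H0). intros [u v] [Hu _] Heq.
    injection Heq as -> ->. change (Rabs (0 - a) < Rabs a) in Hu.
    rewrite Rminus_0_l, Rabs_Ropp in Hu. lra.
  - pose proof (Rabs_pos_lt _ H). exists (mkposreal _ H0). intros [u v] [_ Hv] Heq.
    injection Heq as -> ->. change (Rabs (0 - b) < Rabs b) in Hv.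
    rewrite Rminus_0_l, Rabs_Ropp in Hv. lra.
Qed.

Lemma hess_quad_product (A A1 A2 B B1 B2 : R -> R) p xi :
  (forall x, is_derive A x (A1 x)) -> (forall x, is_derive A1 x (A2 x)) ->
  (forall x, is_derive B x (B1 x)) -> (forall x, is_derive B1 x (B2 x)) ->
  hess_quad (fun q => A (fst q) * B (snd q)) p xi =
  A2 (fst p) * B (snd p) * fst xi ^ 2 + 2 * A1 (fst p) * B1 (snd p) * fst xi * snd xi
  + A (fst p) * B2 (snd p) * snd xi ^ 2.
Proof.
  intros HA HA1 HB HB1.
  assert (Hd1 : forall q, d1 (fun q => A (fst q) * B (snd q)) q = A1 (fst q) * B (snd q)).
  { intros q. apply is_derive_unique. simpl. pose proof (HA (fst q)).
    auto_derive; [ex_derive_ctx|rew_derive; ring]. }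
  assert (Hd2 : forall q, d2 (fun q => A (fst q) * B (snd q)) q = A (fst q) * B1 (snd q)).
  { intros q. apply is_derive_unique. simpl. pose proof (HB (snd q)).
    auto_derive; [ex_derive_ctx|rew_derive; ring]. }
  assert (H11 : d1 (d1 (fun q => A (fst q) * B (snd q))) p = A2 (fst p) * B (snd p)).
  { unfold d1 at 1. rewrite (Derive_ext _ (fun a => A1 a * B (snd p))) by (intros t; exact (Hd1 (t, snd p))).
    apply is_derive_unique. pose proof (HA1 (fst p)).
    auto_derive; [ex_derive_ctx|rew_derive; ring]. }
  assert (H21 : d2 (d1 (fun q => A (fst q) * B (snd q))) p = A1 (fst p) * B1 (snd p)).
  { unfold d2. rewrite (Derive_ext _ (fun b => A1 (fst p) * B b)) by (intros t; exact (Hd1 (fst p, t))).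
    apply is_derive_unique. pose proof (HB (snd p)).
    auto_derive; [ex_derive_ctx|rew_derive; ring]. }
  assert (H12 : d1 (d2 (fun q => A (fst q) * B (snd q))) p = A1 (fst p) * B1 (snd p)).
  { unfold d1. rewrite (Derive_ext _ (fun a => A a * B1 (snd p))) by (intros t; exact (Hd2 (t, snd p))).
    apply is_derive_unique. pose proof (HA (fst p)).
    auto_derive; [ex_derive_ctx|rew_derive; ring]. }
  assert (H22 : d2 (d2 (fun q => A (fst q) * B (snd q))) p = A (fst p) * B2 (snd p)).
  { unfold d2 at 1. rewrite (Derive_ext _ (fun b => A (fst p) * B1 b)) by (intros t; exact (Hd2 (fst p, t))).
    apply is_derive_unique. pose proof (HB1 (snd p)).
    auto_derive; [ex_derive_ctx|rew_derive; ring]. }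
  unfold hess_quad. rewrite H11, H21, H12, H22. ring.
Qed.

Lemma square_integral_box (F : vec -> R) r l u l' u' :
  - r <= l <= u -> u <= r -> - r <= l' <= u' -> u' <= r ->
  (forall a b, (a < l \/ u < a) \/ (b < l' \/ u' < b) -> F (a, b) = 0) ->
  (forall a, l <= a <= u -> ex_RInt (fun b => F (a, b)) l' u') ->
  ex_RInt (fun a => RInt (fun b => F (a, b)) l' u') l u ->
  square_integral r F = RInt (fun a => RInt (fun b => F (a, b)) l' u') l u.
Proof.
  intros H1 H2 H3 H4 Hz E1 E2. unfold square_integral.
  assert (Hin : forall a, RInt (fun b => F (a, b)) (- r) r = RInt (fun b => F (a, b)) l' u').
  { intros a.
    destruct (Rlt_dec a l) as [Ha|Ha]; [|destruct (Rlt_dec u a) as [Ha'|Ha']].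
    1, 2: rewrite 2!(RInt_Rext (fun b => F (a, b)) (fun _ => 0)) by
        (lra || intros; apply Hz; tauto);
      rewrite 2!RInt_const; unfold scal; simpl; unfold mult; simpl; ringR.
    apply RInt_supported; auto. apply E1; lra. }
  rewrite (RInt_ext _ (fun a => RInt (fun b => F (a, b)) l' u')) by (intros; apply Hin).
  apply RInt_supported; auto.
  intros a Ha. rewrite (RInt_Rext (fun b => F (a, b)) (fun _ => 0)) by
      (lra || intros; apply Hz; tauto).
  rewrite RInt_const; unfold scal; simpl; unfold mult; simpl; ringR.
Qed.

Section Elliptic.
Variable phi : vec -> R.
Hypothesis phi_smooth : smooth_anisotropy phi.
Let f (a b : R) := phi (a, b).

Lemma smooth_anisotropy_smooth2 : smooth2 off_origin f.
Proof. intros n t x Hp. exact (phi_smooth n (t, x) Hp). Qed.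
Let Sf := smooth_anisotropy_smooth2.

(** The second derivative of [phi ^ 2] in the direction [(x, y)], expanded by the product rule:
    twice the square of the directional derivative, plus [2 * phi] times the Hessian form of
    [phi]. *)
Definition hess_sqr (a b x y : R) : R :=
  (2 * (Dt f a b) ^ 2 + 2 * f a b * Dt (Dt f) a b) * x ^ 2
  + 2 * (2 * Dt f a b * Dx f a b + 2 * f a b * Dt (Dx f) a b) * x * y
  + (2 * (Dx f a b) ^ 2 + 2 * f a b * Dx (Dx f) a b) * y ^ 2.

(** If the bound failed at a point off the origin, it would fail strictly, for the same direction,
    on a small square around it by continuity; the product bump supported there would contradict the
    distributional inequality. The constant is the same. *)
Lemma elliptic_pointwise :
  elliptic phi ->
  exists c, 0 < c /\ forall a b x y, (a, b) <> vzero -> c * (x ^ 2 + y ^ 2) <= hess_sqr a b x y.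
Proof.
  intros [c [Hc Hell]]. exists c. split; [exact Hc|]. intros a0 b0 x y Hp.
  destruct (Rle_lt_dec (c * (x ^ 2 + y ^ 2)) (hess_sqr a0 b0 x y)) as [|Hlt]; [assumption|exfalso].
  set (k := c * (x ^ 2 + y ^ 2)) in *.
  pose proof (smooth2_Dt _ _ Sf) as St. pose proof (smooth2_Dx _ _ Sf) as Sx.
  pose proof (smooth2_Dt _ _ St) as Stt. pose proof (smooth2_Dt _ _ Sx) as Stx.
  pose proof (smooth2_Dx _ _ Sx) as Sxx.
  assert (Cc : forall g, smooth2 off_origin g -> forall a b, off_origin (a, b) -> continuity_2d_pt g a b)
    by (intros; eapply smooth2_continuity; eauto).
  assert (Hcont : forall a b, off_origin (a, b) -> continuity_2d_pt (fun a b => hess_sqr a b x y) a b).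
  { intros a b Hab. unfold hess_sqr.
    repeat first [ apply continuity_2d_pt_plus | apply continuity_2d_pt_mult
                 | apply continuity_2d_pt_const ]; apply Cc; auto. }
  assert (Hnear : locally_2d (fun a b => hess_sqr a b x y < k) a0 b0).
  { destruct (Hcont _ _ Hp (mkposreal (k - hess_sqr a0 b0 x y) ltac:(lra))) as [d Hd].
    exists d. intros u v Hu Hv. specialize (Hd u v Hu Hv). simpl in Hd.
    apply Rabs_lt_between in Hd. lra. }
  destruct Hnear as [e1 He1].
  destruct (open_locally_2d _ _ _ off_origin_open Hp) as [e2 He2].
  set (rho := Rmin e1 e2 / 2).
  assert (Hm : 0 < Rmin e1 e2) by (apply Rmin_pos; apply cond_pos).
  pose proof (Rmin_l e1 e2). pose proof (Rmin_r e1 e2).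
  assert (Hrho : 0 < rho) by (unfold rho; lra).
  assert (Hre1 : rho < e1) by (unfold rho; lra).
  assert (Hre2 : rho < e2) by (unfold rho; lra).
  destruct (bump_exists a0 rho Hrho) as [A _]. destruct (bump_exists b0 rho Hrho) as [B _].
  set (l := a0 - rho). set (u := a0 + rho). set (l' := b0 - rho). set (u' := b0 + rho).
  assert (Hbox : forall a b, l <= a <= u -> l' <= b <= u' -> off_origin (a, b)).
  { intros a b Ha Hb. unfold l, u, l', u' in *. apply He2; apply Rabs_def1; lra. }
  assert (Hk : forall a b, l <= a <= u -> l' <= b <= u' -> hess_sqr a b x y < k).
  { intros a b Ha Hb. unfold l, u, l', u' in *. apply He1; apply Rabs_def1; lra. }
  (* Large enough for the square of half-width [r] about the origin, on which ellipticity is tested,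
     to contain the small one. *)
  set (r := Rabs a0 + Rabs b0 + rho).
  assert (Hr1 : - r <= l <= u) by
    (unfold r, l, u; pose proof (Rabs_pos b0); pose proof (Rle_abs (- a0)); rewrite Rabs_Ropp in *; lra).
  assert (Hr2 : u <= r) by
    (unfold r, u; pose proof (Rabs_pos b0); pose proof (Rle_abs a0); lra).
  assert (Hr3 : - r <= l' <= u') by
    (unfold r, l', u'; pose proof (Rabs_pos a0); pose proof (Rle_abs (- b0)); rewrite Rabs_Ropp in *; lra).
  assert (Hr4 : u' <= r) by
    (unfold r, u'; pose proof (Rabs_pos a0); pose proof (Rle_abs b0); lra).
  set (eta := fun q : vec => bf _ _ A (fst q) * bf _ _ B (snd q)).
  assert (Hout : forall (d : R) (b : bump d rho) s, (s < d - rho \/ d + rho < s) ->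
     bf _ _ b s = 0 /\ bf1 _ _ b s = 0 /\ bf2 _ _ b s = 0).
  { intros d b s Hs. assert (rho < Rabs (s - d)) by (unfold Rabs; destruct (Rcase_abs (s - d)); lra).
    destruct (bump_out _ _ b s); [lra|]. split; [|split]; auto. now apply (bump_out2 _ _ b). }
  assert (Heta : forall a b, (a < l \/ u < a) \/ (b < l' \/ u' < b) -> eta (a, b) = 0).
  { intros a b [Hs|Hs]; unfold eta; simpl.
    - destruct (Hout _ A a Hs) as [-> _]. ring.
    - destruct (Hout _ B b Hs) as [-> _]. ring. }
  assert (Hhess : forall a b, hess_quad eta (a, b) (x, y) =
      bf2 _ _ A a * bf _ _ B b * x ^ 2 + 2 * bf1 _ _ A a * bf1 _ _ B b * x * y
      + bf _ _ A a * bf2 _ _ B b * y ^ 2).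
  { intros a b. unfold eta. rewrite (hess_quad_product _ (bf1 _ _ A) (bf2 _ _ A) _ (bf1 _ _ B) (bf2 _ _ B)).
    reflexivity. apply bump_d1. apply bump_d2. apply bump_d1. apply bump_d2. }
  assert (Hpos : forall (d : R) (b : bump d rho) s, 0 <= bf _ _ b s).
  { intros d b s. destruct (Rlt_dec (Rabs (s - d)) rho) as [Hs|Hs].
    - left. now apply (bump_pos _ _ b).
    - destruct (bump_out _ _ b s); lra. }
  specialize (Hell r eta (x, y)).
  assert (cA : forall s, continuous (bf _ _ A) s) by (intros; exact (is_derive_continuous _ _ _ (bump_d1 _ _ A s))).
  assert (cA1 : forall s, continuous (bf1 _ _ A) s) by (intros; exact (is_derive_continuous _ _ _ (bump_d2 _ _ A s))).
  assert (cB : forall s, continuous (bf _ _ B) s) by (intros; exact (is_derive_continuous _ _ _ (bump_d1 _ _ B s))).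
  assert (cB1 : forall s, continuous (bf1 _ _ B) s) by (intros; exact (is_derive_continuous _ _ _ (bump_d2 _ _ B s))).
  assert (cx : forall g t s, (forall z, continuous g z) -> continuity_2d_pt (fun u _ : R => g u) t s).
  { intros g t s Hg. apply (continuity_1d_2d_pt_comp g (fun u _ => u)).
    - apply continuity_pt_filterlim, Hg.
    - apply continuity_2d_pt_id1. }
  set (G := fun a b => f a b ^ 2).
  assert (HG : forall a b, off_origin (a, b) -> continuity_2d_pt G a b).
  { intros a b Hab. unfold G.
    repeat first [ apply continuity_2d_pt_plus | apply continuity_2d_pt_mult
                 | apply continuity_2d_pt_const ]; apply Cc; auto. }
  set (T := box_integrand a0 b0 rho A B G x y).
  assert (CT : forall a b, off_origin (a, b) -> continuity_2d_pt T a b).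
  { intros a b Hab. unfold T, box_integrand.
    assert (cA2 : forall s, continuous (bf2 _ _ A) s) by (intros; apply bump_c2).
    assert (cB2 : forall s, continuous (bf2 _ _ B) s) by (intros; apply bump_c2).
    repeat match goal with
    | |- continuity_2d_pt (fun a b => G a b) _ _ => apply HG; exact Hab
    | |- continuity_2d_pt (fun _ _ => ?c) _ _ => apply continuity_2d_pt_const
    | |- continuity_2d_pt (fun a b => @?g a b + @?h a b) _ _ => apply (continuity_2d_pt_plus g h)
    | |- continuity_2d_pt (fun a b => @?g a b * @?h a b) _ _ => apply (continuity_2d_pt_mult g h)
    | |- continuity_2d_pt (fun a b => ?g a) _ _ => apply cx; auto
    | |- continuity_2d_pt (fun a b => ?g b) _ _ => apply continuity_2d_pt_x; auto
    end. }
  assert (I1 : square_integral r (fun p => phi p ^ 2 * hess_quad eta p (x, y))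
     = RInt (fun a => RInt (T a) l' u') l u).
  { assert (HT : forall a b, phi (a, b) ^ 2 * hess_quad eta (a, b) (x, y) = T a b).
    { intros a b. rewrite Hhess. reflexivity. }
    assert (HTi : forall a, RInt (fun b => phi (a, b) ^ 2 * hess_quad eta (a, b) (x, y)) l' u' = RInt (T a) l' u').
    { intros a. apply RInt_ext. intros b _. apply HT. }
    rewrite (square_integral_box _ r l u l' u'); auto.
    - apply RInt_ext. intros a _. apply HTi.
    - intros a b Hs. rewrite HT. unfold T, box_integrand.
      destruct Hs as [Hs|Hs].
      + destruct (Hout _ A a Hs) as [-> [-> ->]]. ring.
      + destruct (Hout _ B b Hs) as [-> [-> ->]]. ring.
    - intros a Ha. apply ex_RInt_ext with (T a). { intros; symmetry; apply HT. }
      apply ex_RInt_cont; [lra|]. intros b Hb. apply continuity_2d_pt_1d_x. auto.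
    - apply ex_RInt_ext with (fun a => RInt (T a) l' u'). { intros; symmetry; apply HTi. }
      apply ex_RInt_cont; [lra|]. intros a Ha. apply RInt_param_continuous; [lra|].
      exists off_origin. split; [exact off_origin_open|]. auto. }
  assert (I2 : square_integral r eta = RInt (fun a => RInt (fun b => bf _ _ A a * bf _ _ B b) l' u') l u).
  { assert (CE : forall a b, continuity_2d_pt (fun a b => bf _ _ A a * bf _ _ B b) a b).
    { intros a b. apply continuity_2d_pt_mult; [now apply cx|now apply continuity_2d_pt_x]. }
    apply square_integral_box; auto.
    - intros a Ha. apply ex_RInt_cont; [lra|]. intros b Hb. apply (continuity_2d_pt_1d_x _ _ _ (CE a b)).
    - apply ex_RInt_cont; [lra|]. intros a Ha.
      apply (RInt_param_continuous (fun a b => bf _ _ A a * bf _ _ B b)); [lra|].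
      exists (fun _ => True). split; [apply open_true|]. auto. }
  rewrite I1, I2 in Hell.
  assert (Hsm : smooth_on (fun _ => True) eta).
  { intros n p _. exact (ex_diff_n_product n (bf _ _ A) (bf _ _ B) _ _ (bump_Cn _ _ A) (bump_Cn _ _ B)). }
  assert (Hsup : supported_in_square r eta).
  { intros [a b] Hab. apply Heta. simpl in Hab.
    destruct (Rlt_dec a l); [tauto|]. destruct (Rlt_dec u a); [tauto|].
    destruct (Rlt_dec b l'); [tauto|]. destruct (Rlt_dec u' b); [tauto|exfalso].
    apply (Rlt_not_le _ _ Hab). apply Rmax_lub; apply Rabs_le; lra. }
  specialize (Hell Hsm (fun p => Rmult_le_pos _ _ (Hpos _ A _) (Hpos _ B _)) Hsup).
  assert (Hdot : c * dot (x, y) (x, y) = k) by (unfold k, dot; simpl; ring).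
  rewrite Hdot in Hell.
  apply (Rge_not_lt _ _ Hell).
  apply (box_integral_lt a0 b0 rho A B off_origin G
     (fun a b => 2 * f a b * Dt f a b) (fun a b => 2 * f a b * Dx f a b)
     (fun a b => 2 * (Dt f a b) ^ 2 + 2 * f a b * Dt (Dt f) a b)
     (fun a b => 2 * Dt f a b * Dx f a b + 2 * f a b * Dt (Dx f) a b)
     (fun a b => 2 * (Dx f a b) ^ 2 + 2 * f a b * Dx (Dx f) a b) x y Hrho off_origin_open Hbox);
   try assumption; try (
    intros; repeat first [ apply continuity_2d_pt_plus | apply continuity_2d_pt_mult
                 | apply continuity_2d_pt_const ]; apply Cc; assumption).
  - intros a b Hab. pose proof (smooth2_is_derive_t _ _ _ _ Sf Hab).
    unfold G. auto_derive; [ex_derive_ctx|rew_derive; ring].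
  - intros a b Hab. pose proof (smooth2_is_derive_x _ _ _ _ Sf Hab).
    unfold G. auto_derive; [ex_derive_ctx|rew_derive; ring].
  - intros a b Hab. pose proof (smooth2_is_derive_t _ _ _ _ Sf Hab).
    pose proof (smooth2_is_derive_t _ _ _ _ St Hab).
    auto_derive; [ex_derive_ctx|rew_derive; ring].
  - intros a b Hab. pose proof (smooth2_is_derive_t _ _ _ _ Sf Hab).
    pose proof (smooth2_is_derive_t _ _ _ _ Sx Hab).
    auto_derive; [ex_derive_ctx|rew_derive; ring].
  - intros a b Hab. pose proof (smooth2_is_derive_x _ _ _ _ Sf Hab).
    pose proof (smooth2_is_derive_x _ _ _ _ Sx Hab).
    auto_derive; [ex_derive_ctx|rew_derive; ring].
Qed.
End Elliptic.

(** * The norm and its Hessian in polar coordinates *)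

Lemma is_derive_le_slope (g : R -> R) l k :
  is_derive g 0 l -> (forall h, 0 < h -> g h <= g 0 + h * k) -> l <= k.
Proof.
  intros Hd Hg. apply is_derive_Reals in Hd.
  apply Rnot_lt_le. intros Hlt.
  destruct (Hd (l - k) ltac:(lra)) as [d H]. pose proof (cond_pos d).
  specialize (H (d / 2) ltac:(lra) ltac:(rewrite Rabs_pos_eq; lra)).
  rewrite Rplus_0_l in H. apply Rabs_lt_between in H.
  specialize (Hg (d / 2) ltac:(lra)).
  assert (E : (g (d / 2) - g 0) / (d / 2) <= k).
  { apply Rmult_le_reg_r with (d / 2); [lra|].
    unfold Rdiv at 1. rewrite Rmult_assoc, Rinv_l by lra. lra. }
  lra.
Qed.

Lemma is_derive_det (g : R -> R) (x l k : R) : is_derive g x l -> is_derive g x k -> l = k.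
Proof. intros Hl Hk. now rewrite <- (is_derive_unique _ _ _ Hl), (is_derive_unique _ _ _ Hk). Qed.

Section Inverse.
Variables (al A : R -> R).
Hypothesis al_d : forall t, is_derive al t (A t).
Hypothesis A_pos : forall t, 0 < A t.
Hypothesis A_cont : forall t, continuous A t.

Lemma positive_derivative_increasing s t : s < t -> al s < al t.
Proof.
  intros H. destruct (MVT_gen al s t A) as [c [_ Hc]].
  - intros; apply al_d.
  - intros x _. apply continuity_pt_filterlim. exact (is_derive_continuous _ _ _ (al_d x)).
  - pose proof (A_pos c). nra.
Qed.

(** [T] is any right inverse. Its continuity follows from the strict monotonicity of [al], and by
    the mean value theorem its difference quotient is [/ A c] for some [c] between [T th] and
    [T (th + h)]. *)
Lemma is_derive_inverse (T : R -> R) :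
  (forall th, al (T th) = th) -> forall th, is_derive T th (/ A (T th)).
Proof.
  intros HT th.
  assert (inc : forall s t, al s < al t -> s < t).
  { intros s t H. destruct (Rtotal_order s t) as [|[->|H']]; [assumption|lra|].
    apply positive_derivative_increasing in H'. lra. }
  assert (cont : forall e, 0 < e -> exists d, 0 < d /\
     forall h, Rabs h < d -> Rabs (T (th + h) - T th) < e).
  { intros e He.
    pose proof (positive_derivative_increasing (T th - e) (T th) ltac:(lra)) as H1.
    pose proof (positive_derivative_increasing (T th) (T th + e) ltac:(lra)) as H2.
    rewrite HT in H1, H2.
    exists (Rmin (th - al (T th - e)) (al (T th + e) - th)).
    split; [apply Rmin_pos; lra|]. intros h Hh.
    pose proof (Rmin_l (th - al (T th - e)) (al (T th + e) - th)).
    pose proof (Rmin_r (th - al (T th - e)) (al (T th + e) - th)).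
    apply Rabs_lt_between in Hh. apply Rabs_lt_between.
    pose proof (inc (T th - e) (T (th + h)) ltac:(rewrite HT; lra)).
    pose proof (inc (T (th + h)) (T th + e) ltac:(rewrite HT; lra)). lra. }
  apply is_derive_Reals. intros eps Heps.
  assert (Hc : continuity_pt (fun t => / A t) (T th)).
  { apply continuity_pt_inv. apply continuity_pt_filterlim, A_cont.
    apply Rgt_not_eq, A_pos. }
  destruct (Hc eps Heps) as [d1 [Hd1 Hd1']].
  destruct (cont d1 Hd1) as [d2 [Hd2 Hd2']].
  exists (mkposreal d2 Hd2). intros h Hh Hhd. simpl in Hhd. specialize (Hd2' h Hhd).
  destruct (MVT_gen al (T th) (T (th + h)) A) as [c [Hcb Hcv]].
  - intros; apply al_d.
  - intros x _. apply continuity_pt_filterlim. exact (is_derive_continuous _ _ _ (al_d x)).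
  - rewrite 2!HT in Hcv. pose proof (A_pos c).
    assert (Hq : T (th + h) - T th = h * / A c).
    { apply Rmult_eq_reg_l with (A c); [|lra]. rewrite <- Hcv. field. lra. }
    rewrite Hq. replace (h * / A c / h) with (/ A c) by (field; split; lra).
    destruct (Req_dec c (T th)) as [->|Hne].
    + rewrite Rminus_eq_0, Rabs_R0. exact Heps.
    + apply Hd1'. split.
      * split; [exact I|]. intros E. apply Hne. now symmetry.
      * apply Rle_lt_trans with (2 := Hd2'). simpl. unfold Rdist.
        unfold Rmin, Rmax in Hcb. destruct (Rle_dec (T th) (T (th + h))).
        -- rewrite 2!Rabs_pos_eq; lra.
        -- rewrite 2!Rabs_left1; lra.
Qed.
End Inverse.

Section Angle.
Variable g : R -> R -> R.

Definition ang (g : R -> R -> R) (th : R) : R := g (cos th) (sin th).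

Lemma off_origin_cos_sin th : off_origin (cos th, sin th).
Proof.
  intros H. injection H as H1 H2. pose proof (sin2_cos2 th) as H.
  rewrite H1, H2 in H. unfold Rsqr in H. lra.
Qed.

Lemma ang_derive : smooth2 off_origin g -> forall th,
  is_derive (ang g) th (- sin th * ang (Dt g) th + cos th * ang (Dx g) th).
Proof.
  intros Sg th. evar_last.
  - apply (smooth2_is_derive_comp off_origin g cos sin th (- sin th) (cos th)).
    + exact off_origin_open.
    + exact Sg.
    + apply off_origin_cos_sin.
    + auto_derive; [exact I|ring].
    + auto_derive; [exact I|ring].
  - unfold ang. ring.
Qed.
End Angle.

Lemma sin_Cn_cos_Cn n : Cn n cos /\ Cn n sin.
Proof.
  induction n as [|n [Hc Hs]]; [split; exact I|]. split.
  - exists (fun x => -1 * sin x). split; [|now apply Cn_scal].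
    intros x. auto_derive; [exact I|ring].
  - exists cos. split; [|exact Hc]. intros x. auto_derive; [exact I|ring].
Qed.

Lemma ang_Cn n g : smooth2 off_origin g -> Cn n (ang g).
Proof.
  revert g; induction n as [|n IH]; intros g Sg; [exact I|].
  exists (fun th => (-1 * sin th) * ang (Dt g) th + cos th * ang (Dx g) th). split.
  - intros th. evar_last; [now apply ang_derive|]. ring.
  - destruct (sin_Cn_cos_Cn n) as [Hc Hs].
    apply Cn_plus; apply Cn_mult; auto using Cn_scal.
    + apply IH. now apply smooth2_Dt.
    + apply IH. now apply smooth2_Dx.
Qed.

Section Polar.
Variable phi : vec -> R.
Hypothesis phi_norm : anisotropy phi.
Hypothesis phi_smooth : smooth_anisotropy phi.
Hypothesis phi_elliptic : elliptic phi.
Let f (a b : R) := phi (a, b).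
Let Sf : smooth2 off_origin f := smooth_anisotropy_smooth2 phi phi_smooth.
Let St : smooth2 off_origin (Dt f) := smooth2_Dt _ _ Sf.
Let Sx : smooth2 off_origin (Dx f) := smooth2_Dx _ _ Sf.

Let phi_pos p : p <> vzero -> 0 < phi p.
Proof.
  intros Hp. destruct phi_norm as [H0 [H1 _]].
  destruct (H0 p) as [H|H]; [exact H|]. elim Hp. now apply H1.
Qed.

(** Differentiate the homogeneity of [phi] along the ray through [(a, b)], at [r = 1]. *)
Lemma euler_identity a b : off_origin (a, b) -> a * Dt f a b + b * Dx f a b = f a b.
Proof.
  intros Hab.
  assert (D1 : is_derive (fun r => f (r * a) (r * b)) 1 (Dt f a b * a + Dx f a b * b)).
  { evar_last.
    - apply (smooth2_is_derive_comp off_origin f (fun r => r * a) (fun r => r * b) 1 a b off_origin_open Sf).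
      + now rewrite 2!Rmult_1_l.
      + auto_derive; [exact I|ring].
      + auto_derive; [exact I|ring].
    - now rewrite 2!Rmult_1_l. }
  assert (D2 : is_derive (fun r => f (r * a) (r * b)) 1 (f a b)).
  { apply is_derive_ext_loc with (fun r => r * f a b).
    - exists (mkposreal 1 Rlt_0_1). intros r Hr. change (Rabs (r - 1) < 1) in Hr.
      apply Rabs_lt_between in Hr. destruct phi_norm as [_ [_ [H _]]].
      specialize (H r (a, b)). unfold vscal in H; simpl in H.
      unfold f. rewrite H, Rabs_pos_eq; lra.
    - auto_derive; [exact I|ring]. }
  pose proof (is_derive_det _ _ _ _ D1 D2). lra.
Qed.

(** Differentiating Euler's identity in each variable shows that the Hessian annihilates the radial
    direction. *)
Lemma euler_second a b : off_origin (a, b) ->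
  a * Dt (Dt f) a b + b * Dt (Dx f) a b = 0 /\ a * Dt (Dx f) a b + b * Dx (Dx f) a b = 0.
Proof.
  intros Hab.
  pose proof (open_locally_2d _ _ _ off_origin_open Hab) as Hloc.
  assert (Hs : Dt (Dx f) a b = Dx (Dt f) a b) by (apply (smooth2_Schwarz off_origin); auto using off_origin_open).
  pose proof (smooth2_is_derive_t _ _ _ _ St Hab) as D1.
  pose proof (smooth2_is_derive_t _ _ _ _ Sx Hab) as D2.
  pose proof (smooth2_is_derive_x _ _ _ _ St Hab) as D3.
  pose proof (smooth2_is_derive_x _ _ _ _ Sx Hab) as D4.
  pose proof (smooth2_is_derive_t _ _ _ _ Sf Hab) as D5.
  pose proof (smooth2_is_derive_x _ _ _ _ Sf Hab) as D6.
  split.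
  - assert (E : is_derive (fun s => f s b) a (Dt f a b + a * Dt (Dt f) a b + b * Dt (Dx f) a b)).
    { apply is_derive_ext_loc with (fun s => s * Dt f s b + b * Dx f s b).
      - destruct Hloc as [d Hd]. exists d. intros s Hs'. apply euler_identity, Hd; [exact Hs'|].
        rewrite Rminus_eq_0, Rabs_R0. apply cond_pos.
      - auto_derive; [ex_derive_ctx|rew_derive; ring]. }
    pose proof (is_derive_det _ _ _ _ D5 E). lra.
  - assert (E : is_derive (fun s => f a s) b (a * Dx (Dt f) a b + Dx f a b + b * Dx (Dx f) a b)).
    { apply is_derive_ext_loc with (fun s => a * Dt f a s + s * Dx f a s).
      - destruct Hloc as [d Hd]. exists d. intros s Hs'. apply euler_identity, Hd; [|exact Hs'].
        rewrite Rminus_eq_0, Rabs_R0. apply cond_pos.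
      - auto_derive; [ex_derive_ctx|rew_derive; ring]. }
    pose proof (is_derive_det _ _ _ _ D6 E). rewrite Hs. lra.
Qed.

Let p (th : R) := ang f th.

(** By subadditivity, [phi] grows from [(a, b)] in the direction [(x, y)] at slope at most
    [phi (x, y)]. Hence every gradient of [phi] has polar norm at most 1. *)
Lemma dual_support a b x y : off_origin (a, b) -> Dt f a b * x + Dx f a b * y <= phi (x, y).
Proof.
  intros Hab.
  assert (D : is_derive (fun h => f (a + h * x) (b + h * y)) 0 (Dt f a b * x + Dx f a b * y)).
  { evar_last.
    - apply (smooth2_is_derive_comp off_origin f (fun h => a + h * x) (fun h => b + h * y) 0 x y off_origin_open Sf).
      + now rewrite 2!Rmult_0_l, 2!Rplus_0_r.
      + auto_derive; [exact I|ring].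
      + auto_derive; [exact I|ring].
    - now rewrite 2!Rmult_0_l, 2!Rplus_0_r. }
  apply (is_derive_le_slope _ _ _ D). intros h Hh.
  rewrite 2!Rmult_0_l, 2!Rplus_0_r. destruct phi_norm as [_ [_ [H1 H2]]].
  specialize (H1 h (x, y)). rewrite Rabs_pos_eq in H1 by lra. rewrite <- H1.
  exact (H2 (a, b) (vscal h (x, y))).
Qed.

(** [dual_support] bounds the supremum by [c], and Euler's identity shows that it is attained at
    [(a, b)] normalized to [phi = 1]. *)
Lemma polar_at_gradient a b c :
  off_origin (a, b) -> 0 <= c -> polar phi (c * Dt f a b, c * Dx f a b) = c.
Proof.
  intros Hab Hc. unfold polar.
  rewrite (is_lub_Rbar_unique _ (Finite c)); [reflexivity|]. split.
  - intros s [[x y] [H1 ->]]. unfold dot; simpl.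
    pose proof (dual_support a b x y Hab). nra.
  - intros M HM. apply HM. pose proof (phi_pos _ Hab) as Hp.
    exists (vscal (/ phi (a, b)) (a, b)). split.
    + destruct phi_norm as [_ [_ [H _]]]. rewrite H, Rabs_pos_eq.
      * rewrite Rinv_l; lra.
      * left. now apply Rinv_0_lt_compat.
    + unfold dot; simpl.
      replace (/ phi (a, b) * a * (c * Dt f a b) + / phi (a, b) * b * (c * Dx f a b))
        with (/ phi (a, b) * c * (a * Dt f a b + b * Dx f a b)) by ring.
      rewrite euler_identity by exact Hab. unfold f. field. lra.
Qed.

(** The right side is p + p'' at [th], and equals the tangential second derivative [w] of [phi].
    Ellipticity is tested in the direction orthogonal to the gradient: the squared first derivative
    drops out of [hess_sqr], and by Euler's identity what remains is [2 * v ^ 3 * w], with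
    [v = phi > 0]. If [w] were not positive, the gradient would vanish, against Euler's identity. *)
Lemma norm_radius_convex th :
  0 < p th + (- cos th * ang (Dt f) th - sin th * (- sin th * ang (Dt (Dt f)) th + cos th * ang (Dx (Dt f)) th)
    - sin th * ang (Dx f) th + cos th * (- sin th * ang (Dt (Dx f)) th + cos th * ang (Dx (Dx f)) th)).
Proof.
  destruct (elliptic_pointwise phi phi_smooth phi_elliptic) as [c [Hc Hell]].
  pose proof (off_origin_cos_sin th) as Ho.
  pose proof (euler_identity _ _ Ho) as E1. destruct (euler_second _ _ Ho) as [E2 E3].
  assert (Hs : Dt (Dx f) (cos th) (sin th) = Dx (Dt f) (cos th) (sin th))
    by (apply (smooth2_Schwarz off_origin); auto using off_origin_open).
  pose proof (phi_pos _ Ho) as Hp. change (0 < f (cos th) (sin th)) in Hp.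
  specialize (Hell (cos th) (sin th) (- Dx f (cos th) (sin th)) (Dt f (cos th) (sin th)) Ho).
  pose proof (sin2_cos2 th) as Hcs. unfold Rsqr in Hcs.
  unfold p, ang. unfold hess_sqr in Hell. rewrite <- Hs. clear Hs.
  change (fun a b => phi (a, b)) with f in Hell. cbv beta in Hell.
  change (phi (cos th, sin th)) with (f (cos th) (sin th)) in Hell.
  set (ft := Dt f (cos th) (sin th)) in *. set (fx := Dx f (cos th) (sin th)) in *.
  set (ftt := Dt (Dt f) (cos th) (sin th)) in *. set (fxx := Dx (Dx f) (cos th) (sin th)) in *.
  set (m := Dt (Dx f) (cos th) (sin th)) in *.
  set (v := f (cos th) (sin th)) in *.
  clearbody ft fx ftt fxx m v. generalize dependent (sin th). intros s; intros. generalize dependent (cos th). intros k; intros.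
  (* As the radial direction is in its kernel, the Hessian is [w] times the projection onto the
     tangent [(- s, k)]; the next three assertions are its entries. *)
  set (w := s * s * ftt - 2 * s * k * m + k * k * fxx).
  assert (Htt : ftt = s * s * w).
  { assert (H : ftt * (s * s + k * k) ^ 2 - s * s * w =
      (2 * s * s * k + k * k * k) * (k * ftt + s * m) - s * k * k * (k * m + s * fxx)) by (unfold w; ring).
    rewrite Hcs, E2, E3 in H. lra. }
  assert (Hm : m = - s * k * w).
  { assert (H : m * (s * s + k * k) ^ 2 + s * k * w =
      s * s * s * (k * ftt + s * m) + k * k * k * (k * m + s * fxx)) by (unfold w; ring).
    rewrite Hcs, E2, E3 in H. lra. }
  assert (Hxx : fxx = k * k * w).
  { assert (H : fxx * (s * s + k * k) ^ 2 - k * k * w =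
      (2 * k * k * s + s * s * s) * (k * m + s * fxx) - s * s * k * (k * ftt + s * m)) by (unfold w; ring).
    rewrite Hcs, E2, E3 in H. lra. }
  replace (v + _) with w by (rewrite <- E1; unfold w; ring).
  clearbody w. subst ftt m fxx.
  replace ((2 * ft ^ 2 + 2 * v * (s * s * w)) * (- fx) ^ 2 +
    2 * (2 * ft * fx + 2 * v * (- s * k * w)) * - fx * ft + (2 * fx ^ 2 + 2 * v * (k * k * w)) * ft ^ 2)
    with (2 * v * w * (k * ft + s * fx) ^ 2) in Hell by ring.
  rewrite E1 in Hell.
  apply Rnot_le_lt. intros Hw.
  assert (Hv3 : 0 < v ^ 3) by now apply pow_lt.
  assert (Hz : (- fx) ^ 2 + ft ^ 2 <= 0) by nra.
  assert (fx = 0) by nra. assert (ft = 0) by nra. subst. lra.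
Qed.
End Polar.

(** * The polar norm in polar coordinates *)

(* The polar norm at angle th is [pF th], with derivative [pF1]; [pW] is
   [pF + pF''], and the last field says that the gradients are subgradients. *)
Record polar_profile (phi : vec -> R) := {
  pF : R -> R; pF1 : R -> R; pW : R -> R; pW1 : R -> R;
  polar_eq : forall r th, 0 < r -> polar phi (r * cos th, r * sin th) = r * pF th;
  pF_derive : forall th, is_derive pF th (pF1 th);
  pF1_derive : forall th, is_derive pF1 th (pW th - pF th);
  pW_derive : forall th, is_derive pW th (pW1 th);
  pW1_cont : forall th, continuous pW1 th;
  pF_pos : forall th, 0 < pF th;
  pW_pos : forall th, 0 < pW th;
  pF_support : forall th th', pF th * cos (th' - th) + pF1 th * sin (th' - th) <= pF th'
}.

(** Since [atan] is bounded by [PI / 2 <= 2], the values at [th - 2] and [th + 2] enclose [th]. This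
    gives the surjectivity of the gradient angle. *)
Lemma atan_shift_onto (q : R -> R) :
  (forall t, continuous q t) -> forall th, exists t, t + atan (q t) = th.
Proof.
  intros Hq th.
  destruct (IVT_gen (fun t => t + atan (q t)) (th - 2) (th + 2) th) as [t [_ Ht]].
  - intros x. apply continuity_pt_filterlim.
    apply (continuous_plus (fun t => t) (fun t => atan (q t)) x).
    + apply continuous_id.
    + apply (continuous_comp q atan); [apply Hq|].
      apply (is_derive_continuous atan _ _ (is_derive_atan (q x))).
  - pose proof (atan_bound (q (th - 2))). pose proof (atan_bound (q (th + 2))).
    pose proof PI_4. rewrite Rmin_left, Rmax_right by lra. lra.
  - now exists t.
Qed.

(* With p t = phi (cos t, sin t), the gradient of phi at (cos t, sin t) has length
   rho = sqrt (p^2 + p'^2) and angle al t = t + atan (p' / p), and the polar norm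
   is 1 / rho in that direction.  Since al' = p (p + p'') / rho^2 > 0, the profile
   is obtained by composing with the inverse of al. *)
Lemma polar_profile_exists phi :
  anisotropy phi -> smooth_anisotropy phi -> elliptic phi -> exists _ : polar_profile phi, True.
Proof.
  intros Hn Hs He.
  set (f := fun a b => phi (a, b)).
  assert (Sf : smooth2 off_origin f) by exact (smooth_anisotropy_smooth2 phi Hs).
  pose proof (smooth2_Dt _ _ Sf) as St. pose proof (smooth2_Dx _ _ Sf) as Sx.
  (* Four orders: [pW1] involves the third derivative of [p], and its continuity uses the fourth. *)
  destruct (ang_Cn 4 f Sf) as [q1 [D0 [q2 [D1 [q3 [D2 [q4 [D3 _]]]]]]]].
  set (p := ang f) in *.
  assert (Hp : forall t, 0 < p t).
  { intros t. destruct Hn as [H0 [H1 _]]. destruct (H0 (cos t, sin t)) as [H|H]; [exact H|].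
    elim (off_origin_cos_sin t). now apply H1. }
  assert (E1 : forall t, q1 t = - sin t * ang (Dt f) t + cos t * ang (Dx f) t).
  { intros t. exact (is_derive_det _ _ _ _ (D0 t) (ang_derive f Sf t)). }
  assert (E0 : forall t, p t = cos t * ang (Dt f) t + sin t * ang (Dx f) t).
  { intros t. symmetry. apply (euler_identity phi Hn Hs). apply off_origin_cos_sin. }
  assert (Hw : forall t, 0 < p t + q2 t).
  { intros t. pose proof (norm_radius_convex phi Hn Hs He t) as H.
    replace (q2 t) with (- cos t * ang (Dt f) t - sin t * (- sin t * ang (Dt (Dt f)) t + cos t * ang (Dx (Dt f)) t)
    - sin t * ang (Dx f) t + cos t * (- sin t * ang (Dt (Dx f)) t + cos t * ang (Dx (Dx f)) t)); [exact H|].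
    apply (is_derive_det q1 t); [|apply D1].
    apply is_derive_ext with (fun t => - sin t * ang (Dt f) t + cos t * ang (Dx f) t).
    { intros; symmetry; apply E1. }
    pose proof (ang_derive _ St t). pose proof (ang_derive _ Sx t).
    auto_derive; [ex_derive_ctx|]. rew_derive. ring. }
  set (rho2 := fun t => p t ^ 2 + q1 t ^ 2).
  assert (Hr2 : forall t, 0 < rho2 t).
  { intros t. unfold rho2. pose proof (Hp t). pose proof (pow2_ge_0 (q1 t)). pose proof (pow_lt (p t) 2). lra. }
  set (rho := fun t => sqrt (rho2 t)).
  assert (Hr : forall t, 0 < rho t) by (intros; apply sqrt_lt_R0, Hr2).
  assert (Hrr : forall t, rho t ^ 2 = rho2 t) by (intros t; apply pow2_sqrt; left; apply Hr2).
  assert (Drho : forall t, is_derive rho t (q1 t * (p t + q2 t) / rho t)).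
  { intros t. pose proof (D0 t). pose proof (D1 t). pose proof (Hr2 t). pose proof (Hr t).
    evar_last.
    - apply (is_derive_sqrt rho2 t (2 * p t * q1 t + 2 * q1 t * q2 t)); [|assumption].
      unfold rho2. auto_derive; [ex_derive_ctx|rew_derive; ring].
    - change (sqrt (rho2 t)) with (rho t). field. lra. }
  set (al := fun t => t + atan (q1 t / p t)).
  set (A := fun t => p t * (p t + q2 t) / rho2 t).
  assert (HA : forall t, 0 < A t).
  { intros t. apply Rdiv_lt_0_compat; [|apply Hr2]. apply Rmult_lt_0_compat; [apply Hp|apply Hw]. }
  assert (Dal : forall t, is_derive al t (A t)).
  { intros t. unfold al, A. pose proof (D0 t). pose proof (D1 t). pose proof (Hp t). pose proof (Hr2 t).
    auto_derive. { ex_derive_ctx. lra. }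
    rew_derive. unfold rho2 in *. field. split; lra.
  }
  assert (CA : forall t, continuous A t).
  { intros t. apply (is_derive_continuous A t (((q1 t * (p t + q2 t) + p t * (q1 t + q3 t)) * rho2 t
       - p t * (p t + q2 t) * (2 * p t * q1 t + 2 * q1 t * q2 t)) / rho2 t ^ 2)).
    unfold A. pose proof (D0 t). pose proof (D1 t). pose proof (D2 t). pose proof (Hr2 t). unfold rho2 in *.
    auto_derive. { ex_derive_ctx. lra. }
    rew_derive. field. lra. }
  assert (HT : forall th, exists t, al t = th).
  { intros th. apply (atan_shift_onto (fun t => q1 t / p t)). intros t.
    apply (is_derive_continuous _ t ((q2 t * p t - q1 t * q1 t) / p t ^ 2)).
    pose proof (D0 t). pose proof (D1 t). pose proof (Hp t).
    auto_derive. { ex_derive_ctx. lra. } rew_derive. field. lra. }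
  set (T := fun th => proj1_sig (constructive_indefinite_description _ (HT th))).
  assert (HalT : forall th, al (T th) = th).
  { intros th. exact (proj2_sig (constructive_indefinite_description _ (HT th))). }
  pose proof (is_derive_inverse al A Dal HA CA T HalT) as DT.
  (* Differentiation with respect to [th] is differentiation in [t] followed by division by [A]. *)
  assert (comp : forall h h' : R -> R, forall th, is_derive h (T th) (h' (T th) * A (T th)) ->
     is_derive (fun th => h (T th)) th (h' (T th))).
  { intros h h' th D. evar_last; [apply (is_derive_comp h T); [exact D|apply DT]|].
    unfold scal; simpl; unfold mult; simpl. field. apply Rgt_not_eq, HA. }
  assert (Hcos : forall t, cos (al t) = ang (Dt f) t / rho t /\ sin (al t) = ang (Dx f) t / rho t).
  { intros t. pose proof (Hp t) as Hpt. pose proof (Hr t) as Hrt.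
    assert (Hsq : sqrt (1 + (q1 t / p t)²) = rho t / p t).
    { apply sqrt_lem_1.
      - pose proof (Rle_0_sqr (q1 t / p t)). lra.
      - left. now apply Rdiv_lt_0_compat.
      - replace (rho t / p t * (rho t / p t)) with (rho t ^ 2 / p t ^ 2) by (field; lra).
        rewrite Hrr. unfold rho2, Rsqr. field. lra. }
    unfold al. rewrite cos_plus, sin_plus, cos_atan, sin_atan, Hsq.
    rewrite E1. replace (p t) with (cos t * ang (Dt f) t + sin t * ang (Dx f) t) in * by (symmetry; apply E0).
    pose proof (sin2_cos2 t) as Hcs. unfold Rsqr in Hcs.
    split.
    - transitivity ((sin t * sin t + cos t * cos t) * ang (Dt f) t / rho t); [field|rewrite Hcs; field]; lra.
    - transitivity ((sin t * sin t + cos t * cos t) * ang (Dx f) t / rho t); [field|rewrite Hcs; field]; lra. }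
  unshelve eexists; [|exact I].
  (* [pF1] is the derivative of [/ rho] with respect to the angle [al]; differentiating once more
     and adding [/ rho] gives [pW], where [rho ^ 2 = p ^ 2 + q1 ^ 2] leaves a single positive
     quotient. *)
  refine {| pF := fun th => / rho (T th);
            pF1 := fun th => - q1 (T th) / (rho (T th) * p (T th));
            pW := fun th => rho (T th) ^ 3 / (p (T th) ^ 3 * (p (T th) + q2 (T th)));
            pW1 := fun th => ((3 * rho (T th) * (q1 (T th) * (p (T th) + q2 (T th))) * p (T th) * (p (T th) + q2 (T th))
                - rho (T th) ^ 3 * (3 * q1 (T th) * (p (T th) + q2 (T th)) + p (T th) * (q1 (T th) + q3 (T th))))
                / (p (T th) ^ 4 * (p (T th) + q2 (T th)) ^ 2)) / A (T th) |}.
  - intros r th H. rewrite <- (HalT th) at 1 2. destruct (Hcos (T th)) as [-> ->].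
    pose proof (Hr (T th)).
    replace (r * (ang (Dt f) (T th) / rho (T th))) with (r * / rho (T th) * Dt f (cos (T th)) (sin (T th)))
      by (unfold ang; field; lra).
    replace (r * (ang (Dx f) (T th) / rho (T th))) with (r * / rho (T th) * Dx f (cos (T th)) (sin (T th)))
      by (unfold ang; field; lra).
    apply (polar_at_gradient phi Hn Hs); [apply off_origin_cos_sin|].
    apply Rmult_le_pos; [lra|]. left. now apply Rinv_0_lt_compat.
  - intros th. apply (comp (fun t => / rho t) (fun t => - q1 t / (rho t * p t))).
    set (t := T th). pose proof (D0 t). pose proof (Drho t). pose proof (Hr t). pose proof (Hp t).
    unfold A. rewrite <- Hrr. clearbody rho.
    auto_derive. { ex_derive_ctx; lra. }
    rew_derive. field. lra.
  - intros th. evar_last.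
    + apply (comp (fun t => - q1 t / (rho t * p t)) (fun t => rho t ^ 3 / (p t ^ 3 * (p t + q2 t)) - / rho t)).
      set (t := T th). pose proof (D0 t). pose proof (D1 t). pose proof (Drho t). pose proof (Hr t). pose proof (Hp t).
      pose proof (Hw t). pose proof (Hrr t) as Hq. unfold rho2 in Hq.
      unfold A. rewrite <- Hrr. clearbody rho.
      replace ((rho t ^ 3 / (p t ^ 3 * (p t + q2 t)) - / rho t) * (p t * (p t + q2 t) / rho t ^ 2)) with
        (- (q2 t * (rho t ^ 2 * p t) - (q1 t ^ 2) * (p t * (p t + q2 t)) - rho t ^ 2 * q1 t ^ 2) / (rho t ^ 3 * p t ^ 2)).
      2:{ replace (q1 t ^ 2) with (rho t ^ 2 - p t ^ 2) by lra. field. lra. }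
      auto_derive. { ex_derive_ctx. apply Rmult_integral_contrapositive_currified; lra. }
      rew_derive. field. lra.
    + reflexivity.
  - intros th. apply (comp (fun t => rho t ^ 3 / (p t ^ 3 * (p t + q2 t)))
      (fun t => ((3 * rho t * (q1 t * (p t + q2 t)) * p t * (p t + q2 t)
                - rho t ^ 3 * (3 * q1 t * (p t + q2 t) + p t * (q1 t + q3 t)))
                / (p t ^ 4 * (p t + q2 t) ^ 2)) / A t)).
    set (t := T th). pose proof (D0 t). pose proof (D2 t). pose proof (Drho t). pose proof (Hr t). pose proof (Hp t).
    pose proof (Hw t). pose proof (HA t) as HAt. clearbody rho.
    replace (_ / A t * A t) with ((3 * rho t * (q1 t * (p t + q2 t)) * p t * (p t + q2 t)
                - rho t ^ 3 * (3 * q1 t * (p t + q2 t) + p t * (q1 t + q3 t)))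
                / (p t ^ 4 * (p t + q2 t) ^ 2)) by (field; lra).
    auto_derive.
    { ex_derive_ctx. apply Rmult_integral_contrapositive_currified; [|lra].
      replace (p t * (p t * (p t * 1))) with (p t ^ 3) by ring. apply pow_nonzero; lra. }
    rew_derive. field. lra.
  - intros th. apply (ex_derive_continuous (V := R_NormedModule)).
    pose proof (D0 (T th)). pose proof (D1 (T th)). pose proof (D2 (T th)). pose proof (D3 (T th)).
    pose proof (Drho (T th)). pose proof (DT th). pose proof (Hr (T th)). pose proof (Hp (T th)).
    pose proof (Hw (T th)). pose proof (Hr2 (T th)). unfold A. unfold rho2. unfold rho2 in H8.
    assert (0 < p (T th) * (p (T th) + q2 (T th))) by now apply Rmult_lt_0_compat.
    clearbody rho T.
    auto_derive. ex_derive_ctx.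
    all: try (repeat apply Rmult_integral_contrapositive_currified; lra).
    apply Rmult_integral_contrapositive_currified; [lra|]. apply Rinv_neq_0_compat. nra.
  - intros th. apply Rinv_0_lt_compat, Hr.
  - intros th. apply Rdiv_lt_0_compat; [apply pow_lt, Hr|].
    apply Rmult_lt_0_compat; [apply pow_lt, Hp|apply Hw].
  - intros th th'.
    set (t := T th). set (t' := T th').
    assert (Hth : al t = th) by apply HalT. assert (Hth' : al t' = th') by apply HalT.
    destruct (Hcos t) as [Ec Es]. rewrite Hth in Ec, Es.
    destruct (Hcos t') as [Ec' Es']. rewrite Hth' in Ec', Es'.
    rewrite cos_minus, sin_minus, Ec, Es, Ec', Es'. clear Ec Es Ec' Es'.
    (* The unit vector of [phi] in the direction [t] is the gradient of the polar norm at [th]. Its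
       pairing with the gradient of [phi] at [t'] is at most 1, and division by [rho t'] gives the
       claim. *)
    pose proof (dual_support phi Hn Hs (cos t') (sin t') (/ p t * cos t) (/ p t * sin t)
      (off_origin_cos_sin t')) as Hd.
    pose proof (Hp t) as Hpt. pose proof (Hr t) as Hrt. pose proof (Hr t') as Hrt'.
    destruct Hn as [_ [_ [Hh _]]].
    specialize (Hh (/ p t) (cos t, sin t)). rewrite Rabs_pos_eq in Hh by (left; now apply Rinv_0_lt_compat).
    change (phi (/ p t * cos t, / p t * sin t) = / p t * p t) in Hh.
    rewrite Hh, Rinv_l in Hd by lra.
    change (ang (Dt f) t' * (/ p t * cos t) + ang (Dx f) t' * (/ p t * sin t) <= 1) in Hd.
    apply Rmult_le_reg_r with (rho t'); [exact Hrt'|].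
    rewrite Rinv_l by lra. apply Rle_trans with (2 := Hd). right.
    pose proof (Hrr t) as Hq. unfold rho2 in Hq.
    pose proof (sin2_cos2 t) as Hcs. unfold Rsqr in Hcs.
    assert (Ht : ang (Dt f) t = p t * cos t - q1 t * sin t).
    { rewrite E0, E1. transitivity ((sin t * sin t + cos t * cos t) * ang (Dt f) t); [rewrite Hcs|]; ring. }
    assert (Hx : ang (Dx f) t = p t * sin t + q1 t * cos t).
    { rewrite E0, E1. transitivity ((sin t * sin t + cos t * cos t) * ang (Dx f) t); [rewrite Hcs|]; ring. }
    rewrite Ht, Hx. clearbody rho p.
    transitivity ((p t ^ 2 + q1 t ^ 2) * (ang (Dt f) t' * cos t + ang (Dx f) t' * sin t) / (rho t ^ 2 * p t)).
    { field. lra. }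
    rewrite <- Hq. field. lra.
Qed.

(** * The polar angle *)

Lemma unit_vector_angle c s : c * c + s * s = 1 ->
  exists th, - PI <= th <= PI /\ c = cos th /\ s = sin th.
Proof.
  intros H. assert (Hc : -1 <= c <= 1) by nra.
  pose proof (acos_bound c). pose proof (cos_acos c Hc) as H1.
  pose proof (sin_acos c Hc) as H2.
  assert (H3 : sqrt (1 - c²) = Rabs s).
  { replace (1 - c²) with (s²) by (unfold Rsqr; lra). apply sqrt_Rsqr_abs. }
  rewrite H3 in H2. pose proof PI_RGT_0.
  destruct (Rle_lt_dec 0 s).
  - exists (acos c). rewrite Rabs_pos_eq in H2 by assumption. repeat split; lra.
  - exists (- acos c). rewrite Rabs_left in H2 by assumption.
    rewrite cos_neg, sin_neg. repeat split; lra.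
Qed.

(* The polar angle of (a, b), in the branch around [th0]. *)
Definition angle_near (th0 a b : R) : R :=
  th0 + atan ((b * cos th0 - a * sin th0) / (a * cos th0 + b * sin th0)).

Section LocalAngle.
Variable th0 : R.
Definition half_plane (a b : R) : Prop := 0 < a * cos th0 + b * sin th0.

Lemma half_plane_angle a b : half_plane a b ->
  a = sqrt (a ^ 2 + b ^ 2) * cos (angle_near th0 a b) /\
  b = sqrt (a ^ 2 + b ^ 2) * sin (angle_near th0 a b) /\ 0 < sqrt (a ^ 2 + b ^ 2).
Proof.
  unfold half_plane, angle_near. intros H.
  set (c := cos th0) in *. set (s := sin th0) in *.
  set (u := a * c + b * s) in *. set (v := b * c - a * s).
  assert (Hcs : s * s + c * c = 1) by exact (sin2_cos2 th0).
  assert (Huv : u ^ 2 + v ^ 2 = a ^ 2 + b ^ 2).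
  { unfold u, v. transitivity ((s * s + c * c) * (a ^ 2 + b ^ 2)); [ring|rewrite Hcs; ring]. }
  assert (Hpos : 0 < a ^ 2 + b ^ 2) by (rewrite <- Huv; pose proof (pow2_ge_0 v); nra).
  assert (Hr : 0 < sqrt (a ^ 2 + b ^ 2)) by now apply sqrt_lt_R0.
  assert (Hsq : sqrt (1 + (v / u)²) = sqrt (a ^ 2 + b ^ 2) / u).
  { apply sqrt_lem_1.
    - pose proof (Rle_0_sqr (v / u)). lra.
    - left. now apply Rdiv_lt_0_compat.
    - transitivity (sqrt (a ^ 2 + b ^ 2) ^ 2 / u ^ 2); [field; lra|].
      rewrite pow2_sqrt by lra. rewrite <- Huv. unfold Rsqr. field. lra. }
  rewrite cos_plus, sin_plus, cos_atan, sin_atan, Hsq. fold c s.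
  set (r := sqrt (a ^ 2 + b ^ 2)) in *.
  split; [|split; [|exact Hr]].
  - transitivity ((s * s + c * c) * a); [rewrite Hcs; ring|].
    transitivity (c * u - s * v); [unfold u, v; ring|]. field. lra.
  - transitivity ((s * s + c * c) * b); [rewrite Hcs; ring|].
    transitivity (s * u + c * v); [unfold u, v; ring|]. field. lra.
Qed.

Lemma angle_near_center r : 0 < r -> angle_near th0 (r * cos th0) (r * sin th0) = th0.
Proof.
  intros H. unfold angle_near.
  replace (r * sin th0 * cos th0 - r * cos th0 * sin th0) with 0 by ring.
  unfold Rdiv. rewrite Rmult_0_l, atan_0. ring.
Qed.

Lemma half_plane_center r : 0 < r -> half_plane (r * cos th0) (r * sin th0).
Proof.
  intros H. unfold half_plane. pose proof (sin2_cos2 th0) as Hcs. unfold Rsqr in Hcs.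
  replace (_ + _) with (r * (sin th0 * sin th0 + cos th0 * cos th0)) by ring. rewrite Hcs. lra.
Qed.

Lemma angle_near_derive (a b : R -> R) s a' b' :
  is_derive a s a' -> is_derive b s b' -> half_plane (a s) (b s) ->
  is_derive (fun s => angle_near th0 (a s) (b s)) s
    ((a s * b' - b s * a') / (a s ^ 2 + b s ^ 2)).
Proof.
  unfold half_plane, angle_near. intros Ha Hb H.
  auto_derive. { ex_derive_ctx. lra. }
  rew_derive.
  set (c := cos th0) in *. set (k := sin th0) in *.
  assert (Hcs : k * k + c * c = 1) by exact (sin2_cos2 th0).
  assert (Huv : (a s * c + b s * k) ^ 2 + (b s * c - a s * k) ^ 2 = a s ^ 2 + b s ^ 2).
  { transitivity ((k * k + c * c) * (a s ^ 2 + b s ^ 2)); [ring|rewrite Hcs; ring]. }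
  rewrite <- Huv.
  assert (0 < (a s * c + b s * k) ^ 2 + (b s * c - a s * k) ^ 2).
  { pose proof (pow2_ge_0 (b s * c - a s * k)). nra. }
  replace (a s * b' - b s * a') with ((k * k + c * c) * (a s * b' - b s * a')) by (rewrite Hcs; ring).
  field. split; [lra|nra].
Qed.

Lemma half_plane_locally (a b : R -> R) s :
  continuous a s -> continuous b s -> half_plane (a s) (b s) ->
  locally s (fun r => half_plane (a r) (b r)).
Proof.
  intros Ha Hb H.
  assert (C : continuous (fun r => a r * cos th0 + b r * sin th0) s).
  { apply (continuous_plus (fun r => a r * cos th0) (fun r => b r * sin th0));
    [apply (continuous_mult a (fun _ => cos th0)) | apply (continuous_mult b (fun _ => sin th0))];
    auto; apply continuous_const. }
  apply C. exact (open_gt 0 _ H).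
Qed.
End LocalAngle.

(** The radial factor is left general so that one computation serves both the polar norm, of degree
    one, and its partial derivatives, of degree zero. *)
Lemma polar_form_partials (g : vec -> R) (R0 R1 G : R -> R) (G' r th : R) :
  (forall r th, 0 < r -> g (r * cos th, r * sin th) = R0 r * G th) ->
  0 < r -> is_derive R0 r (R1 r) -> is_derive G th G' ->
  is_derive (fun a => g (a, r * sin th)) (r * cos th) (cos th * (R1 r * G th) - sin th * (R0 r / r * G')) /\
  is_derive (fun b => g (r * cos th, b)) (r * sin th) (sin th * (R1 r * G th) + cos th * (R0 r / r * G')).
Proof.
  intros Hg Hr DR DG.
  pose proof (sin2_cos2 th) as Hcs. unfold Rsqr in Hcs.
  assert (Hrr : (r * cos th) ^ 2 + (r * sin th) ^ 2 = r ^ 2).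
  { transitivity ((sin th * sin th + cos th * cos th) * r ^ 2); [ring|rewrite Hcs; ring]. }
  assert (Hsq : sqrt ((r * cos th) ^ 2 + (r * sin th) ^ 2) = r).
  { rewrite Hrr. apply sqrt_pow2. lra. }
  pose proof (half_plane_center th r Hr) as Hc.
  pose proof (angle_near_center th r Hr) as Hth.
  assert (Hgen : forall (a b : R -> R) s a' b', is_derive a s a' -> is_derive b s b' ->
     a s = r * cos th -> b s = r * sin th ->
     is_derive (fun s => g (a s, b s)) s
       (R1 r * ((cos th * a' + sin th * b')) * G th + R0 r * (G' * ((cos th * b' - sin th * a') / r)))).
  { intros a b s a' b' Ha Hb Ea Eb.
    apply is_derive_ext_loc with (fun s => R0 (sqrt (a s ^ 2 + b s ^ 2)) * G (angle_near th (a s) (b s))).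
    { rewrite <- Ea, <- Eb in Hc.
      apply filter_imp with (2 := half_plane_locally th a b s
        (is_derive_continuous _ _ _ Ha) (is_derive_continuous _ _ _ Hb) Hc).
      intros t Ht. destruct (half_plane_angle th _ _ Ht) as [E1 [E2 E3]].
      rewrite <- Hg by exact E3. now rewrite <- E1, <- E2. }
    assert (D1 : is_derive (fun s => sqrt (a s ^ 2 + b s ^ 2)) s (cos th * a' + sin th * b')).
    { evar_last.
      - apply (is_derive_sqrt (fun s => a s ^ 2 + b s ^ 2) s (2 * a s * a' + 2 * b s * b')).
        + auto_derive; [ex_derive_ctx|rew_derive; ring].
        + rewrite Ea, Eb, Hrr. apply pow_lt, Hr.
      - rewrite Ea, Eb, Hsq. field. lra. }
    assert (D2 : is_derive (fun s => angle_near th (a s) (b s)) s ((cos th * b' - sin th * a') / r)).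
    { evar_last.
      - apply (angle_near_derive th a b s a' b' Ha Hb). now rewrite Ea, Eb.
      - rewrite Ea, Eb, Hrr. field. lra. }
    evar_last.
    - apply (is_derive_mult (fun s => R0 (sqrt (a s ^ 2 + b s ^ 2))) (fun s => G (angle_near th (a s) (b s))) s
        ((cos th * a' + sin th * b') * R1 r) ((cos th * b' - sin th * a') / r * G')).
      + apply (is_derive_comp R0 _ _ _ _) ; [rewrite Ea, Eb, Hsq; exact DR|exact D1].
      + apply (is_derive_comp G (fun s => angle_near th (a s) (b s)));
          [rewrite Ea, Eb, Hth; exact DG|exact D2].
      + intros; apply Rmult_comm.
    - rewrite Ea, Eb, Hsq, Hth. unfold plus, mult; simpl. ring. }
  split.
  - evar_last.
    + apply (Hgen (fun a => a) (fun _ => r * sin th) (r * cos th) 1 0); auto.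
      auto_derive; [exact I|ring]. auto_derive; [exact I|ring].
    + simpl. field. lra.
  - evar_last.
    + apply (Hgen (fun _ => r * cos th) (fun b => b) (r * sin th) 0 1); auto.
      auto_derive; [exact I|ring]. auto_derive; [exact I|ring].
    + simpl. field. lra.
Qed.

(** * Functions on the unit circle *)

(* [h1] is the derivative of [h] along the unit circle, by angle. *)
Definition circle_C1 (h h1 : vec -> R) : Prop :=
  exists H H1 : R -> R,
    (forall th, h (cos th, sin th) = H th) /\ (forall th, h1 (cos th, sin th) = H1 th) /\
    (forall th, is_derive H th (H1 th)) /\ (forall th, continuous H1 th).

Lemma unit_half_plane a b : a ^ 2 + b ^ 2 = 1 ->
  exists th, a = cos th /\ b = sin th /\ half_plane th a b.
Proof.
  intros H. destruct (unit_vector_angle a b) as [th [_ [Ha Hb]]]; [lra|].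
  exists th. split; [exact Ha|]. split; [exact Hb|].
  unfold half_plane. rewrite <- Ha, <- Hb. lra.
Qed.

Lemma unit_angle_near th a b : a ^ 2 + b ^ 2 = 1 -> half_plane th a b ->
  (a, b) = (cos (angle_near th a b), sin (angle_near th a b)).
Proof.
  intros H Hab. destruct (half_plane_angle th a b Hab) as [E1 [E2 _]].
  rewrite H, sqrt_1, Rmult_1_l in E1, E2. congruence.
Qed.

(** Near [s] the moving unit vector has an angle given by [angle_near], whose derivative on the unit
    circle is [a b' - b a']. The result no longer mentions the angle, so no lift along the whole
    curve has to be built. *)
Lemma circle_derive h h1 (a b : R -> R) s a' b' :
  circle_C1 h h1 -> is_derive a s a' -> is_derive b s b' ->
  locally s (fun r => a r ^ 2 + b r ^ 2 = 1) ->
  is_derive (fun r => h (a r, b r)) s (h1 (a s, b s) * (a s * b' - b s * a')).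
Proof.
  intros [H [H1 [Eh [Eh1 [DH _]]]]] Ha Hb Hu.
  pose proof (locally_singleton _ _ Hu) as Hs.
  destruct (unit_half_plane _ _ Hs) as [th [Eth1 [Eth2 Hth]]].
  apply is_derive_ext_loc with (fun r => H (angle_near th (a r) (b r))).
  - pose proof (half_plane_locally th a b s (is_derive_continuous _ _ _ Ha)
      (is_derive_continuous _ _ _ Hb) Hth) as Hp.
    generalize (filter_and _ _ Hu Hp). apply filter_imp. intros r [Hr1 Hr2].
    rewrite (unit_angle_near th _ _ Hr1 Hr2). symmetry. apply Eh.
  - evar_last.
    + apply (is_derive_comp H (fun r => angle_near th (a r) (b r))); [apply DH|].
      exact (angle_near_derive th a b s a' b' Ha Hb Hth).
    + assert (E : h1 (a s, b s) = H1 (angle_near th (a s) (b s))).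
      { rewrite (unit_angle_near th _ _ Hs Hth). apply Eh1. }
      rewrite E, Hs.
      unfold scal; simpl; unfold mult; simpl. field.
Qed.

Lemma continuity_2d_pt_div f g x y :
  continuity_2d_pt f x y -> continuity_2d_pt g x y -> g x y <> 0 ->
  continuity_2d_pt (fun u v => f u v / g u v) x y.
Proof.
  intros Hf Hg H. apply (continuity_2d_pt_mult f (fun u v => / g u v)); [exact Hf|].
  now apply continuity_2d_pt_inv.
Qed.

Lemma circle_continuity_2d (h : vec -> R) (H : R -> R) (a b : R -> R -> R) t x :
  (forall th, h (cos th, sin th) = H th) -> (forall th, continuous H th) ->
  continuity_2d_pt a t x -> continuity_2d_pt b t x ->
  locally_2d (fun t x => a t x ^ 2 + b t x ^ 2 = 1) t x ->
  continuity_2d_pt (fun t x => h (a t x, b t x)) t x.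
Proof.
  intros Eh CH Ha Hb Hu.
  pose proof (locally_2d_singleton _ _ _ Hu) as Hs.
  destruct (unit_half_plane _ _ Hs) as [th [Eth1 [Eth2 Hth]]].
  assert (Cu : continuity_2d_pt (fun t x => a t x * cos th + b t x * sin th) t x).
  { apply continuity_2d_pt_plus; apply continuity_2d_pt_mult; auto using continuity_2d_pt_const. }
  assert (Hp : locally_2d (fun t x => half_plane th (a t x) (b t x)) t x).
  { unfold half_plane in *. destruct (Cu (mkposreal _ Hth)) as [d Hd]. exists d.
    intros u v Hu' Hv'. specialize (Hd u v Hu' Hv'). simpl in Hd. apply Rabs_lt_between in Hd. lra. }
  apply continuity_2d_pt_ext_loc with (fun t x => H (angle_near th (a t x) (b t x))).
  - apply locally_2d_impl with (2 := Hu). apply locally_2d_impl with (2 := Hp).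
    apply locally_2d_forall. intros u v H1 H2.
    rewrite (unit_angle_near th _ _ H2 H1). symmetry. apply Eh.
  - apply (continuity_1d_2d_pt_comp H (fun t x => angle_near th (a t x) (b t x))).
    { apply continuity_pt_filterlim, CH. }
    unfold angle_near.
    apply continuity_2d_pt_plus; [apply continuity_2d_pt_const|].
    apply (continuity_1d_2d_pt_comp atan (fun u v =>
      (b u v * cos th - a u v * sin th) / (a u v * cos th + b u v * sin th))).
    { apply continuity_pt_filterlim. exact (is_derive_continuous atan _ _ (is_derive_atan _)). }
    apply continuity_2d_pt_div; [|exact Cu|unfold half_plane in Hth; lra].
    apply continuity_2d_pt_minus; apply continuity_2d_pt_mult; auto using continuity_2d_pt_const.
Qed.

Lemma circle_C1_continuity h h1 (a b : R -> R -> R) t x :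
  circle_C1 h h1 ->
  continuity_2d_pt a t x -> continuity_2d_pt b t x ->
  locally_2d (fun t x => a t x ^ 2 + b t x ^ 2 = 1) t x ->
  continuity_2d_pt (fun t x => h (a t x, b t x)) t x /\
  continuity_2d_pt (fun t x => h1 (a t x, b t x)) t x.
Proof.
  intros [H [H1 [Eh [Eh1 [DH CH]]]]] Ha Hb Hu. split.
  - apply (circle_continuity_2d h H); auto. intros; exact (is_derive_continuous _ _ _ (DH th)).
  - apply (circle_continuity_2d h1 H1); auto.
Qed.

(* In terms of the angle: f' and f + f'' = psi / f, where f is the polar norm. *)
Definition polar_dir (phi : vec -> R) (n : vec) : R :=
  d2 (polar phi) n * fst n - d1 (polar phi) n * snd n.
Definition polar_curv (phi : vec -> R) (n : vec) : R :=
  hess_quad (polar phi) n (unperp n).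

Section Profile.
Variables (phi : vec -> R) (h : polar_profile phi).
Let f := polar phi.
Let F := pF _ h. Let F1 := pF1 _ h. Let W := pW _ h.
Let DF th : is_derive F th (F1 th) := pF_derive _ h th.
Let DF1 th : is_derive F1 th (W th - F th) := pF1_derive _ h th.

Lemma polar_partials r th : 0 < r ->
  d1 f (r * cos th, r * sin th) = cos th * F th - sin th * F1 th /\
  d2 f (r * cos th, r * sin th) = sin th * F th + cos th * F1 th.
Proof.
  intros Hr.
  destruct (polar_form_partials f (fun r => r) (fun _ => 1) F (F1 th) r th) as [H1 H2]; auto.
  - intros; now apply (polar_eq _ h).
  - auto_derive; [exact I|ring].
  - split.
    + apply (eq_trans (is_derive_unique _ _ _ H1)). field. lra.
    + apply (eq_trans (is_derive_unique _ _ _ H2)). field. lra.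
Qed.

Lemma polar_unit th : f (cos th, sin th) = F th.
Proof.
  pose proof (polar_eq _ h 1 th Rlt_0_1) as H. rewrite !Rmult_1_l in H. exact H.
Qed.

Lemma polar_partials_unit th :
  d1 f (cos th, sin th) = cos th * F th - sin th * F1 th /\
  d2 f (cos th, sin th) = sin th * F th + cos th * F1 th.
Proof. pose proof (polar_partials 1 th Rlt_0_1) as H. now rewrite !Rmult_1_l in H. Qed.

Let DA th : is_derive (fun th => cos th * F th - sin th * F1 th) th (- sin th * W th).
Proof.
  pose proof (DF th). pose proof (DF1 th). auto_derive; [ex_derive_ctx|]. rew_derive. ring.
Qed.
Let DB th : is_derive (fun th => sin th * F th + cos th * F1 th) th (cos th * W th).
Proof.
  pose proof (DF th). pose proof (DF1 th). auto_derive; [ex_derive_ctx|]. rew_derive. ring.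
Qed.

(** The partial derivatives have degree zero and angular derivatives [- sin th * W] and
    [cos th * W]; so the Hessian on the unit circle is [W] times the projection onto the tangent. *)
Lemma polar_curv_unit th : polar_curv phi (cos th, sin th) = W th.
Proof.
  destruct (polar_form_partials (d1 f) (fun _ => 1) (fun _ => 0)
     (fun th => cos th * F th - sin th * F1 th) (- sin th * W th) 1 th) as [H11 H21].
  { intros r t Hr. rewrite (proj1 (polar_partials r t Hr)). ring. }
  { lra. } { auto_derive; [exact I|ring]. } { apply DA. }
  destruct (polar_form_partials (d2 f) (fun _ => 1) (fun _ => 0)
     (fun th => sin th * F th + cos th * F1 th) (cos th * W th) 1 th) as [H12 H22].
  { intros r t Hr. rewrite (proj2 (polar_partials r t Hr)). ring. }
  { lra. } { auto_derive; [exact I|ring]. } { apply DB. }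
  rewrite !Rmult_1_l in H11, H21, H12, H22.
  assert (E11 := is_derive_unique _ _ _ H11 : d1 (d1 f) (cos th, sin th) = _).
  assert (E21 := is_derive_unique _ _ _ H21 : d2 (d1 f) (cos th, sin th) = _).
  assert (E12 := is_derive_unique _ _ _ H12 : d1 (d2 f) (cos th, sin th) = _).
  assert (E22 := is_derive_unique _ _ _ H22 : d2 (d2 f) (cos th, sin th) = _).
  unfold polar_curv, hess_quad, unperp. cbn [fst snd].
  change (polar phi) with f. rewrite E11, E21, E12, E22.
  pose proof (sin2_cos2 th) as Hcs. unfold Rsqr in Hcs.
  transitivity ((sin th * sin th + cos th * cos th) ^ 2 * W th); [field|rewrite Hcs; ring].
Qed.

Lemma polar_dir_unit th : polar_dir phi (cos th, sin th) = F1 th.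
Proof.
  unfold polar_dir; cbn [fst snd]. fold f.
  destruct (polar_partials_unit th) as [-> ->].
  pose proof (sin2_cos2 th) as Hcs. unfold Rsqr in Hcs.
  transitivity ((sin th * sin th + cos th * cos th) * F1 th); [ring|rewrite Hcs; ring].
Qed.

Lemma circle_polar : circle_C1 f (polar_dir phi).
Proof.
  exists F, F1. split; [exact polar_unit|]. split; [exact polar_dir_unit|]. split; [exact DF|].
  intros th. exact (is_derive_continuous _ _ _ (DF1 th)).
Qed.

(** Together with the next lemma: along the circle the gradient of the polar norm moves in the
    direction [perp n] at rate [polar_curv]. This is how the junction condition gets
    differentiated. *)
Lemma circle_d1_polar : circle_C1 (d1 f) (fun n => - snd n * polar_curv phi n).
Proof.
  exists (fun th => cos th * F th - sin th * F1 th), (fun th => - sin th * W th).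
  split; [intros; apply polar_partials_unit|]. split.
  { intros th. rewrite polar_curv_unit. reflexivity. }
  split; [exact DA|]. intros th. pose proof (pW_derive _ h th : is_derive W th _).
  apply (ex_derive_continuous (V := R_NormedModule)). auto_derive. ex_derive_ctx.
Qed.

Lemma circle_d2_polar : circle_C1 (d2 f) (fun n => fst n * polar_curv phi n).
Proof.
  exists (fun th => sin th * F th + cos th * F1 th), (fun th => cos th * W th).
  split; [intros; apply polar_partials_unit|]. split.
  { intros th. rewrite polar_curv_unit. reflexivity. }
  split; [exact DB|]. intros th. pose proof (pW_derive _ h th : is_derive W th _).
  apply (ex_derive_continuous (V := R_NormedModule)). auto_derive. ex_derive_ctx.
Qed.

(** The derivative must be a function of the normal, whereas [pW1] is a function of an angle. Some
    angle is chosen; the value does not depend on it, because [W] itself comes from a function of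
    the normal. *)
Lemma circle_polar_curv : exists w1, circle_C1 (polar_curv phi) w1.
Proof.
  assert (Hang : forall n : vec, { th | fst n * fst n + snd n * snd n = 1 -> n = (cos th, sin th) }).
  { intros [a b]. apply constructive_indefinite_description.
    destruct (Req_dec (a * a + b * b) 1) as [H|H].
    - destruct (unit_vector_angle a b H) as [th [_ [-> ->]]]. now exists th.
    - exists 0. simpl. intros K; contradiction. }
  exists (fun n => pW1 _ h (proj1_sig (Hang n))), W, (pW1 _ h).
  split; [exact polar_curv_unit|]. split.
  2: { split; [exact (pW_derive _ h)|exact (pW1_cont _ h)]. }
  intros th. destruct (Hang (cos th, sin th)) as [th' H]. cbn [proj1_sig].
  assert (E : (cos th, sin th) = (cos th', sin th')).
  { apply H. simpl. rewrite Rplus_comm. exact (sin2_cos2 th). }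
  injection E as Ec Es.
  apply (is_derive_det (fun s => W (th + s)) 0).
  - apply is_derive_ext with (fun s => W (th' + s)).
    { intros s. rewrite <- 2!polar_curv_unit, 2!cos_plus, 2!sin_plus, Ec, Es. reflexivity. }
    pose proof (pW_derive _ h (th' + 0)) as D. rewrite Rplus_0_r in D at 2.
    change (is_derive W (th' + 0) (pW1 _ h th')) in D.
    auto_derive; [ex_derive_ctx|]. rew_derive. ring.
  - pose proof (pW_derive _ h (th + 0)) as D. rewrite Rplus_0_r in D at 2.
    change (is_derive W (th + 0) (pW1 _ h th)) in D.
    auto_derive; [ex_derive_ctx|]. rew_derive. ring.
Qed.
End Profile.

(** * Constants of the polar norm *)

Lemma vlen_sqr_1 n : unit_vec n -> fst n ^ 2 + snd n ^ 2 = 1.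
Proof.
  unfold unit_vec, vlen, dot. intros H.
  assert (0 <= fst n * fst n + snd n * snd n) by nra.
  rewrite <- (pow2_sqrt (fst n * fst n + snd n * snd n)) in H by assumption.
  assert (H1 : sqrt (fst n * fst n + snd n * snd n) ^ 2 = 1).
  { destruct (Req_dec 0 0); [|lra]. rewrite pow2_sqrt in H by assumption. rewrite H. ring. }
  rewrite pow2_sqrt in H1 by assumption. lra.
Qed.

Lemma unit_vec_angle n : unit_vec n -> exists th, - PI <= th <= PI /\ n = (cos th, sin th).
Proof.
  intros H. apply vlen_sqr_1 in H. destruct n as [a b]; simpl in H.
  destruct (unit_vector_angle a b) as [th [H1 [-> ->]]]; [lra|]. now exists th.
Qed.

(** Every unit vector has an angle in [[-PI, PI]], so the extrema over this compact interval bound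
    [G] on the whole line. *)
Lemma circle_bounds (g : vec -> R) (G : R -> R) :
  (forall th, g (cos th, sin th) = G th) -> (forall th, continuous G th) ->
  (forall th, 0 < G th) ->
  exists m M, 0 < m /\ (forall th, m <= G th <= M).
Proof.
  intros Eg CG Gpos. pose proof PI_RGT_0.
  destruct (continuity_ab_maj G (- PI) PI) as [tM [HM _]]; [lra| |].
  { intros; apply continuity_pt_filterlim, CG. }
  destruct (continuity_ab_min G (- PI) PI) as [tm [Hm _]]; [lra| |].
  { intros; apply continuity_pt_filterlim, CG. }
  exists (G tm), (G tM). split; [apply Gpos|]. intros th.
  destruct (unit_vector_angle (cos th) (sin th)) as [th' [Hb [Ec Es]]].
  { rewrite Rplus_comm. exact (sin2_cos2 th). }
  rewrite <- (Eg th), Ec, Es, Eg. auto.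
Qed.

Lemma Rabs_atan_le y : Rabs (atan y) <= Rabs y.
Proof.
  destruct (MVT_gen atan 0 y (fun x => / (1 + x²))) as [c [_ Hc]].
  - intros; apply is_derive_atan.
  - intros x _. apply continuity_pt_filterlim. exact (is_derive_continuous atan _ _ (is_derive_atan x)).
  - rewrite atan_0, 2!Rminus_0_r in Hc. rewrite Hc, Rabs_mult.
    pose proof (Rle_0_sqr c). rewrite Rabs_pos_eq by (left; apply Rinv_0_lt_compat; lra).
    pose proof (Rabs_pos y). rewrite <- (Rmult_1_l (Rabs y)) at 2.
    apply Rmult_le_compat_r; [assumption|]. rewrite <- Rinv_1. apply Rinv_le_contravar; lra.
Qed.

Lemma bounded_derivative_lipschitz (g g' : R -> R) M :
  (forall x, is_derive g x (g' x)) -> (forall x, Rabs (g' x) <= M) ->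
  forall x y, Rabs (g y - g x) <= M * Rabs (y - x).
Proof.
  intros D B x y. destruct (MVT_gen g x y g') as [c [_ Hc]].
  - intros; apply D.
  - intros z _. apply continuity_pt_filterlim. exact (is_derive_continuous g _ _ (D z)).
  - rewrite Hc, Rabs_mult. apply Rmult_le_compat_r; [apply Rabs_pos|apply B].
Qed.

Section Junction.
Variables (phi : vec -> R) (h : polar_profile phi).
Hypothesis phi_even : forall v, phi (vscal (-1) v) = phi v.
Let f := polar phi.
Let F := pF _ h. Let F1 := pF1 _ h. Let W := pW _ h.
(** [(A th, B th)] is the gradient of the polar norm at the normal of angle [th]. *)
Let A th := cos th * F th - sin th * F1 th.
Let B th := sin th * F th + cos th * F1 th.
Variables (fm G M : R).
Hypothesis fm_pos : 0 < fm.
Hypothesis F_ge : forall th, fm <= F th.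
Hypothesis F1_le : forall th, Rabs (F1 th) <= G.
Hypothesis W_le : forall th, W th <= M.

Let F_even th : F (th + PI) = F th.
Proof.
  unfold F. rewrite <- 2!polar_unit, neg_cos, neg_sin. unfold polar. f_equal.
  apply Lub_Rbar_eqset. intros s.
  assert (E : forall v w, dot (vscal (-1) v) w = dot v (vscal (-1) w)) by
    (intros [a b] [c d]; unfold dot, vscal; simpl; ring).
  assert (E2 : (- cos th, - sin th) = vscal (-1) (cos th, sin th)) by
    (unfold vscal; simpl; f_equal; ring).
  assert (E3 : vscal (-1) (vscal (-1) (cos th, sin th)) = (cos th, sin th)) by
    (unfold vscal; simpl; f_equal; ring).
  split; intros [xi [H ->]]; exists (vscal (-1) xi); rewrite phi_even; split; auto.
  - now rewrite E, E2.
  - now rewrite E, E2, E3.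
Qed.

Let F1_even th : F1 (th + PI) = F1 th.
Proof.
  apply (is_derive_det F th); [|apply pF_derive].
  apply is_derive_ext with (fun t => F (t + PI)). { intros; apply F_even. }
  pose proof (pF_derive _ h (th + PI) : is_derive F _ (F1 (th + PI))).
  auto_derive; [ex_derive_ctx|]. rew_derive. ring.
Qed.

Let W_pos th : 0 < W th := pW_pos _ h th.

Let M_pos : 0 < M.
Proof. pose proof (W_le 0). pose proof (W_pos 0). lra. Qed.

Let DA th : is_derive A th (- sin th * W th).
Proof.
  pose proof (pF_derive _ h th : is_derive F th (F1 th)).
  pose proof (pF1_derive _ h th : is_derive F1 th (W th - F th)).
  unfold A. auto_derive; [ex_derive_ctx|]. rew_derive. ring.
Qed.
Let DB th : is_derive B th (cos th * W th).
Proof.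
  pose proof (pF_derive _ h th : is_derive F th (F1 th)).
  pose proof (pF1_derive _ h th : is_derive F1 th (W th - F th)).
  unfold B. auto_derive; [ex_derive_ctx|]. rew_derive. ring.
Qed.

Let G_nonneg : 0 <= G.
Proof. pose proof (F1_le 0). pose proof (Rabs_pos (F1 0)). lra. Qed.

Let grad_dot a b : A a * cos b + B a * sin b = F a * cos (b - a) + F1 a * sin (b - a).
Proof. unfold A, B. rewrite cos_minus, sin_minus. ring. Qed.

(* If the normals at i and j make a sharp angle, the gradient at i is nonpositive
   on the normal at j; if they are almost opposite, the gradients at i and j nearly
   cancel, which the third one, of size at least [fm], forbids. *)
Lemma junction_sin_bound i j k :
  A i + A j + A k = 0 -> B i + B j + B k = 0 ->
  Rmin (1 / 2) (Rmin (fm / (2 * (G + 1))) (fm / (4 * M))) <= Rabs (sin (j - i)).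
Proof.
  intros HA HB.
  pose proof (Rmin_l (1 / 2) (Rmin (fm / (2 * (G + 1))) (fm / (4 * M)))) as m1.
  pose proof (Rmin_r (1 / 2) (Rmin (fm / (2 * (G + 1))) (fm / (4 * M)))) as m2.
  pose proof (Rmin_l (fm / (2 * (G + 1))) (fm / (4 * M))) as m3.
  pose proof (Rmin_r (fm / (2 * (G + 1))) (fm / (4 * M))) as m4.
  set (s := sin (j - i)). set (c := cos (j - i)).
  assert (Hcs : s * s + c * c = 1) by exact (sin2_cos2 (j - i)).
  assert (Hsmall : Rabs c < 1 / 2 -> 1 / 2 <= Rabs s).
  { intros Hc. apply Rnot_lt_le. intros Hs.
    rewrite <- (Rabs_pos_eq (s * s + c * c)) in Hcs by nra.
    apply Rabs_lt_between in Hc. apply Rabs_lt_between in Hs.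
    rewrite Rabs_pos_eq in Hcs by nra. nra. }
  destruct (Rlt_dec (Rabs c) (1 / 2)) as [Hc|Hc]; [specialize (Hsmall Hc); lra|].
  destruct (Rle_lt_dec 0 c) as [Hc0|Hc0].
  - rewrite Rabs_pos_eq in Hc by assumption.
    (* Pair the vanishing sum of gradients with the normal at [j]. The gradient at [j] contributes
       [F j], and the one at [k] at least [- F j], by the support inequality at the opposite normal
       and the evenness of [F]. *)
    assert (H1 : A i * cos j + B i * sin j <= 0).
    { assert (E : (A i + A j + A k) * cos j + (B i + B j + B k) * sin j = 0) by (rewrite HA, HB; ring).
      pose proof (grad_dot j j) as Ej. rewrite Rminus_eq_0, cos_0, sin_0 in Ej.
      pose proof (grad_dot k (j + PI)) as Ek. pose proof (pF_support _ h k (j + PI)) as Sk.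
      fold F F1 in Sk. rewrite <- Ek, F_even, neg_cos, neg_sin in Sk. lra. }
    rewrite grad_dot in H1. fold s c in H1.
    pose proof (F_ge i). pose proof (F1_le i) as HF1.
    assert (H2 : Rabs (F1 i * s) <= G * Rabs s).
    { rewrite Rabs_mult. apply Rmult_le_compat_r; [apply Rabs_pos|assumption]. }
    apply Rabs_le_between in H2. pose proof (Rabs_pos s).
    apply Rle_trans with (fm / (2 * (G + 1))); [lra|].
    apply Rmult_le_reg_r with (2 * (G + 1)); [lra|].
    unfold Rdiv. rewrite Rmult_assoc, Rinv_l by lra. nra.
  - rewrite Rabs_left in Hc by assumption.
    (* Up to full turns, [j] is [i + PI + d], and [Rabs c >= 1 / 2] gives [Rabs d <= 2 * Rabs s]. *)
    set (d := atan (s / c)).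
    assert (Hd : Rabs d <= 2 * Rabs s).
    { apply Rle_trans with (1 := Rabs_atan_le _). unfold Rdiv. rewrite Rabs_mult, Rabs_inv, (Rabs_left c) by assumption.
      pose proof (Rabs_pos s). apply Rmult_le_reg_r with (- c); [lra|].
      rewrite Rmult_assoc, Rinv_l by lra. nra. }
    assert (Hsq : sqrt (1 + (s / c)²) = / (- c)).
    { apply sqrt_lem_1.
      - pose proof (Rle_0_sqr (s / c)). lra.
      - left. apply Rinv_0_lt_compat. lra.
      - transitivity ((s * s + c * c) / (c * c)); [rewrite Hcs|unfold Rsqr]; field; lra. }
    assert (Ej : cos j = cos (i + PI + d) /\ sin j = sin (i + PI + d)).
    { assert (Ecj : cos j = cos i * c - sin i * s).
      { unfold c, s. rewrite <- cos_plus. f_equal. ring. }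
      assert (Esj : sin j = sin i * c + cos i * s).
      { unfold c, s. rewrite <- sin_plus. f_equal. ring. }
      rewrite Ecj, Esj, (cos_plus (i + PI)), (sin_plus (i + PI)), neg_cos, neg_sin.
      unfold d. rewrite cos_atan, sin_atan, Hsq. split; field; lra. }
    destruct Ej as [Ec Es].
    assert (EAj : A j = A (i + PI + d) /\ B j = B (i + PI + d)).
    { unfold A, B, F, F1. rewrite <- 2!polar_unit, <- 2!polar_dir_unit, Ec, Es. tauto. }
    assert (EAi : A (i + PI) = - A i /\ B (i + PI) = - B i).
    { unfold A, B. rewrite F_even, F1_even, neg_cos, neg_sin. split; ring. }
    assert (LA : Rabs (A (i + PI + d) - A (i + PI)) <= M * Rabs d).
    { replace d with (i + PI + d - (i + PI)) at 2 by ring.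
      apply (bounded_derivative_lipschitz A (fun th => - sin th * W th) M DA).
      intros x. rewrite Rabs_mult, Rabs_Ropp, (Rabs_pos_eq (W x)) by (left; apply W_pos).
      pose proof (W_le x). pose proof (W_pos x). pose proof (SIN_bound x).
      assert (Rabs (sin x) <= 1) by (apply Rabs_le; lra). pose proof (Rabs_pos (sin x)). nra. }
    assert (LB : Rabs (B (i + PI + d) - B (i + PI)) <= M * Rabs d).
    { replace d with (i + PI + d - (i + PI)) at 2 by ring.
      apply (bounded_derivative_lipschitz B (fun th => cos th * W th) M DB).
      intros x. rewrite Rabs_mult, (Rabs_pos_eq (W x)) by (left; apply W_pos).
      pose proof (W_le x). pose proof (W_pos x). pose proof (COS_bound x).
      assert (Rabs (cos x) <= 1) by (apply Rabs_le; lra). pose proof (Rabs_pos (cos x)). nra. }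
    destruct EAj as [E1 E2], EAi as [E3 E4]. rewrite <- E1, E3 in LA. rewrite <- E2, E4 in LB.
    pose proof (grad_dot k k) as Ek. rewrite Rminus_eq_0, cos_0, sin_0 in Ek.
    pose proof (F_ge k).
    (* The gradient at [k] is opposite to the sum of the other two, each component of which is at
       most [M * Rabs d]. Hence [fm <= 4 * M * Rabs s], the last entry of the minimum. *)
    assert (Hk : fm <= Rabs (A j - - A i) + Rabs (B j - - B i)).
    { replace (A k) with (- (A j - - A i)) in Ek by lra. replace (B k) with (- (B j - - B i)) in Ek by lra.
      set (X := A j - - A i) in *. set (Y := B j - - B i) in *.
      apply Rle_trans with (Rabs (- X * cos k + - Y * sin k)).
      { rewrite Rabs_pos_eq; lra. }
      apply Rle_trans with (1 := Rabs_triang _ _). rewrite 2!Rabs_mult, 2!Rabs_Ropp.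
      pose proof (SIN_bound k). pose proof (COS_bound k).
      assert (Rabs (sin k) <= 1) by (apply Rabs_le; lra).
      assert (Rabs (cos k) <= 1) by (apply Rabs_le; lra).
      pose proof (Rabs_pos X). pose proof (Rabs_pos Y). nra. }
    apply Rle_trans with (fm / (4 * M)); [lra|].
    apply Rmult_le_reg_r with (4 * M); [lra|].
    unfold Rdiv. rewrite Rmult_assoc, Rinv_l by lra. nra.
Qed.
End Junction.

Lemma admissible_constants_exist phi :
  anisotropy phi -> smooth_anisotropy phi -> elliptic phi ->
  exists K, admissible_constants phi K.
Proof.
  intros Hn Hs He. destruct (polar_profile_exists phi Hn Hs He) as [h _].
  set (F := pF _ h). set (F1 := pF1 _ h). set (W := pW _ h).
  pose proof (pF_derive _ h : forall th, is_derive F th (F1 th)) as DF.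
  pose proof (pF1_derive _ h : forall th, is_derive F1 th (W th - F th)) as DF1.
  pose proof (pW_derive _ h : forall th, is_derive W th _) as DW.
  pose proof (pF_pos _ h : forall th, 0 < F th) as Fpos.
  pose proof (pW_pos _ h : forall th, 0 < W th) as Wpos.
  assert (CF : forall th, continuous F th) by (intros; exact (is_derive_continuous _ _ _ (DF th))).
  assert (CF1 : forall th, continuous F1 th) by (intros; exact (is_derive_continuous _ _ _ (DF1 th))).
  assert (CW : forall th, continuous W th) by (intros; exact (is_derive_continuous _ _ _ (DW th))).
  destruct (circle_bounds (polar phi) F (polar_unit phi h) CF Fpos) as [fm [fM [Hfm HF]]].
  destruct (circle_bounds (polar_curv phi) W (polar_curv_unit phi h) CW Wpos) as [wm [wM [Hwm HW]]].
  destruct (circle_bounds (fun n => polar phi n * polar_curv phi n) (fun th => F th * W th)) as [pm [pM [Hpm HP]]].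
  { intros th. now rewrite (polar_unit phi h), (polar_curv_unit phi h). }
  { intros th. contR; auto. }
  { intros th. now apply Rmult_lt_0_compat. }
  (* For [y] the squared length of the gradient, [1 + y] is positive and bounds both [sqrt y] and
     [Rabs F1]. *)
  destruct (circle_bounds (fun n => 1 + (polar phi n * polar phi n + polar_dir phi n * polar_dir phi n))
    (fun th => 1 + (F th * F th + F1 th * F1 th))) as [gm [gM [Hgm HG]]].
  { intros th. now rewrite (polar_unit phi h), (polar_dir_unit phi h). }
  { intros th. contR; auto. }
  { intros th. nra. }
  set (a0 := Rmin (1 / 2) (Rmin (fm / (2 * (gM + 1))) (fm / (4 * wM)))).
  assert (HgM : 0 < gM) by (pose proof (HG 0); lra).
  assert (HwM : 0 < wM) by (pose proof (HW 0); lra).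
  assert (Ha0 : 0 < a0).
  { unfold a0. repeat apply Rmin_pos; [lra| |]; apply Rdiv_lt_0_compat; lra. }
  exists (Build_polar_constants pm pM a0 fm fM gM).
  unfold admissible_constants; cbn [psi_min psi_max junction_angle polar_min polar_max polar_grad_max].
  split; [exact Hpm|]. split.
  { intros n Hu. destruct (unit_vec_angle n Hu) as [th [_ ->]]. unfold psi.
    fold (polar_curv phi (cos th, sin th)).
    rewrite (polar_unit phi h), (polar_curv_unit phi h). apply HP. }
  split; [exact Ha0|]. split.
  2:{ split; [exact Hfm|]. split.
      - intros n Hu. destruct (unit_vec_angle n Hu) as [th [_ ->]]. rewrite (polar_unit phi h). apply HF.
      - intros n Hu. destruct (unit_vec_angle n Hu) as [th [_ ->]].
        unfold vlen, grad, dot; cbn [fst snd].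
        destruct (polar_partials_unit phi h th) as [-> ->]. fold F F1.
        specialize (HG th). pose proof (sin2_cos2 th) as Hcs. unfold Rsqr in Hcs.
        replace (_ + _) with ((sin th * sin th + cos th * cos th) * (F th * F th + F1 th * F1 th)) by ring.
        rewrite Hcs, Rmult_1_l. apply Rle_trans with (2 := proj2 HG).
        set (y := F th * F th + F1 th * F1 th). assert (0 <= y) by (unfold y; nra).
        apply Rle_trans with (sqrt ((1 + y) ^ 2)); [apply sqrt_le_1_alt; nra|].
        rewrite sqrt_pow2; lra. }
  intros n Hu Hsum i j Hij.
  assert (Hang : forall b, exists th, n b = (cos th, sin th)).
  { intros b. destruct (unit_vec_angle _ (Hu b)) as [th [_ ->]]. now exists th. }
  assert (Hk : exists k, vadd (vadd (grad (polar phi) (n i)) (grad (polar phi) (n j))) (grad (polar phi) (n k)) = vzero).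
  { unfold vsum3, vadd, vzero in *. injection Hsum as H1 H2.
    destruct i, j; try (now elim Hij); [exists B3|exists B2|exists B3|exists B1|exists B2|exists B1];
    f_equal; cbn [fst snd grad] in *; lra. }
  destruct Hk as [k Hk].
  destruct (Hang i) as [ti Ei], (Hang j) as [tj Ej], (Hang k) as [tk Ek].
  rewrite Ei, Ej, Ek in Hk. rewrite Ei, Ej.
  unfold vadd, grad, vzero in Hk; cbn [fst snd] in Hk.
  destruct (polar_partials_unit phi h ti) as [E1 E2]. destruct (polar_partials_unit phi h tj) as [E3 E4].
  destruct (polar_partials_unit phi h tk) as [E5 E6]. rewrite E1, E2, E3, E4, E5, E6 in Hk.
  injection Hk as HA HB.
  replace (dot (cos ti, sin ti) (unperp (cos tj, sin tj))) with (sin (tj - ti))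
    by (unfold dot, unperp; cbn [fst snd]; rewrite sin_minus; ring).
  apply (junction_sin_bound phi h) with tk; auto.
  - intros v. destruct Hn as [_ [_ [Hh _]]]. rewrite Hh, Rabs_left; lra.
  - intros th. apply HF.
  - intros th. pose proof (HG th). unfold F1. fold F1. apply Rabs_le. split; nra.
  - intros th. apply HW.
Qed.

(** * Kinematics of a moving curve *)

Ltac cont2d_step :=
  match goal with
  | |- continuity_2d_pt (fun _ _ => ?c) _ _ => apply continuity_2d_pt_const
  | |- continuity_2d_pt (fun a b => @?g a b + @?h a b) _ _ => apply (continuity_2d_pt_plus g h)
  | |- continuity_2d_pt (fun a b => @?g a b - @?h a b) _ _ => apply (continuity_2d_pt_minus g h)
  | |- continuity_2d_pt (fun a b => - @?g a b) _ _ => apply (continuity_2d_pt_opp g)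
  | |- continuity_2d_pt (fun a b => @?g a b * @?h a b) _ _ => apply (continuity_2d_pt_mult g h)
  | |- continuity_2d_pt (fun a b => @?g a b / @?h a b) _ _ => apply (continuity_2d_pt_div g h)
  | |- continuity_2d_pt (fun a b => / @?g a b) _ _ => apply (continuity_2d_pt_inv g)
  | |- continuity_2d_pt (fun a b => (@?g a b) ^ 2) _ _ =>
      apply (continuity_2d_pt_ext (fun a b => g a b * g a b)); [intros; simpl; ring|]
  end.
Ltac cont2d := repeat first [eassumption | cont2d_step].

Section Curve.
Variables (a b : R -> R -> R) (O : vec -> Prop).
Hypothesis O_open : open O.
Hypothesis Sa : smooth2 O a.
Hypothesis Sb : smooth2 O b.
Hypothesis regular : forall t x, O (t, x) -> 0 < Dx a t x ^ 2 + Dx b t x ^ 2.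

Let X := Dx a. Let Y := Dx b.
Definition vel t x := sqrt (Dx a t x ^ 2 + Dx b t x ^ 2).
Definition nrm1 t x := - (/ vel t x * Dx b t x).
Definition nrm2 t x := / vel t x * Dx a t x.
(* With the angle th of the normal: [rotx] is th_x, [rott] is th_t, [rotxt] is
   the mixed derivative th_xt. *)
Definition rotx t x := (Dx a t x * Dx (Dx b) t x - Dx b t x * Dx (Dx a) t x) / vel t x ^ 2.
Definition rott t x := (Dx a t x * Dt (Dx b) t x - Dx b t x * Dt (Dx a) t x) / vel t x ^ 2.
(** The components of the velocity along the normal and, for [tspeed], along the tangent
    [(nrm2, - nrm1)]. *)
Definition vspeed t x := Dt a t x * nrm1 t x + Dt b t x * nrm2 t x.
Definition tspeed t x := Dt a t x * nrm2 t x - Dt b t x * nrm1 t x.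
Definition vel_t t x := (Dx a t x * Dt (Dx a) t x + Dx b t x * Dt (Dx b) t x) / vel t x.
Definition vel_x t x := (Dx a t x * Dx (Dx a) t x + Dx b t x * Dx (Dx b) t x) / vel t x.
Definition rotxt t x :=
  (Dx (Dx a) t x * Dt (Dx b) t x + Dx a t x * Dx (Dt (Dx b)) t x
   - Dx (Dx b) t x * Dt (Dx a) t x - Dx b t x * Dx (Dt (Dx a)) t x) / vel t x ^ 2
  - 2 * rott t x * vel_x t x / vel t x.
Definition rotxx t x :=
  (Dx a t x * Dx (Dx (Dx b)) t x - Dx b t x * Dx (Dx (Dx a)) t x) / vel t x ^ 2
  - 2 * rotx t x * vel_x t x / vel t x.

Let SX : smooth2 O (Dx a) := smooth2_Dx _ _ Sa.
Let SY : smooth2 O (Dx b) := smooth2_Dx _ _ Sb.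

Section Point.
Variables t x : R.
Hypothesis Hp : O (t, x).

Lemma vel_pos : 0 < vel t x.
Proof. apply sqrt_lt_R0, regular, Hp. Qed.
Lemma vel_sqr : vel t x ^ 2 = Dx a t x ^ 2 + Dx b t x ^ 2.
Proof. apply pow2_sqrt. left. apply regular, Hp. Qed.

Lemma normal_unit : nrm1 t x ^ 2 + nrm2 t x ^ 2 = 1.
Proof.
  pose proof vel_pos. unfold nrm1, nrm2.
  transitivity ((Dx a t x ^ 2 + Dx b t x ^ 2) / vel t x ^ 2); [field; lra|].
  rewrite <- vel_sqr. field. lra.
Qed.

Lemma vel_derive_t : is_derive (fun s => vel s x) t (vel_t t x).
Proof.
  pose proof (smooth2_is_derive_t _ _ _ _ SX Hp). pose proof (smooth2_is_derive_t _ _ _ _ SY Hp).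
  evar_last.
  - apply (is_derive_sqrt (fun s => Dx a s x ^ 2 + Dx b s x ^ 2) t
      (2 * Dx a t x * Dt (Dx a) t x + 2 * Dx b t x * Dt (Dx b) t x)); [|now apply regular].
    auto_derive; [ex_derive_ctx|rew_derive; ring].
  - pose proof vel_pos. unfold vel_t. fold (vel t x). field. lra.
Qed.

Lemma vel_derive_x : is_derive (fun y => vel t y) x (vel_x t x).
Proof.
  pose proof (smooth2_is_derive_x _ _ _ _ SX Hp). pose proof (smooth2_is_derive_x _ _ _ _ SY Hp).
  evar_last.
  - apply (is_derive_sqrt (fun y => Dx a t y ^ 2 + Dx b t y ^ 2) x
      (2 * Dx a t x * Dx (Dx a) t x + 2 * Dx b t x * Dx (Dx b) t x)); [|now apply regular].
    auto_derive; [ex_derive_ctx|rew_derive; ring].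
  - pose proof vel_pos. unfold vel_x. fold (vel t x). field. lra.
Qed.

Lemma normal_derive_t :
  is_derive (fun s => nrm1 s x) t (- nrm2 t x * rott t x) /\
  is_derive (fun s => nrm2 s x) t (nrm1 t x * rott t x).
Proof.
  pose proof (smooth2_is_derive_t _ _ _ _ SX Hp). pose proof (smooth2_is_derive_t _ _ _ _ SY Hp).
  pose proof vel_derive_t. pose proof vel_pos. pose proof vel_sqr as Hv.
  unfold nrm1, nrm2, rott. split.
  - auto_derive; [ex_derive_ctx; lra|]. rew_derive. unfold vel_t.
    transitivity (- (Dt (Dx b) t x * vel t x ^ 2 - Dx b t x * (Dx a t x * Dt (Dx a) t x + Dx b t x * Dt (Dx b) t x)) / vel t x ^ 3);
    [field; lra|]. rewrite Hv at 1. field. lra.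
  - auto_derive; [ex_derive_ctx; lra|]. rew_derive. unfold vel_t.
    transitivity ((Dt (Dx a) t x * vel t x ^ 2 - Dx a t x * (Dx a t x * Dt (Dx a) t x + Dx b t x * Dt (Dx b) t x)) / vel t x ^ 3);
    [field; lra|]. rewrite Hv at 1. field. lra.
Qed.

Lemma normal_derive_x :
  is_derive (fun y => nrm1 t y) x (- nrm2 t x * rotx t x) /\
  is_derive (fun y => nrm2 t y) x (nrm1 t x * rotx t x).
Proof.
  pose proof (smooth2_is_derive_x _ _ _ _ SX Hp). pose proof (smooth2_is_derive_x _ _ _ _ SY Hp).
  pose proof vel_derive_x. pose proof vel_pos. pose proof vel_sqr as Hv.
  unfold nrm1, nrm2, rotx. split.
  - auto_derive; [ex_derive_ctx; lra|]. rew_derive. unfold vel_x.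
    transitivity (- (Dx (Dx b) t x * vel t x ^ 2 - Dx b t x * (Dx a t x * Dx (Dx a) t x + Dx b t x * Dx (Dx b) t x)) / vel t x ^ 3);
    [field; lra|]. rewrite Hv at 1. field. lra.
  - auto_derive; [ex_derive_ctx; lra|]. rew_derive. unfold vel_x.
    transitivity ((Dx (Dx a) t x * vel t x ^ 2 - Dx a t x * (Dx a t x * Dx (Dx a) t x + Dx b t x * Dx (Dx b) t x)) / vel t x ^ 3);
    [field; lra|]. rewrite Hv at 1. field. lra.
Qed.

Lemma rotx_derive_x : is_derive (fun y => rotx t y) x (rotxx t x).
Proof.
  pose proof (smooth2_is_derive_x _ _ _ _ SX Hp). pose proof (smooth2_is_derive_x _ _ _ _ SY Hp).
  pose proof (smooth2_is_derive_x _ _ _ _ (smooth2_Dx _ _ SX) Hp).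
  pose proof (smooth2_is_derive_x _ _ _ _ (smooth2_Dx _ _ SY) Hp).
  pose proof vel_derive_x. pose proof vel_pos.
  unfold rotxx, rotx. auto_derive; [ex_derive_ctx; nra|]. rew_derive. field. lra.
Qed.

Lemma rott_derive_x : is_derive (fun y => rott t y) x (rotxt t x).
Proof.
  pose proof (smooth2_is_derive_x _ _ _ _ SX Hp). pose proof (smooth2_is_derive_x _ _ _ _ SY Hp).
  pose proof (smooth2_is_derive_x _ _ _ _ (smooth2_Dt _ _ SX) Hp).
  pose proof (smooth2_is_derive_x _ _ _ _ (smooth2_Dt _ _ SY) Hp).
  pose proof vel_derive_x. pose proof vel_pos.
  unfold rotxt, rott. auto_derive; [ex_derive_ctx; nra|]. rew_derive. field. lra.
Qed.

(** With [rott_derive_x], this is the equality of the mixed derivatives of the normal angle, without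
    an angle function: Schwarz's theorem for the components of [u_x], after which the two
    expressions differ by a multiple of [|u_x|^2 - vel^2]. *)
Lemma rotx_derive_t : is_derive (fun s => rotx s x) t (rotxt t x).
Proof.
  pose proof (smooth2_is_derive_t _ _ _ _ SX Hp). pose proof (smooth2_is_derive_t _ _ _ _ SY Hp).
  pose proof (smooth2_is_derive_t _ _ _ _ (smooth2_Dx _ _ SX) Hp).
  pose proof (smooth2_is_derive_t _ _ _ _ (smooth2_Dx _ _ SY) Hp).
  pose proof vel_derive_t. pose proof vel_pos. pose proof vel_sqr as Hv.
  unfold rotx. auto_derive; [ex_derive_ctx; nra|]. rew_derive.
  rewrite (smooth2_Schwarz O (Dx a)), (smooth2_Schwarz O (Dx b)) by assumption.
  unfold rotxt, rott, vel_t, vel_x.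
  set (X' := Dx a t x) in *. set (Y' := Dx b t x) in *.
  set (v := vel t x) in *. set (xt := Dt (Dx a) t x). set (yt := Dt (Dx b) t x).
  set (xx := Dx (Dx a) t x). set (yy := Dx (Dx b) t x).
  set (xxt := Dx (Dt (Dx a)) t x). set (yyt := Dx (Dt (Dx b)) t x).
  apply Rminus_diag_uniq.
  transitivity ((2 * (X'^2 + Y'^2 - v ^ 2)) * (xx * yt - yy * xt) / v ^ 4); [field; lra|].
  rewrite Hv. unfold Rdiv. ring.
Qed.

(** Exchange the derivatives in [u_tx]: the normal part of the time derivative of [u_x] is
    [vel * rott], and the turning of the normal along the curve contributes [- tspeed * rotx]. *)
Lemma vspeed_derive_x :
  is_derive (fun y => vspeed t y) x (vel t x * rott t x - tspeed t x * rotx t x).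
Proof.
  pose proof (smooth2_is_derive_x _ _ _ _ (smooth2_Dt _ _ Sa) Hp) as Da.
  pose proof (smooth2_is_derive_x _ _ _ _ (smooth2_Dt _ _ Sb) Hp) as Db.
  rewrite <- (smooth2_Schwarz O a), <- (smooth2_Schwarz O b) in * by assumption.
  destruct normal_derive_x. pose proof vel_pos. pose proof vel_sqr as Hv.
  unfold vspeed. auto_derive; [ex_derive_ctx|]. rew_derive.
  unfold tspeed, rott. unfold nrm1, nrm2. field. lra.
Qed.

(** Solved for [vel_t], this is the evolution law of the length element. *)
Lemma tspeed_derive_x :
  is_derive (fun y => tspeed t y) x (vel_t t x + rotx t x * vspeed t x).
Proof.
  pose proof (smooth2_is_derive_x _ _ _ _ (smooth2_Dt _ _ Sa) Hp) as Da.
  pose proof (smooth2_is_derive_x _ _ _ _ (smooth2_Dt _ _ Sb) Hp) as Db.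
  rewrite <- (smooth2_Schwarz O a), <- (smooth2_Schwarz O b) in * by assumption.
  destruct normal_derive_x. pose proof vel_pos. pose proof vel_sqr as Hv.
  unfold tspeed. auto_derive; [ex_derive_ctx|]. rew_derive.
  unfold vspeed, vel_t. unfold nrm1, nrm2. field. lra.
Qed.

Let Ca g : smooth2 O g -> continuity_2d_pt g t x.
Proof. intros Sg. exact (smooth2_continuity _ _ _ _ Sg Hp). Qed.

Lemma vel_continuity : continuity_2d_pt vel t x.
Proof.
  apply (continuity_1d_2d_pt_comp sqrt (fun t x => Dx a t x ^ 2 + Dx b t x ^ 2)).
  - apply continuity_pt_sqrt. left. apply regular, Hp.
  - pose proof (Ca _ SX). pose proof (Ca _ SY). cont2d.
Qed.

Lemma curve_continuities :
  continuity_2d_pt nrm1 t x /\ continuity_2d_pt nrm2 t x /\ continuity_2d_pt rotx t x /\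
  continuity_2d_pt rott t x /\ continuity_2d_pt vspeed t x /\ continuity_2d_pt tspeed t x /\
  continuity_2d_pt vel_t t x /\ continuity_2d_pt rotxt t x.
Proof.
  pose proof vel_continuity as Cv. pose proof vel_pos as Hv.
  assert (Hv' : vel t x <> 0) by lra. assert (Hv2 : vel t x ^ 2 <> 0) by (apply pow_nonzero; lra).
  pose proof (Ca _ SX). pose proof (Ca _ SY).
  pose proof (Ca _ (smooth2_Dx _ _ SX)). pose proof (Ca _ (smooth2_Dx _ _ SY)).
  pose proof (Ca _ (smooth2_Dt _ _ SX)). pose proof (Ca _ (smooth2_Dt _ _ SY)).
  pose proof (Ca _ (smooth2_Dx _ _ (smooth2_Dt _ _ SX))). pose proof (Ca _ (smooth2_Dx _ _ (smooth2_Dt _ _ SY))).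
  pose proof (Ca _ (smooth2_Dt _ _ Sa)). pose proof (Ca _ (smooth2_Dt _ _ Sb)).
  assert (C1 : continuity_2d_pt nrm1 t x) by (unfold nrm1; cont2d).
  assert (C2 : continuity_2d_pt nrm2 t x) by (unfold nrm2; cont2d).
  assert (C3 : continuity_2d_pt rott t x) by (unfold rott; cont2d).
  assert (C4 : continuity_2d_pt vel_x t x) by (unfold vel_x; cont2d).
  repeat split; auto.
  - unfold rotx; cont2d.
  - unfold vspeed; cont2d.
  - unfold tspeed; cont2d.
  - unfold vel_t; cont2d.
  - unfold rotxt; cont2d.
Qed.


End Point.
End Curve.

(** * The energy density along the flow *)

Section Density.
Variables (phi w1 : vec -> R) (a b : R -> R -> R) (O : vec -> Prop).
Hypothesis circle_f : circle_C1 (polar phi) (polar_dir phi).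
Hypothesis circle_w : circle_C1 (polar_curv phi) w1.
Hypothesis f_pos : forall n1 n2, n1 ^ 2 + n2 ^ 2 = 1 -> 0 < polar phi (n1, n2).
Hypothesis w_pos : forall n1 n2, n1 ^ 2 + n2 ^ 2 = 1 -> 0 < polar_curv phi (n1, n2).
Hypothesis O_open : open O.
Hypothesis Sa : smooth2 O a.
Hypothesis Sb : smooth2 O b.
Hypothesis regular : forall t x, O (t, x) -> 0 < Dx a t x ^ 2 + Dx b t x ^ 2.

Definition nrm t x : vec := (nrm1 a b t x, nrm2 a b t x).
Definition fN t x := polar phi (nrm t x).
Definition f1N t x := polar_dir phi (nrm t x).
Definition wN t x := polar_curv phi (nrm t x).
Definition w1N t x := w1 (nrm t x).

Let v := vel a b. Let K := rotx a b. Let Th := rott a b.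
Let V := vspeed a b. Let la := tspeed a b.

(* The arclength derivative V_s of the normal speed. *)
Definition vspeed_s t x := rott a b t x - tspeed a b t x * rotx a b t x / vel a b t x.

(* With k = kappa_phi and V = f k: [dens] is k^2 f ds, [flux] is
   2 w V V_s + lambda k^2 f, and [dens_t = flux_x + rate]. *)
Definition dens t x := wN t x ^ 2 * K t x ^ 2 * fN t x / v t x.
Definition dens_t t x :=
  2 * wN t x * K t x * (w1N t x * Th t x * K t x + wN t x * rotxt a b t x) * fN t x / v t x
  + wN t x ^ 2 * K t x ^ 2 * f1N t x * Th t x / v t x
  - wN t x ^ 2 * K t x ^ 2 * fN t x * vel_t a b t x / v t x ^ 2.
Definition flux t x :=
  2 * V t x * wN t x * vspeed_s t x + la t x * wN t x ^ 2 * K t x ^ 2 * fN t x / v t x ^ 2.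
Definition rate t x :=
  (- 2 * wN t x * vspeed_s t x ^ 2 + V t x ^ 2 * V t x ^ 2 / (fN t x ^ 2 * wN t x)
   + V t x ^ 2 * f1N t x * vspeed_s t x / fN t x ^ 2) * v t x.

Lemma regular_locally t x : O (t, x) ->
  locally t (fun s => O (s, x)) /\ locally x (fun y => O (t, y)).
Proof.
  intros Hp. destruct (open_locally_2d O t x O_open Hp) as [d Hd]. split; exists d.
  - intros s Hs. apply Hd; [exact Hs|]. rewrite Rminus_eq_0, Rabs_R0. apply cond_pos.
  - intros y Hy. apply Hd; [|exact Hy]. rewrite Rminus_eq_0, Rabs_R0. apply cond_pos.
Qed.

Lemma circle_along_t h h1 t x : circle_C1 h h1 -> O (t, x) ->
  is_derive (fun s => h (nrm s x)) t (h1 (nrm t x) * Th t x).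
Proof.
  intros Hh Hp. destruct (normal_derive_t a b O Sa Sb regular t x Hp) as [D1 D2].
  evar_last.
  - apply (circle_derive h h1 _ _ _ _ _ Hh D1 D2).
    apply filter_imp with (2 := proj1 (regular_locally t x Hp)).
    intros s Hs. exact (normal_unit a b O regular s x Hs).
  - pose proof (normal_unit a b O regular t x Hp) as Hn. unfold nrm, Th.
    transitivity (h1 (nrm1 a b t x, nrm2 a b t x) * ((nrm1 a b t x ^ 2 + nrm2 a b t x ^ 2) * rott a b t x)).
    + ring.
    + rewrite Hn. ring.
Qed.

Lemma circle_along_x h h1 t x : circle_C1 h h1 -> O (t, x) ->
  is_derive (fun y => h (nrm t y)) x (h1 (nrm t x) * K t x).
Proof.
  intros Hh Hp. destruct (normal_derive_x a b O Sa Sb regular t x Hp) as [D1 D2].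
  evar_last.
  - apply (circle_derive h h1 _ _ _ _ _ Hh D1 D2).
    apply filter_imp with (2 := proj2 (regular_locally t x Hp)).
    intros s Hs. exact (normal_unit a b O regular t s Hs).
  - pose proof (normal_unit a b O regular t x Hp) as Hn. unfold nrm, K.
    transitivity (h1 (nrm1 a b t x, nrm2 a b t x) * ((nrm1 a b t x ^ 2 + nrm2 a b t x ^ 2) * rotx a b t x)).
    + ring.
    + rewrite Hn. ring.
Qed.

Section Point.
Variables t x : R.
Hypothesis Hp : O (t, x).

Let Hn : nrm1 a b t x ^ 2 + nrm2 a b t x ^ 2 = 1 := normal_unit a b O regular t x Hp.
Let fpos : 0 < fN t x := f_pos _ _ Hn.
Let wpos : 0 < wN t x := w_pos _ _ Hn.
Let vpos : 0 < v t x := vel_pos a b O regular t x Hp.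

Lemma dens_derive : is_derive (fun s => dens s x) t (dens_t t x).
Proof.
  pose proof (circle_along_t _ _ t x circle_f Hp : is_derive (fun s => fN s x) t (f1N t x * Th t x)).
  pose proof (circle_along_t _ _ t x circle_w Hp : is_derive (fun s => wN s x) t (w1N t x * Th t x)).
  pose proof (rotx_derive_t a b O O_open Sa Sb regular t x Hp : is_derive (fun s => K s x) t _).
  pose proof (vel_derive_t a b O Sa Sb regular t x Hp : is_derive (fun s => v s x) t _).
  unfold dens. auto_derive; [ex_derive_ctx; lra|]. rew_derive. unfold dens_t. field. lra.
Qed.

(** The flow law enters only through the value of [V] at the point. The derivative of [V] along the
    curve is the kinematic one, so the law is never differentiated and the dissipation appears as a
    square of [vspeed_s]. *)
Lemma flux_derive : V t x = fN t x * wN t x * K t x / v t x ->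
  is_derive (fun y => flux t y) x (dens_t t x - rate t x).
Proof.
  intros HV.
  pose proof (circle_along_x _ _ t x circle_f Hp : is_derive (fun y => fN t y) x (f1N t x * K t x)).
  pose proof (circle_along_x _ _ t x circle_w Hp : is_derive (fun y => wN t y) x (w1N t x * K t x)).
  pose proof (rotx_derive_x a b O Sa Sb regular t x Hp : is_derive (fun y => K t y) x _).
  pose proof (rott_derive_x a b O Sa Sb regular t x Hp : is_derive (fun y => Th t y) x _).
  pose proof (vel_derive_x a b O Sa Sb regular t x Hp : is_derive (fun y => v t y) x _).
  pose proof (vspeed_derive_x a b O O_open Sa Sb regular t x Hp : is_derive (fun y => V t y) x _) as DV.
  pose proof (tspeed_derive_x a b O O_open Sa Sb regular t x Hp : is_derive (fun y => la t y) x _) as Dla.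
  fold v K Th V la in DV, Dla.
  unfold flux, vspeed_s. fold v K Th V la. auto_derive. { ex_derive_ctx. all: nra. } rew_derive.
  unfold dens_t, rate, vspeed_s. fold v K Th V la.
  rewrite HV. field. lra.
Qed.

Lemma density_continuities :
  continuity_2d_pt dens t x /\ continuity_2d_pt dens_t t x /\ continuity_2d_pt rate t x /\
  continuity_2d_pt vspeed_s t x /\ continuity_2d_pt V t x /\ continuity_2d_pt v t x.
Proof.
  destruct (curve_continuities a b O Sa Sb regular t x Hp) as [C1 [C2 [C3 [C4 [C5 [C6 [C7 C8]]]]]]].
  pose proof (vel_continuity a b O Sa Sb regular t x Hp) as Cv.
  assert (Hu : locally_2d (fun t x => nrm1 a b t x ^ 2 + nrm2 a b t x ^ 2 = 1) t x).
  { apply locally_2d_impl with (2 := open_locally_2d O t x O_open Hp).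
    apply locally_2d_forall. intros s y Hs. exact (normal_unit a b O regular s y Hs). }
  destruct (circle_C1_continuity _ _ _ _ t x circle_f C1 C2 Hu) as [Cf Cf1].
  destruct (circle_C1_continuity _ _ _ _ t x circle_w C1 C2 Hu) as [Cw Cw1].
  change (continuity_2d_pt fN t x) in Cf. change (continuity_2d_pt f1N t x) in Cf1.
  change (continuity_2d_pt wN t x) in Cw. change (continuity_2d_pt w1N t x) in Cw1.
  fold v in Cv. fold K in C3. fold Th in C4. fold V in C5. fold la in C6.
  assert (Hv : v t x <> 0) by lra. assert (Hv2 : v t x ^ 2 <> 0) by (apply pow_nonzero; lra).
  assert (Hf2 : fN t x ^ 2 <> 0) by (apply pow_nonzero; lra).
  assert (Hfw : fN t x ^ 2 * wN t x <> 0) by (apply Rmult_integral_contrapositive_currified; lra).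
  assert (Cs : continuity_2d_pt vspeed_s t x) by (unfold vspeed_s; fold v K Th la; cont2d).
  repeat split; auto.
  - unfold dens; cont2d.
  - unfold dens_t; cont2d.
  - unfold rate; cont2d.
Qed.
End Point.

Lemma energy_derive t : (forall x, 0 <= x <= 1 -> O (t, x)) ->
  is_derive (fun s => RInt (dens s) 0 1) t (RInt (dens_t t) 0 1).
Proof.
  intros H. apply (is_derive_RInt_open O); auto.
  - lra.
  - intros; now apply dens_derive.
  - intros; now apply density_continuities.
  - intros; now apply density_continuities.
Qed.

Lemma energy_rate t : (forall x, 0 <= x <= 1 -> O (t, x)) ->
  (forall x, 0 <= x <= 1 -> V t x = fN t x * wN t x * K t x / v t x) ->
  RInt (dens_t t) 0 1 = RInt (rate t) 0 1 + (flux t 1 - flux t 0).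
Proof.
  intros H HV.
  assert (C : forall x, 0 <= x <= 1 -> continuous (dens_t t) x /\ continuous (rate t) x).
  { intros x Hx. destruct (density_continuities t x (H x Hx)) as [_ [C1 [C2 _]]].
    split; now apply continuity_2d_pt_1d_x. }
  assert (E1 : ex_RInt (dens_t t) 0 1) by (apply ex_RInt_cont; [lra|intros; now apply C]).
  assert (E2 : ex_RInt (rate t) 0 1) by (apply ex_RInt_cont; [lra|intros; now apply C]).
  assert (E : is_RInt (fun x => dens_t t x - rate t x) 0 1 (flux t 1 - flux t 0)).
  { apply (is_RInt_derive (flux t)).
    - intros x Hx. rewrite Rmin_left, Rmax_right in Hx by lra. apply flux_derive; auto.
    - intros x Hx. rewrite Rmin_left, Rmax_right in Hx by lra. contR; now apply C. }
  apply (is_RInt_unique (V := R_CompleteNormedModule)) in E.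
  rewrite RInt_Rminus in E by assumption. lra.
Qed.
End Density.

(** * Interpolation and the differential inequality *)

(** It plays the part of the Cauchy-Schwarz inequality for integrals. The optimal weight is of order
    [y / A]; for [A = 0] the weight [(B + 1) / y] gives a contradiction unless [y = 0]. *)
Lemma discriminant_bound y A B : 0 <= y -> 0 <= A -> 0 <= B ->
  (forall mu, 0 < mu -> y <= mu * A + B / mu) -> y ^ 2 <= 4 * A * B.
Proof.
  intros Hy HA HB H.
  destruct Hy as [Hy|<-]; [|nra].
  destruct HA as [HA|<-].
  - assert (Hmu : 0 < y / (2 * A)) by (apply Rdiv_lt_0_compat; lra).
    specialize (H _ Hmu).
    replace (y / (2 * A) * A + B / (y / (2 * A))) with (y / 2 + 2 * A * B / y) in H by (field; lra).
    apply Rmult_le_compat_l with (r := y) in H; [|lra].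
    replace (y * (y / 2 + 2 * A * B / y)) with (y * y / 2 + 2 * A * B) in H by (field; lra). nra.
  - exfalso. assert (Hmu : 0 < (B + 1) / y) by (apply Rdiv_lt_0_compat; lra).
    specialize (H _ Hmu). rewrite Rmult_0_r, Rplus_0_l in H.
    replace (B / ((B + 1) / y)) with (y * (B / (B + 1))) in H by (field; lra).
    assert (B / (B + 1) < 1).
    { apply Rmult_lt_reg_r with (B + 1); [lra|]. unfold Rdiv. rewrite Rmult_assoc, Rinv_l; lra. }
    nra.
Qed.

Section Sobolev.
Variables V S v : R -> R.
Hypothesis CV : forall x, 0 <= x <= 1 -> continuous V x.
Hypothesis CS : forall x, 0 <= x <= 1 -> continuous S x.
Hypothesis Cv : forall x, 0 <= x <= 1 -> continuous v x.
Hypothesis v_pos : forall x, 0 <= x <= 1 -> 0 < v x.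
Hypothesis V_derive : forall x, 0 <= x <= 1 -> is_derive V x (v x * S x).
Hypothesis V_end : V 1 = 0.

Let A := RInt (fun x => V x ^ 2 * v x) 0 1.
Let B := RInt (fun x => S x ^ 2 * v x) 0 1.

Let CA x : 0 <= x <= 1 -> continuous (fun x => V x ^ 2 * v x) x.
Proof. intros Hx. simpl. contR; auto. Qed.
Let CB x : 0 <= x <= 1 -> continuous (fun x => S x ^ 2 * v x) x.
Proof. intros Hx. simpl. contR; auto. Qed.

Lemma weighted_square_integrable :
  ex_RInt (fun x => V x ^ 2 * v x) 0 1 /\ ex_RInt (fun x => S x ^ 2 * v x) 0 1.
Proof. split; apply ex_RInt_cont; auto; lra. Qed.

Lemma weighted_square_nonneg : 0 <= A /\ 0 <= B.
Proof.
  destruct weighted_square_integrable.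
  split; apply RInt_ge_0; auto; try lra; intros x Hx;
  (apply Rmult_le_pos; [apply pow2_ge_0|left; apply v_pos; lra]).
Qed.

(** Since [V] vanishes at 1, [V x ^ 2] is the integral of [- 2 V V_s ds] from [x] to 1, and
    [- 2 V V_s] is at most [mu V^2 + V_s^2 / mu] for every [mu > 0]. *)
Lemma sup_fourth_power x : 0 <= x <= 1 -> (V x ^ 2) ^ 2 <= 4 * A * B.
Proof.
  intros Hx. destruct weighted_square_nonneg as [HA HB].
  apply discriminant_bound; auto. { apply pow2_ge_0. }
  intros mu Hmu.
  set (g := fun y => mu * (V y ^ 2 * v y) + / mu * (S y ^ 2 * v y)).
  assert (Cg : forall y, 0 <= y <= 1 -> continuous g y).
  { intros y Hy. unfold g. contR; simpl; contR; auto. }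
  assert (Eg : forall c d, 0 <= c -> c <= d -> d <= 1 -> ex_RInt g c d).
  { intros c d H1 H2 H3. apply ex_RInt_cont; [lra|]. intros; apply Cg; lra. }
  assert (Ig : RInt g 0 1 = mu * A + B / mu).
  { destruct weighted_square_integrable as [E1 E2]. unfold g.
    rewrite RInt_Rplus by (apply (ex_RInt_scal (V := R_NormedModule)); assumption).
    rewrite 2!RInt_Rmult by assumption. unfold A, B, Rdiv. ringR. }
  rewrite <- Ig.
  assert (Hpos : 0 <= RInt g 0 x).
  { apply RInt_ge_0; [lra|apply Eg; lra|]. intros y Hy. unfold g.
    pose proof (v_pos y ltac:(lra)). pose proof (Rinv_0_lt_compat _ Hmu).
    apply Rplus_le_le_0_compat; apply Rmult_le_pos; try lra;
      (apply Rmult_le_pos; [apply pow2_ge_0|lra]). }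
  assert (Ch : RInt g 0 x + RInt g x 1 = RInt g 0 1).
  { apply (RInt_Chasles (V := R_CompleteNormedModule)); apply Eg; lra. }
  assert (Hd : is_RInt (fun y => - (2 * V y * (v y * S y))) x 1 (V x ^ 2)).
  { replace (V x ^ 2) with (- V 1 ^ 2 - - V x ^ 2) by (rewrite V_end; ring).
    apply (is_RInt_derive (fun y => - V y ^ 2)).
    - intros y Hy. rewrite Rmin_left, Rmax_right in Hy by lra.
      pose proof (V_derive y ltac:(lra)). auto_derive; [ex_derive_ctx|]. rew_derive. ring.
    - intros y Hy. rewrite Rmin_left, Rmax_right in Hy by lra.
      contR; first [apply CV|apply Cv|apply CS]; lra. }
  rewrite <- (is_RInt_unique (V := R_CompleteNormedModule) _ _ _ _ Hd).
  apply Rle_trans with (RInt g x 1); [|lra].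
  apply RInt_le; [lra|eexists; exact Hd|apply Eg; lra|].
  intros y Hy. unfold g. pose proof (v_pos y ltac:(lra)).
  assert (E : mu * (V y ^ 2 * v y) + / mu * (S y ^ 2 * v y) - - (2 * V y * (v y * S y))
    = v y * / mu * (mu * V y + S y) ^ 2) by (field; lra).
  assert (0 <= v y * / mu * (mu * V y + S y) ^ 2).
  { apply Rmult_le_pos; [|apply pow2_ge_0]. apply Rmult_le_pos; [lra|]. left. now apply Rinv_0_lt_compat. }
  lra.
Qed.
End Sobolev.

(** The hypothesis gives [B >= M^4 / (4 A)]. One half of [w0 M^4 / (4 A)] absorbs the cubic term, at
    the price of [(2 c3^2 / w0) M^2 A]; the other half absorbs the resulting multiple of [M^2 A].
    The constant comes from these two completed squares. *)
Lemma interpolation_absorb M A B c3 c4 w0 :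
  0 <= M -> 0 <= A -> 0 <= B -> 0 < w0 -> (M ^ 2) ^ 2 <= 4 * A * B ->
  c3 * M ^ 3 + c4 * M ^ 2 * A - w0 * B <= 2 * (c4 + 2 * c3 ^ 2 / w0) ^ 2 / w0 * A ^ 3.
Proof.
  intros HM HA HB Hw H.
  destruct HA as [HA|<-].
  2:{ assert (M = 0) by (destruct (Req_dec M 0); [assumption|exfalso];
        pose proof (pow_lt M 2 ltac:(lra)); nra).
      subst M. nra. }
  set (d := c4 + 2 * c3 ^ 2 / w0).
  assert (HB' : w0 * (M ^ 2) ^ 2 / (4 * A) <= w0 * B).
  { unfold Rdiv. rewrite Rmult_assoc. apply Rmult_le_compat_l; [lra|].
    apply Rmult_le_reg_r with (4 * A); [lra|]. rewrite Rmult_assoc, Rinv_l; lra. }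
  assert (Hi : 0 < w0 / (8 * A)) by (apply Rdiv_lt_0_compat; lra).
  assert (E1 : 0 <= M ^ 2 * (w0 / (8 * A) * (M - 4 * c3 * A / w0) ^ 2)).
  { apply Rmult_le_pos; [apply pow2_ge_0|]. apply Rmult_le_pos; [lra|apply pow2_ge_0]. }
  assert (E2 : 0 <= w0 / (8 * A) * (M ^ 2 - 4 * d * A ^ 2 / w0) ^ 2).
  { apply Rmult_le_pos; [lra|apply pow2_ge_0]. }
  assert (E : 2 * d ^ 2 / w0 * A ^ 3 - (c3 * M ^ 3 + c4 * M ^ 2 * A - w0 * (M ^ 2) ^ 2 / (4 * A))
    = M ^ 2 * (w0 / (8 * A) * (M - 4 * c3 * A / w0) ^ 2) + w0 / (8 * A) * (M ^ 2 - 4 * d * A ^ 2 / w0) ^ 2).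
  { unfold d. field. lra. }
  lra.
Qed.

(** Of the dissipation [2 w S^2], one copy of [w0 S^2] pays for the cross term by Young's inequality
    and another is kept. The quartic term uses [f^2 w >= pm fm]. *)
Lemma rate_bound w f f1 S V v w0 fm pm G :
  0 < w0 <= w -> 0 < fm <= f -> 0 < pm <= f * w -> Rabs f1 <= G -> 0 < v ->
  (- 2 * w * S ^ 2 + V ^ 2 * V ^ 2 / (f ^ 2 * w) + V ^ 2 * f1 * S / f ^ 2) * v
  <= - w0 * (S ^ 2 * v) + (/ (pm * fm) + (G / fm ^ 2) ^ 2 / (4 * w0)) * (V ^ 2 * (V ^ 2 * v)).
Proof.
  intros [Hw0 Hw] [Hfm Hf] [Hpm Hp] HG Hv.
  set (y := V ^ 2). assert (Hy : 0 <= y) by apply pow2_ge_0.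
  assert (H1 : y * y / (f ^ 2 * w) <= / (pm * fm) * (y * y)).
  { unfold Rdiv. rewrite Rmult_comm. apply Rmult_le_compat_r; [nra|].
    apply Rinv_le_contravar; [nra|]. simpl. nra. }
  assert (Hg : Rabs (f1 / f ^ 2) <= G / fm ^ 2).
  { unfold Rdiv. rewrite Rabs_mult, Rabs_inv, (Rabs_pos_eq (f ^ 2)) by apply pow2_ge_0.
    apply Rmult_le_compat; [apply Rabs_pos| |exact HG|].
    - left. apply Rinv_0_lt_compat, pow_lt. lra.
    - apply Rinv_le_contravar; [apply pow_lt; lra|]. apply pow_incr. lra. }
  set (g := f1 / f ^ 2) in *. set (g0 := G / fm ^ 2) in *.
  replace (y * f1 * S / f ^ 2) with (y * g * S) by (unfold g; field; lra).
  assert (H2 : y * g * S <= w0 * S ^ 2 + g0 ^ 2 / (4 * w0) * (y * y)).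
  { assert (Hgg : g ^ 2 <= g0 ^ 2).
    { rewrite <- pow2_abs. apply pow_incr. split; [apply Rabs_pos|exact Hg]. }
    assert (E : w0 * S ^ 2 + g ^ 2 / (4 * w0) * (y * y) - y * g * S = w0 * (S - y * g / (2 * w0)) ^ 2) by (field; lra).
    assert (0 <= w0 * (S - y * g / (2 * w0)) ^ 2) by (apply Rmult_le_pos; [lra|apply pow2_ge_0]).
    assert (g ^ 2 / (4 * w0) * (y * y) <= g0 ^ 2 / (4 * w0) * (y * y)).
    { apply Rmult_le_compat_r; [nra|]. unfold Rdiv. apply Rmult_le_compat_r; [|exact Hgg].
      left. apply Rinv_0_lt_compat. lra. }
    lra. }
  assert (H3 : 0 <= (w - w0) * S ^ 2) by (apply Rmult_le_pos; [lra|apply pow2_ge_0]).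
  replace (- w0 * (S ^ 2 * v) + (/ (pm * fm) + g0 ^ 2 / (4 * w0)) * (y * (y * v)))
    with ((- w0 * S ^ 2 + / (pm * fm) * (y * y) + g0 ^ 2 / (4 * w0) * (y * y)) * v) by ring.
  apply Rmult_le_compat_r; lra.
Qed.

Lemma continuous_ge_right (g : R -> R) x d c :
  0 < d -> continuous g x -> (forall y, x < y < x + d -> c <= g y) -> c <= g x.
Proof.
  intros Hd Hg H. apply Rnot_lt_le. intros Hlt.
  assert (Hn : locally x (fun y => g y < c)) by exact (Hg _ (open_lt c (g x) Hlt)).
  destruct Hn as [e He]. pose proof (cond_pos e).
  set (y := x + Rmin d e / 2).
  assert (0 < Rmin d e) by (apply Rmin_pos; lra).
  pose proof (Rmin_l d e). pose proof (Rmin_r d e).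
  specialize (H y ltac:(unfold y; lra)).
  assert (Hy : g y < c).
  { apply He. change (Rabs (y - x) < e). unfold y. apply Rabs_def1; lra. }
  lra.
Qed.

Lemma blow_up_rate (E : R -> R) (l : R -> R) T C (tj : nat -> R) :
  0 <= C ->
  (forall t, 0 <= t < T -> 0 <= E t) ->
  (forall t, 0 <= t < T -> continuous E t) ->
  (forall t, 0 < t < T -> is_derive E t (l t)) ->
  (forall t, 0 < t < T -> l t <= C * E t ^ 3) ->
  is_lim_seq tj T -> (forall j, tj j < T) -> is_lim_seq (fun j => E (tj j)) p_infty ->
  forall t, 0 <= t < T -> 1 <= 2 * C * (T - t) * E t ^ 2.
Proof.
  intros HC Epos EC ED Hl Hlim Htj HE.
  (* [/ (E + eps) ^ 2 + 2 C t] is nondecreasing and tends to at most [2 C T]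
     along [tj]; the shift by [eps] avoids assuming [E <> 0]. *)
  assert (Heps : forall t eps, 0 < t < T -> 0 < eps -> 1 <= 2 * C * (T - t) * (E t + eps) ^ 2).
  { intros t eps Ht He.
    assert (Hpos : forall s, 0 <= s < T -> 0 < E s + eps) by (intros s Hs; pose proof (Epos s Hs); lra).
    set (g := fun s => / (E s + eps) ^ 2 + 2 * C * s).
    assert (Hmono : forall s, t < s < T -> g t <= g s).
    { intros s Hs.
      assert (D : forall r, t <= r <= s -> is_derive g r (- 2 * l r / (E r + eps) ^ 3 + 2 * C)).
      { intros r Hr. pose proof (ED r ltac:(lra)). pose proof (Hpos r ltac:(lra)).
        unfold g. auto_derive. { ex_derive_ctx. apply Rmult_integral_contrapositive_currified; lra. }
        rew_derive. field. lra. }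
      destruct (MVT_gen g t s (fun r => - 2 * l r / (E r + eps) ^ 3 + 2 * C)) as [c [Hc Hgc]];
        rewrite ?Rmin_left, ?Rmax_right in * by lra.
      - intros r Hr. apply D. lra.
      - intros r Hr. apply continuity_pt_filterlim. exact (is_derive_continuous g _ _ (D r Hr)).
      - pose proof (Hl c ltac:(lra)) as Hlc. pose proof (Epos c ltac:(lra)). pose proof (Hpos c ltac:(lra)) as Hc'.
        assert (Hcube : 0 < (E c + eps) ^ 3) by now apply pow_lt.
        assert (Hle : l c / (E c + eps) ^ 3 <= C).
        { apply Rmult_le_reg_r with ((E c + eps) ^ 3); [exact Hcube|].
          unfold Rdiv. rewrite Rmult_assoc, Rinv_l, Rmult_1_r by lra.
          apply Rle_trans with (1 := Hlc). apply Rmult_le_compat_l; [exact HC|].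
          apply pow_incr. lra. }
        replace (- 2 * l c / (E c + eps) ^ 3) with (- 2 * (l c / (E c + eps) ^ 3)) in Hgc
          by (field; lra). nra. }
    assert (HlimE : is_lim_seq (fun j => / (E (tj j) + eps) ^ 2 + 2 * C * tj j) (0 + 2 * C * T)).
    { apply is_lim_seq_plus'.
      - assert (H1 : is_lim_seq (fun j => / (E (tj j) + eps)) 0).
        { replace (Finite 0) with (Rbar_inv p_infty) by reflexivity.
          apply is_lim_seq_inv; [|discriminate].
          eapply is_lim_seq_plus; [exact HE|apply is_lim_seq_const|reflexivity]. }
        apply is_lim_seq_ext with (fun j => / (E (tj j) + eps) * / (E (tj j) + eps)).
        + intros j. simpl. rewrite Rmult_1_r, Rinv_mult. reflexivity.
        + replace (Finite 0) with (Finite (0 * 0)) by (f_equal; ring). now apply is_lim_seq_mult'.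
      - apply (is_lim_seq_scal_l tj (2 * C) T Hlim). }
    assert (Hbound : Rbar_le (g t) (0 + 2 * C * T)).
    { apply is_lim_seq_le_loc with (fun _ => g t) (fun j => / (E (tj j) + eps) ^ 2 + 2 * C * tj j);
        [|apply is_lim_seq_const|exact HlimE].
      assert (Hn : Rbar_locally T (fun y => t < y)) by exact (open_gt t T (proj2 Ht)).
      specialize (Hlim _ Hn). unfold filtermap in Hlim.
      apply filter_imp with (2 := Hlim). intros j Hj. apply (Hmono (tj j)). split; [exact Hj|apply Htj]. }
    simpl in Hbound. unfold g in Hbound.
    assert (Hsq : 0 < (E t + eps) ^ 2) by (apply pow_lt, Hpos; lra).
    apply Rmult_le_reg_l with (/ (E t + eps) ^ 2); [now apply Rinv_0_lt_compat|].
    replace (/ (E t + eps) ^ 2 * (2 * C * (T - t) * (E t + eps) ^ 2)) with (2 * C * T - 2 * C * t) by (field; pose proof (Hpos t ltac:(lra)); lra).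
    lra. }
  assert (Hint : forall t, 0 < t < T -> 1 <= 2 * C * (T - t) * E t ^ 2).
  { intros t Ht.
    replace (E t) with (E t + 0) by ring.
    apply (continuous_ge_right (fun eps => 2 * C * (T - t) * (E t + eps) ^ 2) 0 1 1 Rlt_0_1).
    - apply (ex_derive_continuous (V := R_NormedModule)). auto_derive. exact I.
    - intros eps He. apply Heps; lra. }
  (* The differential inequality is available at positive times only; at time 0 the bound is a limit
     from the right. *)
  intros t Ht. destruct (Rle_lt_or_eq_dec 0 t (proj1 Ht)) as [H|<-]; [apply Hint; lra|].
  apply (continuous_ge_right (fun t => 2 * C * (T - t) * E t ^ 2) 0 T 1 (proj2 Ht)).
  - assert (CE : continuous E 0) by now apply EC.
    simpl. contR; auto. apply continuous_id.
  - intros s Hs. apply Hint. lra.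
Qed.

(** * Geometric solutions *)

Definition xcoord (g : R -> R -> vec) t x := fst (g t x).
Definition ycoord (g : R -> R -> vec) t x := snd (g t x).

(** The curves are regular on [[0, T) x [0, 1]], while the kinematic formulas are used on an open
    set; restricting the domain to points of positive speed keeps it open. *)
Definition regular_part (O : vec -> Prop) (g : R -> R -> vec) (p : vec) : Prop :=
  O p /\ 0 < Dx (xcoord g) (fst p) (snd p) ^ 2 + Dx (ycoord g) (fst p) (snd p) ^ 2.

Lemma regular_part_open O g :
  open O -> smooth2 O (xcoord g) -> smooth2 O (ycoord g) -> open (regular_part O g).
Proof.
  intros HO Sa Sb [t x] [Hp Hr]. cbn [fst snd] in Hr.
  assert (C : continuity_2d_pt (fun t x => Dx (xcoord g) t x ^ 2 + Dx (ycoord g) t x ^ 2) t x).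
  { pose proof (smooth2_continuity _ _ _ _ (smooth2_Dx _ _ Sa) Hp).
    pose proof (smooth2_continuity _ _ _ _ (smooth2_Dx _ _ Sb) Hp). cont2d. }
  apply (filter_and _ _ (HO _ Hp)).
  apply (proj1 (continuity_2d_pt_filterlim _ _ _)) in C. exact (C _ (open_gt 0 _ Hr)).
Qed.

Section GeometricCurve.
Variables (phi : vec -> R) (g : R -> R -> vec).
Let a := xcoord g. Let b := ycoord g.

Lemma speed_vel t x : speed (g t) x = vel a b t x.
Proof.
  unfold speed, vlen, vel. f_equal. unfold dot, vDerive; cbn [fst snd].
  unfold a, b, xcoord, ycoord, Dx. ring.
Qed.

Lemma nu_nrm t x : nu (g t) x = nrm a b t x.
Proof.
  unfold nu, tau, nrm, nrm1, nrm2, perp, vscal. rewrite speed_vel. reflexivity.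
Qed.

Lemma kappa_rotx t x : 0 < vel a b t x -> kappa (g t) x = rotx a b t x / vel a b t x.
Proof.
  intros H. unfold kappa. rewrite nu_nrm, speed_vel.
  unfold dot, vscal, nrm, nrm1, nrm2; cbn [fst snd].
  change (fst (vDerive (vDerive (g t)) x)) with (Dx (Dx a) t x).
  change (snd (vDerive (vDerive (g t)) x)) with (Dx (Dx b) t x).
  unfold rotx. field. lra.
Qed.

Lemma curve_energy_dens t :
  (forall x, 0 <= x <= 1 -> 0 < vel a b t x /\ 0 < fN phi a b t x) ->
  curve_energy phi (g t) = RInt (dens phi a b t) 0 1.
Proof.
  intros H. unfold curve_energy, arc_integral. apply RInt_Rext; [lra|].
  intros x Hx. destruct (H x ltac:(lra)) as [Hv Hf].
  unfold kappa_phi. rewrite speed_vel, kappa_rotx, nu_nrm by exact Hv.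
  unfold psi. fold (polar_curv phi (nrm a b t x)).
  change (polar phi (nrm a b t x)) with (fN phi a b t x).
  change (polar_curv phi (nrm a b t x)) with (wN phi a b t x).
  unfold dens. field. lra.
Qed.

Lemma vspeed_law t x :
  0 < vel a b t x -> nrm1 a b t x ^ 2 + nrm2 a b t x ^ 2 = 1 ->
  (let n := nu (g t) x in
     vscal (dot (vDerive (fun s => g s x) t) n) n = vscal (psi phi n * kappa (g t) x) n) ->
  vspeed a b t x = fN phi a b t x * wN phi a b t x * rotx a b t x / vel a b t x.
Proof.
  intros Hv Hn. cbv zeta. rewrite kappa_rotx, nu_nrm by exact Hv.
  change (dot (vDerive (fun s => g s x) t) (nrm a b t x)) with (vspeed a b t x).
  change (psi phi (nrm a b t x)) with (fN phi a b t x * wN phi a b t x).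
  unfold vscal, nrm; cbn [fst snd]. intros H. injection H as H1 H2.
  set (V := vspeed a b t x) in *. set (k := fN phi a b t x * wN phi a b t x) in *.
  transitivity (V * (nrm1 a b t x ^ 2 + nrm2 a b t x ^ 2)); [rewrite Hn; ring|].
  transitivity ((V * nrm1 a b t x) * nrm1 a b t x + (V * nrm2 a b t x) * nrm2 a b t x); [ring|].
  rewrite H1, H2.
  transitivity (k * (rotx a b t x / vel a b t x) * (nrm1 a b t x ^ 2 + nrm2 a b t x ^ 2)); [ring|].
  rewrite Hn. field. lra.
Qed.
End GeometricCurve.

(* The constant C of the inequality E' <= C E^3. *)
Definition energy_growth (K : polar_constants) : R :=
  let w0 := psi_min K / polar_max K in
  let c3 := 6 / (junction_angle K * polar_min K) in
  let c4 := / (psi_min K * polar_min K) + (polar_grad_max K / polar_min K ^ 2) ^ 2 / (4 * w0) in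
  2 * (c4 + 2 * c3 ^ 2 / w0) ^ 2 / w0 * polar_max K ^ 3.

Section Flow.
Variables (phi : vec -> R) (h : polar_profile phi) (K : polar_constants).
Variables (T : R) (P : branch -> vec) (u : branch -> R -> R -> vec).
Hypothesis HK : admissible_constants phi K.
Hypothesis Hsol : geometric_solution phi T P u.

Let a i := xcoord (u i).
Let b i := ycoord (u i).
Let pm := psi_min K. Let fm := polar_min K. Let fM := polar_max K.
Let a0 := junction_angle K. Let G := polar_grad_max K.

Lemma unit_vec_pair n1 n2 : n1 ^ 2 + n2 ^ 2 = 1 -> unit_vec (n1, n2).
Proof.
  intros H. unfold unit_vec, vlen, dot; cbn [fst snd].
  replace (n1 * n1 + n2 * n2) with 1 by lra. apply sqrt_1.
Qed.

Let pm_pos : 0 < pm. Proof. apply HK. Qed.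
Let fm_pos : 0 < fm. Proof. apply HK. Qed.
Let a0_pos : 0 < a0. Proof. apply HK. Qed.
Let f_bounds n1 n2 : n1 ^ 2 + n2 ^ 2 = 1 -> fm <= polar phi (n1, n2) <= fM.
Proof. intros H. apply HK. now apply unit_vec_pair. Qed.
Let fM_pos : 0 < fM.
Proof. pose proof (f_bounds 1 0 ltac:(ring)). lra. Qed.
Let f_pos n1 n2 : n1 ^ 2 + n2 ^ 2 = 1 -> 0 < polar phi (n1, n2).
Proof. intros H. pose proof (f_bounds n1 n2 H). lra. Qed.
Let psi_lower n1 n2 : n1 ^ 2 + n2 ^ 2 = 1 -> pm <= polar phi (n1, n2) * polar_curv phi (n1, n2).
Proof. intros H. apply (proj1 (proj2 HK)). now apply unit_vec_pair. Qed.
Let w_pos n1 n2 : n1 ^ 2 + n2 ^ 2 = 1 -> 0 < polar_curv phi (n1, n2).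
Proof. intros H. pose proof (f_pos n1 n2 H). pose proof (psi_lower n1 n2 H). nra. Qed.
Let w_lower n1 n2 : n1 ^ 2 + n2 ^ 2 = 1 -> pm / fM <= polar_curv phi (n1, n2).
Proof.
  intros H. pose proof (f_bounds n1 n2 H). pose proof (psi_lower n1 n2 H). pose proof (w_pos n1 n2 H).
  apply Rmult_le_reg_r with fM; [exact fM_pos|]. unfold Rdiv. rewrite Rmult_assoc, Rinv_l by lra. nra.
Qed.
Let f1_bound n1 n2 : n1 ^ 2 + n2 ^ 2 = 1 -> Rabs (polar_dir phi (n1, n2)) <= G.
Proof.
  intros H. apply Rle_trans with (vlen (grad (polar phi) (n1, n2))).
  2: { apply HK. now apply unit_vec_pair. }
  unfold polar_dir, vlen, grad, dot; cbn [fst snd].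
  set (x := d1 (polar phi) (n1, n2)). set (y := d2 (polar phi) (n1, n2)).
  rewrite <- sqrt_Rsqr_abs. apply sqrt_le_1_alt. unfold Rsqr.
  replace (x * x + y * y) with ((x * x + y * y) * (n1 ^ 2 + n2 ^ 2)) by (rewrite H; ring).
  pose proof (pow2_ge_0 (x * n1 + y * n2)). nra.
Qed.

Lemma regular_domain i : exists O : vec -> Prop,
  open O /\ smooth2 O (a i) /\ smooth2 O (b i) /\
  (forall t x, O (t, x) -> 0 < Dx (a i) t x ^ 2 + Dx (b i) t x ^ 2) /\
  (forall t x, 0 <= t < T -> 0 <= x <= 1 -> O (t, x)).
Proof.
  destruct Hsol as [H1 [H2 _]]. destruct (H1 i) as [O [HO [Hin [Sa Sb]]]].
  assert (Sa' : smooth2 O (xcoord (u i))) by (intros n t x Hp; exact (Sa n (t, x) Hp)).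
  assert (Sb' : smooth2 O (ycoord (u i))) by (intros n t x Hp; exact (Sb n (t, x) Hp)).
  exists (regular_part O (u i)).
  split; [now apply regular_part_open|]. split; [intros n t x [Hp _]; now apply Sa'|].
  split; [intros n t x [Hp _]; now apply Sb'|]. split; [intros t x [_ Hp]; exact Hp|].
  intros t x Ht Hx. split; [now apply Hin|]. cbn [fst snd].
  assert (Hne : (Dx (xcoord (u i)) t x, Dx (ycoord (u i)) t x) <> vzero) by exact (H2 i t x Ht Hx).
  pose proof (pow2_ge_0 (Dx (xcoord (u i)) t x)). pose proof (pow2_ge_0 (Dx (ycoord (u i)) t x)).
  apply Rnot_le_lt. intros Hle. apply Hne. unfold vzero. f_equal; nra.
Qed.

Lemma regular_energy_dens i O t :
  open O -> (forall t x, O (t, x) -> 0 < Dx (a i) t x ^ 2 + Dx (b i) t x ^ 2) ->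
  (forall x, 0 <= x <= 1 -> O (t, x)) ->
  curve_energy phi (u i t) = RInt (dens phi (a i) (b i) t) 0 1.
Proof.
  intros HO Hr Ht. apply (curve_energy_dens phi (u i)). intros x Hx. split.
  - exact (vel_pos _ _ O Hr t x (Ht x Hx)).
  - apply f_pos. exact (normal_unit _ _ O Hr t x (Ht x Hx)).
Qed.

(** The reason for the strict inequality [0 < t] in what follows: an identity known on [[0, T)] can
    be differentiated at such times. *)
Lemma interval_locally t : 0 < t < T -> locally t (fun s => 0 <= s < T).
Proof.
  intros Ht. generalize (filter_and _ _ (open_gt 0 t (proj1 Ht)) (open_lt T t (proj2 Ht))).
  apply filter_imp. intros s Hs. lra.
Qed.

Variable w1 : vec -> R.
Hypothesis circle_w : circle_C1 (polar_curv phi) w1.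
Let circle_f : circle_C1 (polar phi) (polar_dir phi) := circle_polar phi h.

(** Time 0 is included, because the integral formula for the energy holds on a full neighbourhood of
    each such time; the continuity of the energy at 0 comes from here. *)
Lemma curve_energy_derive i t : 0 <= t < T ->
  is_derive (fun s => curve_energy phi (u i s)) t (RInt (dens_t phi w1 (a i) (b i) t) 0 1).
Proof.
  intros Ht. destruct (regular_domain i) as [O [HO [Sa [Sb [Hr Hin]]]]].
  apply is_derive_ext_loc with (fun s => RInt (dens phi (a i) (b i) s) 0 1).
  - apply filter_imp with (2 := tube O t 0 1 HO (fun x Hx => Hin t x Ht Hx)).
    intros s Hs. symmetry. now apply (regular_energy_dens i O s).
  - apply (energy_derive phi w1 (a i) (b i) O); auto.
Qed.

Let V i t x := vspeed (a i) (b i) t x.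
Let S i t x := vspeed_s (a i) (b i) t x.
Let v i t x := vel (a i) (b i) t x.
Let w0 := pm / fM.
Let c4 := / (pm * fm) + (G / fm ^ 2) ^ 2 / (4 * w0).

Let w0_pos : 0 < w0. Proof. now apply Rdiv_lt_0_compat. Qed.

Lemma vspeed_eq i t x : 0 <= t < T -> 0 <= x <= 1 ->
  V i t x = fN phi (a i) (b i) t x * wN phi (a i) (b i) t x * rotx (a i) (b i) t x / v i t x.
Proof.
  intros Ht Hx. destruct (regular_domain i) as [O [HO [Sa [Sb [Hr Hin]]]]].
  specialize (Hin t x Ht Hx).
  apply (vspeed_law phi (u i)).
  - exact (vel_pos _ _ O Hr t x Hin).
  - exact (normal_unit _ _ O Hr t x Hin).
  - destruct Hsol as [_ [_ [H _]]]. now apply H.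
Qed.

Lemma speed_at_fixed_end i t : 0 < t < T -> V i t 1 = 0 /\ tspeed (a i) (b i) t 1 = 0.
Proof.
  intros Ht. destruct Hsol as [_ [_ [_ [H _]]]].
  assert (E : Dt (a i) t 1 = 0 /\ Dt (b i) t 1 = 0).
  { split; apply is_derive_unique.
    - apply is_derive_ext_loc with (fun _ => fst (P i)).
      + apply filter_imp with (2 := interval_locally t Ht). intros s Hs.
        unfold a, xcoord. now rewrite H.
      + auto_derive; [exact I|reflexivity].
    - apply is_derive_ext_loc with (fun _ => snd (P i)).
      + apply filter_imp with (2 := interval_locally t Ht). intros s Hs.
        unfold b, ycoord. now rewrite H.
      + auto_derive; [exact I|reflexivity]. }
  destruct E as [E1 E2]. unfold V, vspeed, tspeed. rewrite E1, E2. split; ring.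
Qed.

Definition speed_sqr i t := RInt (fun x => V i t x ^ 2 * v i t x) 0 1.
Definition slope_sqr i t := RInt (fun x => S i t x ^ 2 * v i t x) 0 1.

(** [M] is left free: the bound for the speeds is chosen later for the three curves together. *)
Lemma curve_estimates i t : 0 < t < T ->
  0 <= speed_sqr i t <= fM * curve_energy phi (u i t) /\ 0 <= slope_sqr i t /\
  (forall x, 0 <= x <= 1 -> (V i t x ^ 2) ^ 2 <= 4 * speed_sqr i t * slope_sqr i t) /\
  forall M, (forall x, 0 <= x <= 1 -> V i t x ^ 2 <= M) ->
    RInt (dens_t phi w1 (a i) (b i) t) 0 1 <=
    - w0 * slope_sqr i t + c4 * (M * speed_sqr i t) - flux phi (a i) (b i) t 0.
Proof.
  intros Ht. destruct (regular_domain i) as [O [HO [Sa [Sb [Hr Hin0]]]]].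
  assert (Hin : forall x, 0 <= x <= 1 -> O (t, x)) by (intros; apply Hin0; lra).
  assert (Hn : forall x, 0 <= x <= 1 -> nrm1 (a i) (b i) t x ^ 2 + nrm2 (a i) (b i) t x ^ 2 = 1)
    by (intros x Hx; exact (normal_unit _ _ O Hr t x (Hin x Hx))).
  assert (Hv : forall x, 0 <= x <= 1 -> 0 < v i t x)
    by (intros x Hx; exact (vel_pos _ _ O Hr t x (Hin x Hx))).
  assert (C := fun x Hx => density_continuities phi w1 (a i) (b i) O circle_f circle_w f_pos w_pos HO Sa Sb Hr t x (Hin x Hx)).
  assert (Cd : forall x, 0 <= x <= 1 -> continuous (dens phi (a i) (b i) t) x).
  { intros x Hx. apply continuity_2d_pt_1d_x. destruct (C x Hx) as [H _]. exact H. }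
  assert (Cr : forall x, 0 <= x <= 1 -> continuous (rate phi (a i) (b i) t) x).
  { intros x Hx. apply continuity_2d_pt_1d_x. destruct (C x Hx) as [_ [_ [H _]]]. exact H. }
  assert (CS : forall x, 0 <= x <= 1 -> continuous (S i t) x).
  { intros x Hx. apply continuity_2d_pt_1d_x. destruct (C x Hx) as [_ [_ [_ [H _]]]]. exact H. }
  assert (CV : forall x, 0 <= x <= 1 -> continuous (V i t) x).
  { intros x Hx. apply continuity_2d_pt_1d_x. destruct (C x Hx) as [_ [_ [_ [_ [H _]]]]]. exact H. }
  assert (Cv : forall x, 0 <= x <= 1 -> continuous (v i t) x).
  { intros x Hx. apply continuity_2d_pt_1d_x. destruct (C x Hx) as [_ [_ [_ [_ [_ H]]]]]. exact H. }
  clear C.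
  destruct (weighted_square_nonneg (V i t) (S i t) (v i t) CV CS Cv Hv) as [HA HB].
  destruct (weighted_square_integrable (V i t) (S i t) (v i t) CV CS Cv) as [EA EB].
  assert (HV : forall x, 0 <= x <= 1 -> V i t x = fN phi (a i) (b i) t x * wN phi (a i) (b i) t x * rotx (a i) (b i) t x / v i t x)
    by (intros; apply vspeed_eq; lra).
  split; [split; [exact HA|]|split; [exact HB|split]].
  - rewrite (regular_energy_dens i O t HO Hr Hin).
    assert (Ed : ex_RInt (dens phi (a i) (b i) t) 0 1) by (apply ex_RInt_cont; [lra|exact Cd]).
    rewrite <- (RInt_Rmult _ _ _ _ Ed).
    apply RInt_le; [lra|exact EA|exact (ex_RInt_scal (V := R_NormedModule) _ _ _ fM Ed)|].
    intros x Hx. rewrite HV by lra. specialize (Hv x ltac:(lra)). specialize (Hn x ltac:(lra)).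
    pose proof (f_bounds _ _ Hn) as Hf. change (fm <= fN phi (a i) (b i) t x <= fM) in Hf.
    assert (Hd : 0 <= dens phi (a i) (b i) t x).
    { unfold dens, Rdiv. apply Rmult_le_pos; [|left; now apply Rinv_0_lt_compat].
      apply Rmult_le_pos; [|lra]. apply Rmult_le_pos; apply pow2_ge_0. }
    (* As [V = f kappa_phi], the integrand [V^2 ds] is [f] times the energy density. *)
    apply Rle_trans with (fN phi (a i) (b i) t x * dens phi (a i) (b i) t x).
    + right. unfold dens. fold (v i t x). field. lra.
    + apply Rmult_le_compat_r; lra.
  - apply sup_fourth_power; auto.
    + intros x Hx. evar_last.
      * exact (vspeed_derive_x (a i) (b i) O HO Sa Sb Hr t x (Hin x Hx)).
      * unfold S, vspeed_s, v. specialize (Hv x Hx). unfold v in Hv. field. lra.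
    + now apply speed_at_fixed_end.
  - intros M HM.
    rewrite (energy_rate phi w1 (a i) (b i) O circle_f circle_w f_pos w_pos HO Sa Sb Hr t Hin HV).
    assert (F1 : flux phi (a i) (b i) t 1 = 0).
    { unfold flux. destruct (speed_at_fixed_end i t Ht) as [E1 E2]. unfold V in E1. rewrite E1, E2.
      unfold Rdiv. ring. }
    rewrite F1.
    enough (RInt (rate phi (a i) (b i) t) 0 1 <= - w0 * slope_sqr i t + c4 * (M * speed_sqr i t)) by lra.
    pose proof (ex_RInt_scal (V := R_NormedModule) _ _ _ (- w0) EB) as EB'.
    pose proof (ex_RInt_scal (V := R_NormedModule) _ _ _ (c4 * M) EA) as EA'.
    replace (- w0 * slope_sqr i t + c4 * (M * speed_sqr i t)) with
      (RInt (fun x => - w0 * (S i t x ^ 2 * v i t x) + (c4 * M) * (V i t x ^ 2 * v i t x)) 0 1).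
    2:{ rewrite (RInt_Rplus (fun x => - w0 * (S i t x ^ 2 * v i t x))) by assumption.
        rewrite (RInt_Rmult _ (- w0) 0 1 EB), (RInt_Rmult _ (c4 * M) 0 1 EA).
        unfold slope_sqr, speed_sqr. ringR. }
    apply RInt_le; [lra|apply ex_RInt_cont; [lra|exact Cr]|exact (ex_RInt_plus (V := R_NormedModule) _ _ _ _ EB' EA')|].
    intros x Hx. specialize (Hn x ltac:(lra)). specialize (Hv x ltac:(lra)). specialize (HM x ltac:(lra)).
    apply Rle_trans with (- w0 * (S i t x ^ 2 * v i t x) + c4 * (V i t x ^ 2 * (V i t x ^ 2 * v i t x))).
    + apply (rate_bound (wN phi (a i) (b i) t x) (fN phi (a i) (b i) t x) (f1N phi (a i) (b i) t x)
        (S i t x) (V i t x) (v i t x) w0 fm pm G); auto.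
      * split; [exact w0_pos|]. now apply w_lower.
      * split; [exact fm_pos|]. now apply f_bounds.
      * split; [exact pm_pos|]. now apply psi_lower.
      * now apply f1_bound.
    + apply Rplus_le_compat_l. rewrite Rmult_assoc. apply Rmult_le_compat_l.
      * unfold c4. apply Rplus_le_le_0_compat.
        -- left. apply Rinv_0_lt_compat. now apply Rmult_lt_0_compat.
        -- unfold Rdiv. apply Rmult_le_pos; [apply pow2_ge_0|]. left. apply Rinv_0_lt_compat. lra.
      * apply Rmult_le_compat_r; [|exact HM]. apply Rmult_le_pos; [apply pow2_ge_0|lra].
Qed.
Lemma in_regular_domain i t x : 0 <= t < T -> 0 <= x <= 1 ->
  0 < v i t x /\ nrm1 (a i) (b i) t x ^ 2 + nrm2 (a i) (b i) t x ^ 2 = 1.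
Proof.
  intros Ht Hx. destruct (regular_domain i) as [O [HO [Sa [Sb [Hr Hin]]]]].
  specialize (Hin t x Ht Hx). split.
  - exact (vel_pos _ _ O Hr t x Hin).
  - exact (normal_unit _ _ O Hr t x Hin).
Qed.

(** * Speeds and boundary terms at the triple junction *)

Lemma common_junction_speed i j t : 0 < t < T ->
  Dt (a i) t 0 = Dt (a j) t 0 /\ Dt (b i) t 0 = Dt (b j) t 0.
Proof.
  intros Ht. destruct Hsol as [_ [_ [_ [_ [H _]]]]].
  assert (E : forall s, 0 <= s < T -> u i s 0 = u j s 0).
  { intros s Hs. destruct (H s Hs) as [H1 H2]. destruct i, j; congruence. }
  split; apply Derive_ext_loc; apply filter_imp with (2 := interval_locally t Ht);
    intros s Hs; unfold a, b, xcoord, ycoord; now rewrite E.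
Qed.

(* Differentiating the Herring condition in time. *)
Lemma junction_rotation t : 0 < t < T ->
  let w i := wN phi (a i) (b i) t 0 * rott (a i) (b i) t 0 in
  sum3 (fun i => nrm1 (a i) (b i) t 0 * w i) = 0 /\
  sum3 (fun i => nrm2 (a i) (b i) t 0 * w i) = 0.
Proof.
  intros Ht w. destruct Hsol as [_ [_ [_ [_ [_ H]]]]].
  assert (D : forall k k1, circle_C1 k k1 -> forall i,
    is_derive (fun s => k (nrm (a i) (b i) s 0)) t (k1 (nrm (a i) (b i) t 0) * rott (a i) (b i) t 0)).
  { intros k k1 Hk i. destruct (regular_domain i) as [O [HO [Sa [Sb [Hr Hin]]]]].
    apply (circle_along_t (a i) (b i) O HO Sa Sb Hr k k1 t 0 Hk). apply Hin; lra. }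
  assert (E : forall s, 0 <= s < T ->
    sum3 (fun i => d1 (polar phi) (nrm (a i) (b i) s 0)) = 0 /\
    sum3 (fun i => d2 (polar phi) (nrm (a i) (b i) s 0)) = 0).
  { intros s Hs. specialize (H s Hs). unfold vsum3, vadd, grad, vzero in H; cbn [fst snd] in H.
    rewrite !nu_nrm in H. injection H as H1 H2. unfold sum3, a, b. split; assumption. }
  assert (Dsum : forall k k1, circle_C1 k k1 ->
    (forall s, 0 <= s < T -> sum3 (fun i => k (nrm (a i) (b i) s 0)) = 0) ->
    sum3 (fun i => k1 (nrm (a i) (b i) t 0) * rott (a i) (b i) t 0) = 0).
  { intros k k1 Hk Hz. apply (is_derive_zero_near (fun s => sum3 (fun i => k (nrm (a i) (b i) s 0))) t).
    - unfold sum3. pose proof (D k k1 Hk) as Dk.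
      apply (is_derive_plus (fun s => k (nrm (a B1) (b B1) s 0) + k (nrm (a B2) (b B2) s 0))); [|apply Dk].
      apply (is_derive_plus (fun s => k (nrm (a B1) (b B1) s 0))); apply Dk.
    - apply filter_imp with (2 := interval_locally t Ht). exact Hz. }
  pose proof (Dsum _ _ (circle_d1_polar phi h) (fun s Hs => proj1 (E s Hs))) as H1.
  pose proof (Dsum _ _ (circle_d2_polar phi h) (fun s Hs => proj2 (E s Hs))) as H2.
  unfold sum3 in *. cbv beta in H1, H2. unfold w, wN.
  assert (Ep : forall i, fst (nrm (a i) (b i) t 0) = nrm1 (a i) (b i) t 0 /\
    snd (nrm (a i) (b i) t 0) = nrm2 (a i) (b i) t 0) by (intros; split; reflexivity).
  destruct (Ep B1) as [P1 Q1], (Ep B2) as [P2 Q2], (Ep B3) as [P3 Q3].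
  rewrite P1, P2, P3 in H2. rewrite Q1, Q2, Q3 in H1. split; lra.
Qed.

(** Write the common velocity in the frame of curve [j] and pair it with the normal of curve [i]:
    V^i = (nu^i . nu^j) V^j + (nu^i . tau^j) lambda^j. The coefficient of lambda^j is at least [a0]
    in absolute value, the other one at most 1. *)
Lemma junction_tspeed i j t : 0 < t < T -> i <> j ->
  a0 * Rabs (tspeed (a j) (b j) t 0) <= Rabs (V i t 0) + Rabs (V j t 0).
Proof.
  intros Ht Hij. destruct (common_junction_speed i j t Ht) as [Ea Eb].
  destruct (in_regular_domain i t 0 ltac:(lra) ltac:(lra)) as [_ Hi].
  destruct (in_regular_domain j t 0 ltac:(lra) ltac:(lra)) as [_ Hj].
  assert (Ha : a0 <= Rabs (dot (nrm (a i) (b i) t 0) (unperp (nrm (a j) (b j) t 0)))).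
  { destruct HK as [_ [_ [_ [H _]]]].
    apply (H (fun k => nrm (a k) (b k) t 0)); [| |exact Hij].
    - intros k. apply unit_vec_pair. now apply in_regular_domain; lra.
    - destruct Hsol as [_ [_ [_ [_ [_ H']]]]]. specialize (H' t ltac:(lra)).
      unfold vsum3 in *. rewrite !nu_nrm in H'. exact H'. }
  unfold dot, unperp, nrm in Ha; cbn [fst snd] in Ha.
  unfold V, vspeed, tspeed. rewrite Ea, Eb.
  set (p := Dt (a j) t 0). set (q := Dt (b j) t 0).
  set (m1 := nrm1 (a i) (b i) t 0) in *. set (m2 := nrm2 (a i) (b i) t 0) in *.
  set (n1 := nrm1 (a j) (b j) t 0) in *. set (n2 := nrm2 (a j) (b j) t 0) in *.
  set (c := m1 * n1 + m2 * n2).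
  assert (Hc : Rabs c <= 1).
  { apply Rabs_le. unfold c. pose proof (pow2_ge_0 (m1 - n1)). pose proof (pow2_ge_0 (m2 - n2)).
    pose proof (pow2_ge_0 (m1 + n1)). pose proof (pow2_ge_0 (m2 + n2)). nra. }
  assert (E : (m1 * n2 + m2 * - n1) * (p * n2 - q * n1) = (p * m1 + q * m2) - c * (p * n1 + q * n2)).
  { unfold c. transitivity ((p * m1 + q * m2) * (n1 ^ 2 + n2 ^ 2) - (m1 * n1 + m2 * n2) * (p * n1 + q * n2)); [ring|].
    rewrite Hj. ring. }
  apply Rle_trans with (Rabs (m1 * n2 + m2 * - n1) * Rabs (p * n2 - q * n1)).
  { apply Rmult_le_compat_r; [apply Rabs_pos|exact Ha]. }
  rewrite <- Rabs_mult, E. unfold Rminus. apply Rle_trans with (1 := Rabs_triang _ _).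
  apply Rplus_le_compat_l. rewrite Rabs_Ropp, Rabs_mult.
  pose proof (Rabs_pos (p * n1 + q * n2)). nra.
Qed.

(** Each lambda is at most [2 M / a0], so each of the three remaining terms lambda V^2 / f is at
    most [2 M^3 / (a0 fm)]: hence the 6. Here [M] bounds the speeds themselves, not their
    squares. *)
Lemma junction_flux t M : 0 < t < T -> (forall i, V i t 0 ^ 2 <= M ^ 2) -> 0 <= M ->
  - sum3 (fun i => flux phi (a i) (b i) t 0) <= 6 / (a0 * fm) * M ^ 3.
Proof.
  intros Ht HM HM0.
  assert (HVM : forall i, Rabs (V i t 0) <= M).
  { intros i.
    rewrite <- (Rabs_pos_eq M HM0). apply Rsqr_le_abs_0. unfold Rsqr. specialize (HM i). lra. }
  assert (Hl : forall i, Rabs (tspeed (a i) (b i) t 0) <= 2 * M / a0).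
  { intros i. assert (Hj : exists j, j <> i) by (destruct i; [exists B2|exists B1|exists B1]; discriminate).
    destruct Hj as [j Hj]. pose proof (junction_tspeed j i t Ht Hj). pose proof (HVM i). pose proof (HVM j).
    apply Rmult_le_reg_l with a0; [exact a0_pos|]. replace (a0 * (2 * M / a0)) with (2 * M) by (field; lra). lra. }
  set (la := fun i => tspeed (a i) (b i) t 0).
  set (f := fun i => fN phi (a i) (b i) t 0).
  assert (Hf : forall i, fm <= f i).
  { intros i. apply f_bounds. apply in_regular_domain; lra. }
  set (w := fun i => wN phi (a i) (b i) t 0 * rott (a i) (b i) t 0).
  (* Insert V_s = theta_t - lambda kappa. By the flow law, 2 w V lambda kappa is 2 lambda V^2 / f,
     while the other part of the flux is lambda V^2 / f, so one negative copy remains. *)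
  assert (Hflux : forall i, flux phi (a i) (b i) t 0 = 2 * (V i t 0 * w i) - la i * V i t 0 ^ 2 / f i).
  { intros i. destruct (in_regular_domain i t 0 ltac:(lra) ltac:(lra)) as [Hv Hn].
    pose proof (f_pos _ _ Hn) as Hfp. change (0 < f i) in Hfp.
    pose proof (w_pos _ _ Hn) as Hwp. change (0 < wN phi (a i) (b i) t 0) in Hwp.
    pose proof (vspeed_eq i t 0 ltac:(lra) ltac:(lra)) as HV. fold (f i) in HV.
    unfold flux, vspeed_s. fold (V i t 0). fold (la i). fold (f i). fold (v i t 0). unfold w.
    rewrite HV. field. lra. }
  assert (Hw : sum3 (fun i => V i t 0 * w i) = 0).
  { destruct (junction_rotation t Ht) as [H1 H2].
    destruct (common_junction_speed B1 B2 t Ht) as [Ea2 Eb2].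
    destruct (common_junction_speed B1 B3 t Ht) as [Ea3 Eb3].
    unfold sum3 in *. unfold V, vspeed. rewrite <- Ea2, <- Eb2, <- Ea3, <- Eb3.
    fold (w B1) (w B2) (w B3) in H1, H2.
    set (p := Dt (a B1) t 0). set (q := Dt (b B1) t 0).
    transitivity (p * (nrm1 (a B1) (b B1) t 0 * w B1 + nrm1 (a B2) (b B2) t 0 * w B2 + nrm1 (a B3) (b B3) t 0 * w B3)
      + q * (nrm2 (a B1) (b B1) t 0 * w B1 + nrm2 (a B2) (b B2) t 0 * w B2 + nrm2 (a B3) (b B3) t 0 * w B3)); [ring|].
    rewrite H1, H2. ring. }
  assert (Hb : forall i, la i * V i t 0 ^ 2 / f i <= 2 / (a0 * fm) * M ^ 3).
  { intros i. specialize (Hf i).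
    apply Rle_trans with (2 * M / a0 * M ^ 2 / fm).
    2: { right. field. lra. }
    apply Rle_trans with (Rabs (la i) * V i t 0 ^ 2 / f i).
    { unfold Rdiv. apply Rmult_le_compat_r; [left; apply Rinv_0_lt_compat; lra|].
      apply Rmult_le_compat_r; [apply pow2_ge_0|apply Rle_abs]. }
    unfold Rdiv at 1 2. apply Rmult_le_compat.
    - apply Rmult_le_pos; [apply Rabs_pos|apply pow2_ge_0].
    - left. apply Rinv_0_lt_compat. lra.
    - apply Rmult_le_compat; [apply Rabs_pos|apply pow2_ge_0|apply Hl|apply HM].
    - apply Rinv_le_contravar; lra. }
  unfold sum3 in *. rewrite 3!Hflux. pose proof (Hb B1). pose proof (Hb B2). pose proof (Hb B3).
  replace (6 / (a0 * fm) * M ^ 3) with (3 * (2 / (a0 * fm) * M ^ 3)) by (field; lra). lra.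
Qed.

(** * Growth of the total energy *)

(** The junction couples the curves, so the interpolation is applied to the sums [SA] and [SB]. In
    [energy_growth], [w0] bounds [w = psi / f] from below, [c3] is the junction coefficient, [c4]
    that of the interior terms, and [polar_max K ^ 3] comes from [SA <= fM * E]. *)
Lemma energy_growth_bound t : 0 < t < T ->
  sum3 (fun i => RInt (dens_t phi w1 (a i) (b i) t) 0 1) <= energy_growth K * energy phi u t ^ 3.
Proof.
  intros Ht.
  set (A := fun i => speed_sqr i t). set (B := fun i => slope_sqr i t).
  assert (HAB := fun i => curve_estimates i t Ht).
  assert (HA : forall i, 0 <= A i <= fM * curve_energy phi (u i t)) by (intros i; destruct (HAB i) as [H _]; exact H).
  assert (HB : forall i, 0 <= B i) by (intros i; destruct (HAB i) as [_ [H _]]; exact H).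
  set (SA := sum3 A). set (SB := sum3 B).
  assert (HSA : forall i, 0 <= A i <= SA).
  { intros i. unfold SA, sum3. pose proof (HA B1). pose proof (HA B2). pose proof (HA B3). destruct i; lra. }
  assert (HSB : forall i, 0 <= B i <= SB).
  { intros i. unfold SB, sum3. pose proof (HB B1). pose proof (HB B2). pose proof (HB B3). destruct i; lra. }
  pose proof (HSA B1). pose proof (HSB B1).
  assert (HSAB : 0 <= 4 * SA * SB) by (apply Rmult_le_pos; lra).
  (* By the choice [M ^ 4 = 4 * SA * SB], the number [M] bounds the speeds of all three curves and
     meets the hypothesis of [interpolation_absorb]. *)
  set (M := sqrt (sqrt (4 * SA * SB))).
  assert (HM0 : 0 <= M) by apply sqrt_pos.
  assert (HM2 : M ^ 2 = sqrt (4 * SA * SB)) by (apply pow2_sqrt, sqrt_pos).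
  assert (HM4 : (M ^ 2) ^ 2 = 4 * SA * SB) by (rewrite HM2; now apply pow2_sqrt).
  assert (HVM : forall i x, 0 <= x <= 1 -> V i t x ^ 2 <= M ^ 2).
  { intros i x Hx. rewrite HM2. apply Rle_trans with (sqrt ((V i t x ^ 2) ^ 2)).
    - rewrite sqrt_pow2; [lra|apply pow2_ge_0].
    - apply sqrt_le_1_alt. apply Rle_trans with (4 * A i * B i).
      + destruct (HAB i) as [_ [_ [H1 _]]]. now apply H1.
      + apply Rmult_le_compat; try apply HSB; [specialize (HSA i); lra|specialize (HSA i); lra]. }
  assert (HR : forall i, RInt (dens_t phi w1 (a i) (b i) t) 0 1 <=
      - w0 * B i + c4 * (M ^ 2 * A i) - flux phi (a i) (b i) t 0).
  { intros i. destruct (HAB i) as [_ [_ [_ H1]]]. apply H1. apply HVM. }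
  pose proof (junction_flux t M Ht (fun i => HVM i 0 ltac:(lra)) HM0) as HJ.
  pose proof (interpolation_absorb M SA SB (6 / (a0 * fm)) c4 w0 HM0 ltac:(lra) ltac:(lra) w0_pos ltac:(lra)) as HI.
  set (C1 := 2 * (c4 + 2 * (6 / (a0 * fm)) ^ 2 / w0) ^ 2 / w0) in *.
  assert (HC1 : 0 <= C1).
  { unfold C1, Rdiv at 1. apply Rmult_le_pos; [|left; now apply Rinv_0_lt_compat].
    apply Rmult_le_pos; [lra|apply pow2_ge_0]. }
  change (energy_growth K) with (C1 * fM ^ 3).
  assert (HE : SA <= fM * energy phi u t).
  { unfold SA, energy, sum3. pose proof (HA B1). pose proof (HA B2). pose proof (HA B3). lra. }
  apply Rle_trans with (C1 * SA ^ 3).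
  - pose proof (HR B1). pose proof (HR B2). pose proof (HR B3). unfold SA, SB, sum3 in HI, HJ |- *.
    unfold SA, SB, sum3 in HI. lra.
  - rewrite Rmult_assoc. apply Rmult_le_compat_l; [exact HC1|].
    rewrite <- Rpow_mult_distr. apply pow_incr. lra.
Qed.
(** The energy is the squared L2 norm with the additional weight [f], and [f <= fM]. This links the
    blow-up bound at time 0 to the last inequality of the theorem. *)
Lemma curve_energy_L2 i t : 0 <= t < T ->
  0 <= curve_energy phi (u i t) <= fM * L2_norm (u i t) (kappa_phi phi (u i t)) ^ 2.
Proof.
  intros Ht. destruct (regular_domain i) as [O [HO [Sa [Sb [Hr Hin0]]]]].
  assert (Hin : forall x, 0 <= x <= 1 -> O (t, x)) by (intros; apply Hin0; lra).
  assert (Hpos : forall x, 0 <= x <= 1 -> 0 < v i t x /\ fm <= fN phi (a i) (b i) t x <= fM).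
  { intros x Hx. split; [exact (vel_pos _ _ O Hr t x (Hin x Hx))|].
    apply f_bounds. exact (normal_unit _ _ O Hr t x (Hin x Hx)). }
  set (d := dens phi (a i) (b i) t). set (f := fN phi (a i) (b i) t).
  assert (Cd : forall x, 0 <= x <= 1 -> continuous d x).
  { intros x Hx. apply continuity_2d_pt_1d_x.
    destruct (density_continuities phi w1 (a i) (b i) O circle_f circle_w f_pos w_pos HO Sa Sb Hr t x (Hin x Hx))
      as [H _]. exact H. }
  assert (Cf : forall x, 0 <= x <= 1 -> continuous f x).
  { intros x Hx. exact (is_derive_continuous _ _ _
      (circle_along_x (a i) (b i) O HO Sa Sb Hr _ _ t x circle_f (Hin x Hx))). }
  assert (Cq : forall x, 0 <= x <= 1 -> continuous (fun x => d x * / f x) x).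
  { intros x Hx. contR; [now apply Cd|]. apply continuous_Rinv_comp; [now apply Cf|].
    destruct (Hpos x Hx). unfold f. lra. }
  assert (Hd : forall x, 0 <= x <= 1 -> 0 <= d x /\ 0 <= d x * / f x).
  { intros x Hx. destruct (Hpos x Hx) as [Hv Hf].
    assert (0 <= d x).
    { unfold d, dens, Rdiv. apply Rmult_le_pos; [|left; now apply Rinv_0_lt_compat].
      apply Rmult_le_pos; [|lra]. apply Rmult_le_pos; apply pow2_ge_0. }
    split; [assumption|]. apply Rmult_le_pos; [assumption|]. left. apply Rinv_0_lt_compat. unfold f. lra. }
  assert (Ed : ex_RInt d 0 1) by (apply ex_RInt_cont; [lra|exact Cd]).
  assert (Eq : ex_RInt (fun x => d x * / f x) 0 1) by (apply ex_RInt_cont; [lra|exact Cq]).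
  assert (Hint : arc_integral (u i t) (fun x => kappa_phi phi (u i t) x ^ 2) = RInt (fun x => d x * / f x) 0 1).
  { unfold arc_integral. apply RInt_Rext; [lra|]. intros x Hx. destruct (Hpos x ltac:(lra)) as [Hv Hf].
    unfold kappa_phi. rewrite speed_vel, kappa_rotx, nu_nrm by exact Hv.
    unfold psi. fold (polar_curv phi (nrm (xcoord (u i)) (ycoord (u i)) t x)).
    change (polar phi (nrm (xcoord (u i)) (ycoord (u i)) t x)) with (f x).
    change (polar_curv phi (nrm (xcoord (u i)) (ycoord (u i)) t x)) with (wN phi (a i) (b i) t x).
    change (vel (xcoord (u i)) (ycoord (u i)) t x) with (v i t x).
    change (rotx (xcoord (u i)) (ycoord (u i)) t x) with (rotx (a i) (b i) t x).
    unfold d, dens. fold f. fold (v i t x). change (fN phi (a i) (b i) t x) with (f x) in Hf |- *.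
    field. lra. }
  assert (Hnn : 0 <= RInt (fun x => d x * / f x) 0 1).
  { apply RInt_ge_0; [lra|exact Eq|]. intros; apply Hd; lra. }
  unfold L2_norm. rewrite Hint, pow2_sqrt by exact Hnn.
  rewrite (regular_energy_dens i O t HO Hr Hin). fold d. split.
  - apply RInt_ge_0; [lra|exact Ed|]. intros; apply Hd; lra.
  - rewrite <- (RInt_Rmult _ _ _ _ Eq).
    apply RInt_le; [lra|exact Ed|exact (ex_RInt_scal (V := R_NormedModule) _ _ _ fM Eq)|].
    intros x Hx. destruct (Hpos x ltac:(lra)) as [Hv Hf]. destruct (Hd x ltac:(lra)) as [_ H].
    change (fN phi (a i) (b i) t x) with (f x) in Hf.
    apply Rle_trans with (f x * (d x * / f x)); [right; field; lra|].
    apply Rmult_le_compat_r; lra.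
Qed.

Lemma energy_derive_along_flow t : 0 <= t < T ->
  is_derive (energy phi u) t (sum3 (fun i => RInt (dens_t phi w1 (a i) (b i) t) 0 1)).
Proof.
  intros Ht. unfold energy, sum3.
  apply (is_derive_plus (fun t => curve_energy phi (u B1 t) + curve_energy phi (u B2 t)));
    [|now apply curve_energy_derive].
  apply (is_derive_plus (fun t => curve_energy phi (u B1 t))); now apply curve_energy_derive.
Qed.
End Flow.

(** * The constant and the conclusion *)

(** The square root comes from [1 <= 2 C (T - t) E^2], the factor with [polar_max K] from the
    comparison of the energy with the L2 norms, so that one constant serves both conclusions. The
    maxima with 1 make it positive for every [K], admissible or not. *)
Definition blow_up_constant (K : polar_constants) : R :=
  / (sqrt (Rmax 1 (2 * energy_growth K)) * Rmax 1 (polar_max K)).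

Theorem lemma5p2 :
  exists Cst : polar_constants -> R -> R,
    (forall (K : polar_constants) (delta : R), 0 < Cst K delta) /\
    forall phi : vec -> R,
      anisotropy phi -> smooth_anisotropy phi -> elliptic phi ->
      (exists K : polar_constants, admissible_constants phi K) /\
      forall (K : polar_constants) (delta T : R) (P : branch -> vec)
             (u : branch -> R -> R -> vec),
        admissible_constants phi K ->
        0 < delta ->
        0 < T ->
        geometric_solution phi T P u ->
        (forall (i : branch) (t : R), 0 <= t < T -> delta <= curve_length (u i t)) ->
        (exists tj : nat -> R,
           (forall j, 0 <= tj j < T) /\
           is_lim_seq tj T /\
           is_lim_seq (fun j => energy phi u (tj j)) p_infty) ->
        (forall t : R, 0 <= t < T ->
           energy phi u t >= Cst K delta / sqrt (T - t)) /\
        sqrt T >= Cst K delta /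
          sum3 (fun i => (L2_norm (u i 0) (kappa_phi phi (u i 0)))^2).
Proof.
  exists (fun K _ => blow_up_constant K).
  assert (HD : forall K, 0 < sqrt (Rmax 1 (2 * energy_growth K))).
  { intros K. apply sqrt_lt_R0. pose proof (Rmax_l 1 (2 * energy_growth K)). lra. }
  split.
  { intros K _. apply Rinv_0_lt_compat, Rmult_lt_0_compat; [apply HD|].
    pose proof (Rmax_l 1 (polar_max K)). lra. }
  intros phi Hn Hs He. split; [now apply admissible_constants_exist|].
  intros K delta T P u HK _ HT Hsol _ [tj [Htj [Hlim HE]]].
  destruct (polar_profile_exists phi Hn Hs He) as [h _].
  destruct (circle_polar_curv phi h) as [w1 Hw].
  specialize (HD K). unfold blow_up_constant.
  set (D := Rmax 1 (2 * energy_growth K)) in *. set (F := Rmax 1 (polar_max K)).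
  assert (HD1 : 1 <= D) by apply Rmax_l.
  assert (HF1 : 1 <= F) by apply Rmax_l. assert (HFM : polar_max K <= F) by apply Rmax_r.
  assert (HDg : energy_growth K <= D / 2).
  { pose proof (Rmax_r 1 (2 * energy_growth K)). fold D in H. lra. }
  assert (HL2 : forall i t, 0 <= t < T -> 0 <= curve_energy phi (u i t) <=
      polar_max K * L2_norm (u i t) (kappa_phi phi (u i t)) ^ 2).
  { intros i t Ht. exact (curve_energy_L2 phi h K T P u HK Hsol w1 Hw i t Ht). }
  assert (Epos : forall t, 0 <= t < T -> 0 <= energy phi u t).
  { intros t Ht. unfold energy, sum3. pose proof (HL2 B1 t Ht). pose proof (HL2 B2 t Ht). pose proof (HL2 B3 t Ht). lra. }
  pose proof (energy_derive_along_flow phi h K T P u HK Hsol w1 Hw) as ED.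
  assert (Hblow : forall t, 0 <= t < T -> 1 <= energy phi u t * sqrt D * sqrt (T - t)).
  { intros t Ht.
    assert (Hgrow : forall t, 0 < t < T -> sum3 (fun i =>
        RInt (dens_t phi w1 (xcoord (u i)) (ycoord (u i)) t) 0 1) <= D / 2 * energy phi u t ^ 3).
    { intros s Hs'. apply Rle_trans with (1 := energy_growth_bound phi h K T P u HK Hsol w1 Hw s Hs').
      apply Rmult_le_compat_r; [|exact HDg]. apply pow_le, Epos. lra. }
    (* With the growth constant enlarged to [D / 2], the bound reads [1 <= D * (T - t) * E ^ 2], and
       the claim is its square root. *)
    pose proof (blow_up_rate (energy phi u) _ T (D / 2) tj ltac:(lra) Epos
      (fun t Ht => is_derive_continuous _ _ _ (ED t Ht))
      (fun t Ht => ED t (conj (Rlt_le _ _ (proj1 Ht)) (proj2 Ht)))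
      Hgrow Hlim (fun j => proj2 (Htj j)) HE t Ht) as HB.
    set (y := energy phi u t * sqrt D * sqrt (T - t)).
    assert (Hy : 0 <= y).
    { apply Rmult_le_pos; [apply Rmult_le_pos|]; [now apply Epos|lra|apply sqrt_pos]. }
    assert (Hy2 : y ^ 2 = 2 * (D / 2) * (T - t) * energy phi u t ^ 2).
    { unfold y. rewrite !Rpow_mult_distr, !pow2_sqrt by lra. field. }
    nra. }
  (* Used with [s = sqrt (T - t)] and [y] the energy, then with [s] the sum of squared L2 norms and
     [y = sqrt T]. *)
  assert (Hconst : forall s y, 0 < s -> 1 <= y * F * sqrt D * s -> / (sqrt D * F) / s <= y).
  { intros s y Hs' Hy. apply Rmult_le_reg_r with (sqrt D * F * s).
    - apply Rmult_lt_0_compat; [|exact Hs']. apply Rmult_lt_0_compat; lra.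
    - replace (/ (sqrt D * F) / s * (sqrt D * F * s)) with 1 by (field; lra). lra. }
  split.
  - intros t Ht. apply Rle_ge.
    assert (Hsq : 0 < sqrt (T - t)) by (apply sqrt_lt_R0; lra).
    apply Hconst; [exact Hsq|]. specialize (Hblow t Ht).
    replace (energy phi u t * F * sqrt D * sqrt (T - t)) with
      (energy phi u t * sqrt D * sqrt (T - t) * F) by ring. nra.
  - assert (H0 : 0 <= 0 < T) by lra. specialize (Hblow 0 H0). rewrite Rminus_0_r in Hblow.
    set (S := sum3 _).
    assert (HSE : energy phi u 0 <= F * S).
    { assert (Hi : forall i, curve_energy phi (u i 0) <= F * L2_norm (u i 0) (kappa_phi phi (u i 0)) ^ 2).
      { intros i. apply Rle_trans with (1 := proj2 (HL2 i 0 H0)).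
        apply Rmult_le_compat_r; [apply pow2_ge_0|exact HFM]. }
      unfold energy, S, sum3. pose proof (Hi B1). pose proof (Hi B2). pose proof (Hi B3). lra. }
    assert (HsT : 0 < sqrt T) by now apply sqrt_lt_R0.
    assert (Hprod : 0 < sqrt D * sqrt T) by now apply Rmult_lt_0_compat.
    assert (H1 : 1 <= F * S * (sqrt D * sqrt T)).
    { apply Rle_trans with (1 := Hblow). rewrite Rmult_assoc. apply Rmult_le_compat_r; lra. }
    (* The division by the sum of squared norms is legitimate: [H1] would fail if the sum were not
       positive. *)
    assert (HS : 0 < S).
    { apply Rnot_le_lt. intros HS. assert (F * S <= 0) by nra. nra. }
    apply Rle_ge, Hconst; [exact HS|].
    replace (sqrt T * F * sqrt D * S) with (F * S * (sqrt D * sqrt T)) by ring. exact H1.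
Qed.
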